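(* Let $a:\mathbb{R}\to\mathbb{R}$ be a Lipschitz function such that for some $\lambda>0$ and all $x,y\in\mathbb{R}$ $$(a(x)-a(y))(x-y)\leq -\lambda (x-y)^2.$$ Let $\varphi$ be a random dynamical system that corresponds to the Arratia flow with drift $a$ (as defined in the context). Then there exists a unique (up to almost sure equality) stationary point $\eta$ for the random dynamical system $\varphi$.
   Context: **Stochastic flow.** A stochastic flow on $\mathbb{R}$ is a family $\{\psi_{s,t}:-\infty<s\le t<\infty\}$ of measurable random mappings of $\mathbb{R}$ such that: (1) for all $r\le s\le t$, $x\in\mathbb{R}$, $\omega\in\Omega$: $\psi_{s,t}(\omega,\psi_{r,s}(\omega,x))=\psi_{r,t}(\omega,x)$ and $\psi_{s,s}(\omega,x)=x$; (2) for $t_1<\dots<t_n$ the mappings $\psi_{t_1,t_2},\dots,\psi_{t_{n-1},t_n}$ are independent, and $\psi_{t_1,t_2}$ is equal in distribution to $\psi_{0,t_2-t_1}$. **Coalescing semigroups.** Let $a:\mathbb{R}\to\mathbb{R}$ be Lipschitz and let $P^{(1)}_t(x,A)=\mathbb{P}(X_x(t)\in A)$ be the Feller transition semigroup of the SDE $dX(t)=a(X(t))dt+dw(t)$, $w$ a Wiener process, where $X_x$ is the strong solution started at $x$. Let $P^{(n),ind.}_t$ be the Feller transition semigroup on $\mathbb{R}^n$ with $P^{(n),ind.}_t((x_1,\dots,x_n),A_1\times\dots\times A_n)=\prod_{i=1}^n P^{(1)}_t(x_i,A_i)$ ($n$ solutions driven by independent Wiener processes). A sequence $\{P^{(n)}_t:n\ge1\}$,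 with $P^{(n)}_t$ a transition semigroup on $\mathbb{R}^n$, is consistent if for all $t\ge 0$, $x\in\mathbb{R}^n$, $1\le i_1<\dots<i_k\le n$, Borel $B_k\subset\mathbb{R}^k$ and $C_n=\{y\in\mathbb{R}^n:(y_{i_1},\dots,y_{i_k})\in B_k\}$ one has $P^{(n)}_t(x,C_n)=P^{(k)}_t((x_{i_1},\dots,x_{i_k}),B_k)$. It is known that there is a unique consistent sequence of Feller transition semigroups $\{P^{(n),c}_t:n\ge 1\}$ (the coalescing transition semigroups), with $P^{(n),c}_t$ on $\mathbb{R}^n$, such that: (i) $P^{(2),c}_t((x,x),\Delta)=1$ for all $x\in\mathbb{R}$, $t\ge0$, where $\Delta=\{(y,y):y\in\mathbb{R}\}$; (ii) for every $x\in\mathbb{R}^n$, if $X$ and $\tilde X$ are Feller processes started at $x$ with transition probabilities $P^{(n),c}_t$ and $P^{(n),ind.}_t$ respectively, and $\tau$, $\tilde\tau$ are the first times at which two of the coordinates of $X$, respectively $\tilde X$, coincide, then the stopped processes $X(\cdot\wedge\tau)$ and $\tilde X(\cdot\wedge\tilde\tau)$ have the same distribution. **Arratia flow with drift $a$.** A stochastic flow $\{\psi_{s,t}\}$ such that for all $s\in\mathbb{R}$, $n\ge1$, $x=(x_1,\dots,x_n)\in\mathbb{R}^n$ the process $t\mapsto(\psi_{s,s+t}(x_1),\dots,\psi_{s,s+t}(x_n))$, $t\ge0$, is a Feller process with starting point $x$ and transition probabilities $\{P^{(n),c}_t:t\ge0\}$. **Random dynamical system corresponding to the Arratia flow with drift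 $a$.** A probability space $(\Omega,\mathcal{F},\mathbb{P})$ with a measurable group $(\theta_t)_{t\in\mathbb{R}}$ of measure-preserving transformations of $\Omega$ and a measurable mapping $\varphi:\mathbb{R}_+\times\Omega\times\mathbb{R}\to\mathbb{R}$ such that: (1) $\varphi(t+s,\omega,x)=\varphi(t,\theta_s\omega,\varphi(s,\omega,x))$ for all $s,t\ge0$, $\omega\in\Omega$, $x\in\mathbb{R}$; (2) $\psi_{s,t}(\omega,x)=\varphi(t-s,\theta_s\omega,x)$ defines an Arratia flow with drift $a$. The trajectories $t\mapsto\varphi(t,\omega,x)$ are continuous for all $\omega$ and $x$ (so that, by the cocycle property, all mappings $x\mapsto\psi_{s,t}(\omega,x)$ are non-decreasing). **Stationary point.** A random variable $\eta$ is a stationary point for $\varphi$ if there exists a set $\Omega_0\in\mathcal{F}$ of full measure which is forward-invariant ($\theta_t(\Omega_0)\subset\Omega_0$ for all $t\ge0$) such that for all $\omega\in\Omega_0$ and $t\ge0$: $\varphi(t,\omega,\eta(\omega))=\eta(\theta_t\omega)$. *)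

(* Defs.v *)
From HB Require Import structures.
From mathcomp Require Import all_boot all_order all_algebra.
From mathcomp Require Import all_classical all_reals all_analysis.

Set Implicit Arguments.
Unset Strict Implicit.
Unset Printing Implicit Defensive.

Import Order.TTheory GRing.Theory Num.Theory.
Import numFieldNormedType.Exports.

Local Open Scope classical_set_scope.
Local Open Scope ring_scope.

(* Times are real numbers: every definition below only looks at a process
   (X t), a semigroup (P t) or a cocycle (phi t) for 0 <= t, and at a flow
   (psi s t) for s <= t; the other values are irrelevant. *)

(** * Generated sigma-algebras, laws, independence *)

(* The sigma-algebra sigma(X_i : i in D) on T. *)
Definition sigma_gen (I T : Type) d (E : measurableType d) (D : set I)
    (X : I -> T -> E) : set (set T) :=
  <<s \bigcup_(i in D) preimage_set_system setT (X i) measurable >>.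

(* Sets of paths I -> E measurable for the product sigma-algebra of the
   coordinates in D. *)
Definition path_measurable (I : Type) d (E : measurableType d) (D : set I) :
    set (set (I -> E)) :=
  sigma_gen D (fun i (f : I -> E) => f i).

Definition same_law (R : realType) (I : Type) d (E : measurableType d)
    (D : set I)
    d1 (T1 : measurableType d1) (P1 : probability T1 R) (X1 : I -> T1 -> E)
    d2 (T2 : measurableType d2) (P2 : probability T2 R) (X2 : I -> T2 -> E) :=
  forall B : set (I -> E), path_measurable D B ->
    P1 [set w | B (X1 ^~ w)] = P2 [set w | B (X2 ^~ w)].

(* Meant for sigma-algebras G i: as each of them contains setT, the product
   rule for the subfamilies is included. *)
Definition independent (R : realType) d (T : measurableType d)
    (P : probability T R) (n : nat) (G : 'I_n -> set (set T)) :=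
  forall E : 'I_n -> set T, (forall i, G i (E i)) ->
    (P (\bigcap_i E i) = \prod_(i < n) P (E i))%E.

(** * Feller semigroups and Feller processes on R^n *)

Section feller.
Context (R : realType).

(* R^n is n.-tuple R for its Borel (= product) sigma-algebra; its topology is
   that of 'rV[R]_n. *)
Definition tuple_of_row n (v : 'rV[R]_n) : n.-tuple R :=
  [tuple v ord0 i | i < n].

Definition C0 n (f : n.-tuple R -> R) :=
  continuous (f \o @tuple_of_row n) /\
  forall e, 0 < e -> compact [set v | e <= `|f (tuple_of_row v)|].

Definition semigroup_on n := R -> R.-pker (n.-tuple R) ~> (n.-tuple R).

Record transition_semigroup n (P : semigroup_on n) : Prop := {
  semigroup0 : forall x A, measurable A -> P 0 x A = \d_x A ;
  semigroupD : forall s t x A, 0 <= s -> 0 <= t -> measurable A ->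
    P (s + t) x A = (\int[P s x]_y P t y A)%E }.

Definition semigroup_op n (P : semigroup_on n) (t : R) (f : n.-tuple R -> R)
    (x : n.-tuple R) : R :=
  (\int[P t x]_y f y)%R.

Record feller_semigroup n (P : semigroup_on n) : Prop := {
  feller_transition :> transition_semigroup P ;
  feller_C0 : forall t f, 0 <= t -> C0 f -> C0 (semigroup_op P t f) ;
  feller_continuous : forall f, C0 f -> forall e, 0 < e ->
    \forall t \near 0^'+, forall x, `|semigroup_op P t f x - f x| < e }.

Definition cadlag n (f : R -> n.-tuple R) :=
  forall i : 'I_n,
    (forall t, 0 <= t -> tnth (f s) i @[s --> t^'+] --> tnth (f t) i) /\
    (forall t, 0 < t -> cvg (tnth (f s) i @[s --> t^'-])).

(* feller_markov is P(X_(s+t) \in A | X_r, r <= s) = P_t(X_s, A) a.s., with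
   the conditional probability unfolded. *)
Record feller_process d (T : measurableType d) (Pr : probability T R) n
    (P : semigroup_on n) (x : n.-tuple R) (X : R -> T -> n.-tuple R) :
    Prop := {
  feller_measurable : forall t, 0 <= t -> measurable_fun setT (X t) ;
  feller_cadlag : forall w, cadlag (X ^~ w) ;
  feller_start : {ae Pr, forall w, X 0 w = x} ;
  feller_markov : forall s t F A, 0 <= s -> 0 <= t ->
    sigma_gen `[0, s] X F -> measurable A ->
    Pr (F `&` X (s + t) @^-1` A) = (\int[Pr]_(w in F) P t (X s w) A)%E }.

End feller.

(** * The transition semigroup of dX(t) = a(X(t)) dt + dw(t) *)

Section sde.
Context (R : realType) d (T : measurableType d) (Pr : probability T R).
Local Notation mu := (@lebesgue_measure R).

Record wiener_process (w : R -> T -> R) : Prop := {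
  wiener_measurable : forall t, 0 <= t -> measurable_fun setT (w t) ;
  wiener0 : forall o, w 0 o = 0 ;
  wiener_continuous : forall o, {within `[0, +oo[, continuous (w ^~ o)} ;
  wiener_gaussian : forall s t A, 0 <= s -> s < t -> measurable A ->
    Pr [set o | A (w t o - w s o)] = normal_prob 0 (Num.sqrt (t - s)) A ;
  wiener_independent : forall (t : nat -> R) n, 0 <= t 0%N ->
    {homo t : i j / (i < j)%N >-> i < j} ->
    independent Pr (fun i : 'I_n =>
      preimage_set_system setT (fun o => w (t i.+1) o - w (t i) o)
        measurable) }.

Definition augmented_filtration (w : R -> T -> R) (t : R) : set (set T) :=
  <<s sigma_gen `[0, t] w `|` [set N | measurable N /\ Pr N = 0%E] >>.

Record strong_solution (a : R -> R) (w : R -> T -> R) (x : R)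
    (X : R -> T -> R) : Prop := {
  solution_measurable : forall t, 0 <= t -> measurable_fun setT (X t) ;
  solution_adapted : forall t A, 0 <= t -> measurable A ->
    augmented_filtration w t (X t @^-1` A) ;
  solution_continuous : forall o, {within `[0, +oo[, continuous (X ^~ o)} ;
  solution_eq : {ae Pr, forall o, forall t, 0 <= t ->
    X t o = x + (\int[mu]_(s in `[0, t]) a (X s o))%R + w t o} }.

End sde.

(* R is identified with R^1 = 1.-tuple R. *)
Definition sde_semigroup (R : realType) (a : R -> R) (P1 : semigroup_on R 1) :=
  feller_semigroup P1 /\
  exists d (T : measurableType d) (Pr : probability T R)
    (w : R -> T -> R) (X : R -> R -> T -> R),
    [/\ wiener_process Pr w,
        forall x, strong_solution Pr a w x (X x) &
        forall t x A, 0 <= t -> measurable A ->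
          P1 t [tuple x] A = Pr [set o | A [tuple X x t o]]].

Definition independent_semigroup (R : realType) (P1 : semigroup_on R 1) n
    (P : semigroup_on R n) :=
  feller_semigroup P /\
  forall t x (A : 'I_n -> set R), 0 <= t -> (forall i, measurable (A i)) ->
    (P t x [set y | forall i, A i (tnth y i)] =
     \prod_(i < n) P1 t [tuple tnth x i] [set y | A i (thead y)])%E.

(** * Coalescing semigroups *)

Section coalescing.
Context (R : realType).

Definition subtuple k n (i : 'I_k -> 'I_n) (x : n.-tuple R) : k.-tuple R :=
  [tuple tnth x (i j) | j < k].

Definition consistent (P : forall n, semigroup_on R n) :=
  forall (n k : nat) (i : 'I_k -> 'I_n) t x B, (0 < k)%N ->
    {homo i : j j' / (j < j')%N} -> 0 <= t -> measurable B ->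
    P n t x [set y | B (subtuple i y)] = P k t (subtuple i x) B.

(* First time at which two coordinates coincide, +oo if there is none. *)
Definition meeting_time n (f : R -> n.-tuple R) : \bar R :=
  ereal_inf [set t%:E | t in
    [set t | 0 <= t /\ exists i j, i != j /\ tnth (f t) i = tnth (f t) j]].

(* X(t /\ tau), tau being the meeting time. *)
Definition stopped (T : Type) n (X : R -> T -> n.-tuple R) (t : R) (w : T) :
    n.-tuple R :=
  X (fine (mine t%:E (meeting_time (X ^~ w)))) w.

(* On an incomplete probability space, the meeting time of a cadlag process
   need not be measurable: the laws of the stopped processes are compared
   whenever these are measurable, so that the laws make sense. *)
Definition same_until_meeting n (P Q : semigroup_on R n) :=
  forall x : n.-tuple R,
  forall d (T : measurableType d) (Pr : probability T R)
         (X : R -> T -> n.-tuple R)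
         d' (T' : measurableType d') (Pr' : probability T' R)
         (X' : R -> T' -> n.-tuple R),
    feller_process Pr P x X -> feller_process Pr' Q x X' ->
    (forall t, 0 <= t -> measurable_fun setT (stopped X t)) ->
    (forall t, 0 <= t -> measurable_fun setT (stopped X' t)) ->
    same_law `[0, +oo[ Pr (stopped X) Pr' (stopped X').

(* Only the semigroups P n with n > 0 are relevant. *)
Record coalescing_semigroups (a : R -> R) (P : forall n, semigroup_on R n) :
    Prop := {
  coalescing_feller : forall n, (0 < n)%N -> feller_semigroup (P n) ;
  coalescing_consistent : consistent P ;
  coalescing_diagonal : forall x t, 0 <= t ->
    P 2 t [tuple x; x] [set y | tnth y ord0 = tnth y ord_max] = 1%E ;
  coalescing_until_meeting :
    exists P1 : semigroup_on R 1, sde_semigroup a P1 /\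
    exists Pind : forall n, semigroup_on R n,
      forall n, (0 < n)%N ->
        independent_semigroup P1 (Pind n) /\
        same_until_meeting (P n) (Pind n) }.

End coalescing.

(** * Stochastic flows and random dynamical systems *)

Section flows.
Context (R : realType) d (T : measurableType d) (Pr : probability T R).

(* A random mapping is seen as the random field of its values at the points of
   R, for its law as well as for the sigma-algebra it generates. *)
Record stochastic_flow (psi : R -> R -> T -> R -> R) : Prop := {
  flow_measurable : forall s t, s <= t ->
    measurable_fun setT (fun p : T * R => psi s t p.1 p.2) ;
  flow_comp : forall r s t x w, r <= s -> s <= t ->
    psi s t w (psi r s w x) = psi r t w x ;
  flow_id : forall s x w, psi s s w x = x ;
  flow_independent : forall (t : nat -> R) n,
    {homo t : i j / (i < j)%N >-> i < j} ->
    independent Pr (fun i : 'I_n =>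
      sigma_gen setT (fun x w => psi (t i) (t i.+1) w x)) ;
  flow_stationary : forall s t, s < t ->
    same_law setT Pr (fun x w => psi s t w x)
                  Pr (fun x w => psi 0 (t - s) w x) }.

Definition arratia_flow (a : R -> R) (psi : R -> R -> T -> R -> R) :=
  stochastic_flow psi /\
  exists Pc : forall n, semigroup_on R n, coalescing_semigroups a Pc /\
    forall s n (x : n.-tuple R), (0 < n)%N ->
      feller_process Pr (Pc n) x
        (fun t w => [tuple psi s (s + t) w (tnth x i) | i < n]).

Record measure_preserving_group (theta : R -> T -> T) : Prop := {
  group_measurable : measurable_fun setT (fun p : R * T => theta p.1 p.2) ;
  group0 : forall w, theta 0 w = w ;
  groupD : forall s t w, theta (s + t) w = theta s (theta t w) ;
  group_preserving : forall t A, measurable A -> Pr (theta t @^-1` A) = Pr A }.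

Record arratia_rds (a : R -> R) (theta : R -> T -> T)
    (phi : R -> T -> R -> R) : Prop := {
  rds_group : measure_preserving_group theta ;
  rds_measurable : measurable_fun [set p : R * T * R | 0 <= p.1.1]
    (fun p : R * T * R => phi p.1.1 p.1.2 p.2) ;
  rds_cocycle : forall s t w x, 0 <= s -> 0 <= t ->
    phi (t + s) w x = phi t (theta s w) (phi s w x) ;
  rds_arratia : arratia_flow a (fun s t w x => phi (t - s) (theta s w) x) ;
  rds_continuous : forall w x,
    {within `[0, +oo[, continuous (fun t => phi t w x)} }.

Definition stationary_point (theta : R -> T -> T) (phi : R -> T -> R -> R)
    (eta : {RV Pr >-> R}) :=
  exists T0 : set T, [/\ measurable T0, Pr T0 = 1%E,
    forall t, 0 <= t -> theta t @` T0 `<=` T0 &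
    forall w t, T0 w -> 0 <= t -> phi t w (eta w) = eta (theta t w)].

End flows.

(* Main.v *)
Require Import Defs.
From HB Require Import structures.
From mathcomp Require Import all_boot all_order all_algebra.
From mathcomp Require Import ring lra.
From mathcomp Require Import all_classical all_reals all_analysis.
From mathcomp Require Import measurable_realfun.

Set Implicit Arguments.
Unset Strict Implicit.
Unset Printing Implicit Defensive.

Import Order.TTheory GRing.Theory Num.Theory.
Import numFieldNormedType.Exports.

Local Open Scope classical_set_scope.
Local Open Scope ring_scope.

(** The drift pulls solutions together and the noise makes two of them collide
    in finite time, after which they coalesce. So the flow map over [0, n]
    squeezes every bounded interval to a single point, up to an event whose
    probability decays exponentially in n; the rest follows from this squeezing.

    Coalescence. Let lyap c (x, y) = 1 + c (x - y) for y < x, and 0 when the two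
    points are in the reverse order or equal. Over one unit of time its
    expectation along the two-point motion is multiplied by at most r < 1
    ([lyap_one_step]). Up to the meeting time, the two-point motion has the law
    of two independent solutions, and lyap vanishes afterwards, so it suffices
    to consider two independent solutions stopped when they meet. Before
    meeting, dissipativity bounds the distance at time 1 by a fraction of the
    initial distance plus an integrable functional of the noise; and for
    starting points within a given distance, a large opposite displacement of
    the two noises forces a meeting with a probability bounded away from 0
    ([lyap_contraction]). Iterating with the semigroup property gives
    P(phi_n(x) != phi_n(y)) <= r^n (1 + c (y - x)) ([rds_coalescence]).

    To compare the flow with independent solutions, these must be recognized as
    Feller processes for the given semigroups, that is, satisfy the Markov
    property ([solution_markov], [feller_pair]). It is obtained from the Euler
    scheme: the scheme is a function of its starting point and of increments of
    the noise independent of the past, and it converges to the solution along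
    each path.

    Uniqueness. Two stationary points lie in some [-K, K] with probability close
    to 1, and so agree at time n with probability close to 1; by stationarity
    they agree at time 0 ([crude_stationary_unique]).

    Existence. Let pullback n be the state at time 0 of the trajectory started
    from 0 at time -n. The values pullback n and pullback n.+1 are obtained by
    applying the same flow map to two points, one of which is random with a
    finite first moment ([rds_moment]); by squeezing and the Borel-Cantelli
    lemma the sequence is eventually constant ([pullback_stabilizes]). Its limit
    eta0 satisfies the stationarity relation at each integer time, outside a null
    set depending on that time. Since the image of eta0 by the flow at a real
    time satisfies the same relations, uniqueness extends them to each real time
    ([crude_stationary_real]). By the Tonelli theorem, for almost every w the
    function s |-> phi_s(theta_(-s) w, eta0 (theta_(-s) w)) equals eta0 w for
    almost every s >= 0. Let eta w be the value this function takes almost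
    everywhere from some time on. The set of w where it is defined has full
    measure, and the cocycle property transports it and the value exactly from w
    to theta_t w ([eventual_value_shift]): so eta is stationary without any
    exceptional set depending on time. *)

(** * Measure-theoretic preliminaries *)

(** Seen as a measure in A, an integral over A can be identified on a pi-system
    by [eq_measure_on_pi_system]. *)
Lemma density_measure d (T : measurableType d) (R : realType)
    (mu : {measure set T -> \bar R}) (h : T -> \bar R) :
  measurable_fun setT h -> (forall x, (0 <= h x)%E) ->
  exists m : {measure set T -> \bar R},
    forall A, m A = (\int[mu]_(x in A) h x)%E.
Proof.
move=> mh h0; pose m A := (\int[mu]_(x in A) h x)%E.
have m0 : m set0 = 0%E by exact: integral_set0.
have m_ge0 A : (0 <= m A)%E by exact: integral_ge0.
have m_add : semi_sigma_additive m.
  move=> F mF tF mUF; rewrite /m ge0_integral_bigcup//.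
    by apply: is_cvg_ereal_nneg_natsum_cond => n _ _; exact: integral_ge0.
  exact: measurable_funTS.
pose mB := isMeasure.Build d T R m m0 m_ge0 m_add.
pose M : {measure set T -> \bar R} := HB.pack m mB.
by exists M.
Qed.

(** Dynkin's theorem. The space may carry a sigma-algebra larger than the one
    generated by G, as is the case for the past of a process. *)
Lemma eq_measure_on_pi_system d (T : measurableType d) (R : realType)
    (G : set (set T)) (m1 m2 : {measure set T -> \bar R}) :
  G `<=` measurable -> setI_closed G -> G setT -> (m1 setT < +oo)%E ->
  (forall A, G A -> m1 A = m2 A) -> forall A, <<s G >> A -> m1 A = m2 A.
Proof.
move=> Gm GI GT fin1 eq12 A.
apply: (@g_sigma_algebra_measure_unique _ _ _ G Gm (fun=> setT)) => //.
by rewrite bigcup_const.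
Qed.

(** Paths are only continuous within [0, +oo[; freezing them before time 0 makes
    the theorems on continuous functions on the line available. *)
Lemma continuous_extend0 (R : realType) (f : R -> R) :
  {within `[0, +oo[, continuous f} -> continuous (fun t : R => f (Num.max 0 t)).
Proof.
move=> /subspace_continuousP cf t.
have t0 : `[0%R, +oo[%classic (Num.max 0 t) by rewrite /= in_itv/= andbT le_max lexx.
apply: (@cvg_comp _ _ _ (fun t : R => Num.max 0 t) f _ (within `[0, +oo[ (nbhs (Num.max 0
  t)))); last exact: cf.
move=> A /= [e /= e0 eA].
exists e => //= s /= ts; apply: eA => /=; last first.
  by rewrite in_itv/= andbT le_max lexx.
apply: le_lt_trans ts; rewrite ler_norml.
have := ler_norm (t - s); have := ler_norm (s - t); rewrite (distrC s).
rewrite !maxEle; case: (lerP 0 t) => ?; case: (lerP 0 s) => ? *; 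
  apply/andP; split; lra.
Qed.

Lemma continuous_cvg_seq (R : realType) (f : R -> R) (u : nat -> R) (l : R) :
  continuous f -> u n @[n --> \oo] --> l -> f (u n) @[n --> \oo] --> f l.
Proof. by move=> cf ul; apply: (cvg_comp _ _ ul); exact: cf. Qed.

Lemma grid_cvg (R : realType) (t : R) : 0 <= t ->
  (Num.trunc (t * n.+1%:R))%:R / n.+1%:R @[n --> \oo] --> t.
Proof.
move=> t0; apply/cvgrPdist_le => e e0.
near=> n.
have n0 : 0 < n.+1%:R :> R by [].
have /andP[l1 l2] := truncn_itv (mulr_ge0 t0 (ltW n0)).
have le1 : (Num.trunc (t * n.+1%:R))%:R / n.+1%:R <= t by rewrite ler_pdivrMr.
rewrite ger0_norm ?subr_ge0//.
have : t * n.+1%:R / n.+1%:R <= ((Num.trunc (t * n.+1%:R))%:R + 1) / n.+1%:R.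
  by rewrite ler_pM2r ?invr_gt0// natr1 ltW.
rewrite mulfK ?lt0r_neq0// mulrDl mul1r => le2.
rewrite lerBlDl (le_trans le2)// lerD2l.
near: n.
have := @near_infty_natSinv_lt R (PosNum e0).
by apply: filterS => n /= /ltW.
Unshelve. all: by end_near. Qed.

(** The process is the limit of its discretizations along the grids of step
    1 / n.+1, each of which takes countably many times. *)
Lemma measurable_fun_caratheodory d (T : measurableType d) (R : realType)
    (X : R -> T -> R) :
  (forall t, 0 <= t -> measurable_fun setT (X t)) ->
  (forall w, {within `[0, +oo[, continuous (X ^~ w)}) ->
  measurable_fun setT (fun p : R * T => X (Num.max 0 p.1) p.2).
Proof.
move=> mX cX.
pose g n (t : R) : R := (Num.trunc (Num.max 0 t * n.+1%:R))%:R / n.+1%:R.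
apply: (@measurable_fun_cvg _ _ _ _ (fun n p => X (g n p.1) p.2)).
- move=> n _ B mB; rewrite setTI.
  have -> : (fun p : R * T => X (g n p.1) p.2) @^-1` B =
    \bigcup_k ([set t : R | Num.trunc (Num.max 0 t * n.+1%:R) = k] `*`
               (X (k%:R / n.+1%:R) @^-1` B)).
    apply/seteqP; split => [[t w]/= H|[t w]/= [k _ [/= <-]]//].
    by exists (Num.trunc (Num.max 0 t * n.+1%:R)).
  apply: bigcupT_measurable => k; apply: measurableX; last first.
    by rewrite -[X in measurable X]setTI; apply: mX => //; rewrite divr_ge0.
  have -> : [set t : R | Num.trunc (Num.max 0 t * n.+1%:R) = k] =
    (fun t => Num.max 0 t * n.+1%:R) @^-1` `[k%:R, k.+1%:R[%classic.
    apply/seteqP; split => t /=.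
      move=> <-; rewrite in_itv/=; apply: truncn_itv.
      by rewrite mulr_ge0// le_max lexx.
    by rewrite in_itv/= => H; exact: truncn_def.
  rewrite -[X in measurable X]setTI.
  have mM : measurable_fun setT (fun t : R => Num.max 0 t * n.+1%:R).
    apply: measurable_funM => //; apply: measurable_maxr => //.
  exact: mM.
- move=> [t w] _ /=.
  have := @continuous_cvg_seq R _ _ _ (continuous_extend0 (cX w)) (@grid_cvg R (Num.max 0 t) _).
  rewrite le_max lexx => /(_ isT).
  rewrite (max_idPr (_ : 0 <= Num.max 0 t)) ?le_max ?lexx//.
  apply: cvg_trans; apply: near_eq_cvg; apply: nearW => n /=.
  by rewrite (max_idPr _)// /g divr_ge0.
Qed.

Section basics.
Context d (T : measurableType d) (R : realType).

Lemma sigma_gen_measurable I d' (E : measurableType d') (D : set I) (X : I -> T -> E) :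
  (forall i, D i -> measurable_fun setT (X i)) -> sigma_gen D X `<=` measurable.
Proof.
move=> mX; apply: smallest_sub; first exact: sigma_algebra_measurable.
by move=> _ [i Di [B mB <-]]; exact: mX.
Qed.

Lemma sigma_gen_sub I d' (E : measurableType d') (D1 D2 : set I) (X : I -> T -> E) :
  D1 `<=` D2 -> sigma_gen D1 X `<=` sigma_gen D2 X.
Proof. by move=> D12; apply: sub_smallest2r => //; exact: bigcup_subset. Qed.

Lemma sigma_gen_preimage I d' (E : measurableType d') (D : set I) (X : I -> T -> E) i B :
  D i -> measurable B -> sigma_gen D X (X i @^-1` B).
Proof.
move=> Di mB; apply: sub_sigma_algebra; exists i => //; exists B => //.
by rewrite setTI.
Qed.

Lemma sigma_setI (G : set (set T)) A B : <<s G >> A -> <<s G >> B -> <<s G >> (A `&` B).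
Proof.
exact: (@measurableI _ (g_sigma_algebraType G)).
Qed.

Lemma measure_setI_conull (mu : {measure set T -> \bar R}) A M :
  measurable A -> measurable M -> mu (~` M) = 0%E -> mu (A `&` M) = mu A.
Proof.
move=> mA mM M0; rewrite -[in RHS](setIT A) -(setUv M) setIUr.
rewrite [in RHS]measureU; [|exact: measurableI| by apply: measurableI => //;
  exact: measurableC|].
  rewrite [X in (_ + X)%E](_ : _ = 0%E) ?adde0//.
  apply/eqP; rewrite eq_le measure_ge0 andbT -M0.
  by apply: le_measure; rewrite ?inE //; [apply: measurableI => //|]; exact: measurableC.
by rewrite setIACA setICr setI0.
Qed.

End basics.

(** * The increments of a Wiener process are independent of its past *)
Section wiener.
Context (R : realType) d (T : measurableType d) (Pr : probability T R).
Variable w : R -> T -> R.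
Hypothesis Ww : wiener_process Pr w.

Lemma wiener_increment_measurable s t : 0 <= s -> 0 <= t ->
  measurable_fun setT (fun o => w t o - w s o).
Proof. by move=> s0 t0; apply: measurable_funB; exact: (wiener_measurable Ww). Qed.

Lemma augmented_measurable u : augmented_filtration Pr w u `<=` measurable.
Proof.
apply: smallest_sub; first exact: sigma_algebra_measurable.
move=> A [|[]//]; apply: sigma_gen_measurable => r /=.
by rewrite in_itv/= => /andP[r0 _]; exact: (wiener_measurable Ww).
Qed.

Lemma augmented_sub u v : u <= v ->
  augmented_filtration Pr w u `<=` augmented_filtration Pr w v.
Proof.
move=> uv; apply: sub_smallest2r; first exact: smallest_sigma_algebra.
apply: setSU; apply: sigma_gen_sub => r/=.
by rewrite !in_itv/= => /andP[-> /le_trans->].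
Qed.

Section past.
Variables (u h : R) (A : set R).
Hypotheses (u0 : 0 <= u) (h0 : 0 < h) (mA : measurable A).
Let Delta o := w (u + h) o - w u o.

Let uh0 : 0 <= u + h. Proof. by rewrite addr_ge0// ltW. Qed.

Let mDelta : measurable (Delta @^-1` A).
Proof. rewrite -[X in measurable X]setTI; exact: wiener_increment_measurable. Qed.

Let Delta_law : Pr (Delta @^-1` A) = normal_prob 0 (Num.sqrt h) A.
Proof.
have uuh : u < u + h by rewrite ltrDl.
by have := wiener_gaussian Ww u0 uuh mA; rewrite addrAC subrr add0r.
Qed.

Let indep (G : set T) :=
  Pr (G `&` Delta @^-1` A) = (Pr G * normal_prob 0 (Num.sqrt h) A)%E.

(* Both sides of the product rule are finite measures in the past event. *)
Let indep_pi (G : set (set T)) : G `<=` measurable -> setI_closed G -> G setT ->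
  (forall B, G B -> indep B) -> forall B, <<s G >> B -> indep B.
Proof.
move=> Gm GI GT Gind B sB; rewrite /indep.
pose c : {nonneg R} := NngNum (fine_ge0 (measure_ge0 (normal_prob 0 (Num.sqrt h)) A)).
have -> : normal_prob 0 (Num.sqrt h) A = c%:num%:E.
  by rewrite /= fineK// fin_num_measure.
rewrite muleC.
have : mrestr Pr mDelta B = mscale c Pr B.
  apply: (@eq_measure_on_pi_system _ _ _ G) => //.
    rewrite /= /mrestr setTI; apply: le_lt_trans (ltry 1); exact: probability_le1.
  move=> C GC; rewrite /= /mrestr /mscale /= (Gind C GC) muleC /c/= fineK// fin_num_measure//.
by rewrite /mrestr /mscale.
Qed.

(** Independence is only known for successive increments. The values of w at
    finitely many times of [0, u] are sums of increments along the subdivision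
    formed by these times, 0 and u, to which the increment from u to u + h is
    appended. *)
Let indep_list (l : seq R) : (forall x, x \in l -> 0 <= x <= u) ->
  forall G, sigma_gen [set` l] w G -> indep G.
Proof.
move=> lu.
pose s := sort <=%O (undup (0 :: u :: l)).
have sE x : x \in s = (x \in 0 :: u :: l) by rewrite mem_sort mem_undup.
have s_bnd x : x \in s -> 0 <= x <= u.
  by rewrite sE !inE => /or3P[/eqP->|/eqP->|/lu//]; rewrite ?lexx ?u0.
have s_lt : sorted <%O s.
  by rewrite lt_sorted_uniq_le sort_uniq undup_uniq sort_le_sorted.
have s0 : 0 \in s by rewrite sE inE eqxx.
have [k sk] : exists k, size s = k.+1.
  by case: (s) s0 => // a s' _; exists (size s').
have s_nth i j : (i < j)%N -> (j < k.+1)%N -> s`_i < s`_j.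
  move=> ij jk; apply: (sorted_ltn_nth (@lt_trans _ _)) => //; rewrite inE sk//.
  exact: ltn_trans jk.
have mem_nth_s i : (i < k.+1)%N -> s`_i \in s by move=> ik; rewrite mem_nth ?sk.
have s_first : s`_0 = 0.
  have := nth_index 0 s0; have : (index 0%R s < k.+1)%N by rewrite -sk index_mem.
  case: (index _ _) => [//|i] ik i0.
  have := s_nth 0%N i.+1 isT ik; rewrite i0 ltNge.
  by have /andP[->] := s_bnd _ (mem_nth_s 0%N isT).
have s_last : s`_k = u.
  have us : u \in s by rewrite sE !inE eqxx orbT.
  have := nth_index 0 us; have : (index u s < k.+1)%N by rewrite -sk index_mem.
  rewrite ltnS leq_eqVlt => /predU1P[-> //|ik iu].
  have := s_nth _ k ik (ltnSn k); rewrite iu ltNge.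
  by have /andP[_ ->] := s_bnd _ (mem_nth_s k (ltnSn k)).
(* The times after u + h only serve to make the sequence increasing. *)
pose t i := if (i < k.+1)%N then s`_i else u + h * (i - k)%:R.
have tk : t k = u by rewrite /t ltnSn.
have tk1 : t k.+1 = u + h by rewrite /t ltnn subSnn mulr1.
have t0 : t 0%N = 0 by [].
have t_homo : {homo t : i j / (i < j)%N >-> i < j}.
  move=> i j ij; rewrite /t; case: ifPn => ik; case: ifPn => jk.
  - exact: s_nth.
  - have /andP[_ iu] := s_bnd _ (mem_nth_s i ik).
    by rewrite (le_lt_trans iu)// ltrDl mulr_gt0// ltr0n subn_gt0 ltnNge.
  - by rewrite (ltn_trans ij) in ik.
  - rewrite ltrD2l ltr_pM2l// ltr_nat ltn_sub2r//.
    by rewrite -leqNgt in jk.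
have t_ge0 i : 0 <= t i.
  by case: i => [|i]; rewrite -t0//; apply/ltW/t_homo.
pose delta i o := w (t i.+1) o - w (t i) o.
have deltak : delta k = Delta by rewrite /delta tk tk1.
have mdelta i : measurable_fun setT (delta i) by exact: wiener_increment_measurable.
pose G := [set B | exists2 E : nat -> set R, (forall i, measurable (E i)) &
   B = \bigcap_(i in `I_k) delta i @^-1` E i].
have Gm : G `<=` measurable.
  move=> _ [E mE ->]; apply: fin_bigcap_measurable; first exact: finite_II.
  by move=> i _; rewrite -[X in measurable X]setTI; exact: mdelta.
have GI : setI_closed G.
  move=> _ _ [E mE ->] [F mF ->]; exists (fun i => E i `&` F i).
    by move=> i; exact: measurableI.
  by rewrite -bigcapI.
have GT : G setT.
  by exists (fun=> setT) => //; apply/seteqP; split.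
have prodG (E : nat -> set R) B : (forall i, measurable (E i)) -> measurable B ->
    Pr (\bigcap_(i in `I_k) delta i @^-1` E i `&` Delta @^-1` B) =
    (\prod_(i < k) Pr (delta i @^-1` E i) * Pr (Delta @^-1` B))%E.
  move=> mE mB.
  pose F (i : 'I_k.+1) := if (i < k)%N then E i else B.
  have := @wiener_independent _ _ _ _ _ Ww t k.+1 _ t_homo (fun i => delta i @^-1` F i) _.
  rewrite t0 lexx => /(_ isT) H.
  have {}H := H (fun i => _).
  rewrite (_ : \bigcap_i _ = \bigcap_(i in `I_k) delta i @^-1` E i `&` Delta @^-1` B) in H;
    last first.
    apply/seteqP; split => o /=.
      move=> Ho; split => [i /= ik|].
        by have := Ho (Ordinal (ltn_trans ik (ltnSn k))) I; rewrite /= /F/= ik.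
      by have := Ho ord_max I; rewrite /= /F/= ltnn deltak.
    move=> [Ho1 Ho2] i _; rewrite /= /F/=; case: ifPn => ik; first exact: (Ho1 i ik).
    rewrite (_ : (i : nat) = k) ?deltak//; apply/eqP.
    by rewrite eqn_leq -ltnS ltn_ord leqNgt.
  rewrite H.
    rewrite big_ord_recr/= /F/= ltnn deltak; congr (_ * _)%E.
    by apply: eq_bigr => i _; rewrite /= ltn_ord.
  move=> i; exists (F i); last by rewrite setTI.
  by rewrite /F; case: ifP.
have indG B : G B -> indep B.
  move=> [E mE ->]; rewrite /indep prodG// Delta_law.
  have := prodG E setT mE measurableT; rewrite preimage_setT setIT => ->.
  by rewrite probability_setT mule1.
have mwt j : (j < k.+1)%N -> measurable_fun (setT : set (g_sigma_algebraType G)) (w (t j)).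
  elim: j => [_|j IH jk].
    rewrite t0 (_ : w 0 = cst 0); last by apply/funext => o; rewrite (wiener0 Ww).
    exact: (@measurable_cst _ _ (g_sigma_algebraType G)).
  have -> : w (t j.+1) = (fun o => w (t j) o + delta j o).
    by apply/funext => o; rewrite /delta addrC subrK.
  have mj := IH (ltnW jk). apply: measurable_funD; first exact: mj.
  move=> _ B mB; rewrite setTI; apply: sub_sigma_algebra.
  exists (fun i => if i == j then B else setT).
    by move=> i; case: ifP.
  apply/seteqP; split => o /=.
    by move=> Bo i _; case: eqP => [->|].
  by move=> /(_ j jk) /=; rewrite eqxx.
move=> B sB; apply: (indep_pi Gm GI GT indG).
move: B sB; apply: smallest_sub; first exact: smallest_sigma_algebra.
move=> _ [r rl [B mB <-]]; rewrite setTI.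
have rs : r \in s by rewrite sE !inE [r \in l]rl !orbT.
have rk : (index r s < k.+1)%N by rewrite -sk index_mem.
have <- : t (index r s) = r by rewrite /t rk nth_index.
by have := mwt _ rk measurableT B mB; rewrite setTI.
Qed.

(** An event of the past involves infinitely many times, but the pasts of the
    finite sets of times form a pi-system that generates it. *)
Let indep_past G : sigma_gen `[0, u] w G -> indep G.
Proof.
pose Pi := [set G | exists2 l : seq R, (forall x, x \in l -> 0 <= x <= u) &
  sigma_gen [set` l] w G].
have mPi : Pi `<=` measurable.
  move=> B [l lu]; apply: sigma_gen_measurable => r /= /lu /andP[r0 _].
  exact: (wiener_measurable Ww).
suff : sigma_gen `[0, u] w `<=` <<s Pi >>.
  move=> sub /sub; apply: indep_pi => //.
  - move=> B C [l1 l1u sB] [l2 l2u sC]; exists (l1 ++ l2).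
      by move=> x; rewrite mem_cat => /orP[/l1u|/l2u].
    apply: sigma_setI.
      by move: sB; apply: sigma_gen_sub => x /=; rewrite mem_cat => ->.
    by move: sC; apply: sigma_gen_sub => x /=; rewrite mem_cat => ->; rewrite orbT.
  - exists [::] => //; exact: (@measurableT _ (g_sigma_algebraType _)).
  - by move=> B [l lu]; exact: indep_list.
apply: smallest_sub; first exact: smallest_sigma_algebra.
move=> _ [r ru [B mB <-]]; rewrite setTI; apply: sub_sigma_algebra.
exists [:: r]; first by move=> x; rewrite inE => /eqP ->; move: ru; rewrite /= in_itv.
by apply: sigma_gen_preimage => //=; rewrite inE.
Qed.

(** The null sets added to the filtration are dealt with by intersecting the
    past with events of probability 0 or 1. *)
Lemma wiener_increment_independent G : augmented_filtration Pr w u G ->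
  Pr (G `&` (fun o => w (u + h) o - w u o) @^-1` A) =
  (Pr G * normal_prob 0 (Num.sqrt h) A)%E.
Proof.
pose Pi := [set G | exists G0 M, [/\ G = G0 `&` M, sigma_gen `[0, u] w G0,
  measurable M & Pr M = 0%E \/ Pr (~` M) = 0%E]].
have m0 G0 : sigma_gen `[0, u] w G0 -> measurable G0.
  apply: sigma_gen_measurable => r /=; rewrite in_itv/= => /andP[r0 _].
  exact: (wiener_measurable Ww).
have sT : sigma_gen `[0, u] w setT by exact: (@measurableT _ (g_sigma_algebraType _)).
have sub0 B C : measurable B -> measurable C -> B `<=` C -> Pr C = 0%E -> Pr B = 0%E.
  move=> mB mC BC C0; apply/eqP; rewrite eq_le measure_ge0 andbT -C0.
  by apply: le_measure; rewrite ?inE.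
suff : augmented_filtration Pr w u `<=` <<s Pi >>.
  move=> sub /sub; apply: indep_pi.
  - by move=> _ [G0 [M [-> /m0 mG0 mM _]]]; exact: measurableI.
  - move=> _ _ [G0 [M [-> sG0 mM M01]]] [G1 [N [-> sG1 mN N01]]].
    exists (G0 `&` G1), (M `&` N); split; [by rewrite setIACA|exact: sigma_setI|exact:
      measurableI|].
    have mCM := measurableC mM; have mCN := measurableC mN.
    case: M01 => M01.
      by left; apply: sub0 M01 => //; exact: measurableI.
    case: N01 => N01.
      by left; apply: sub0 N01 => //; exact: measurableI.
    by right; rewrite setCI; apply: null_set_setU.
  - exists setT, setT; split => //; [by rewrite setIT|].
    by right; rewrite setCT measure0.
  - move=> _ [G0 [M [-> sG0 mM M01]]]; rewrite /indep.
    have mG0 := m0 _ sG0; case: M01 => M01.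
      have mGM : measurable (G0 `&` M) by exact: measurableI.
      have GM0 : Pr (G0 `&` M) = 0%E by exact: (sub0 _ M).
      rewrite GM0 mul0e; apply: (sub0 _ (G0 `&` M)) => //.
      exact: measurableI.
    rewrite -setIA (setIC M) setIA (measure_setI_conull (A := G0 `&` _) (M := M))//;
      last exact: measurableI.
    by rewrite (measure_setI_conull (A := G0) (M := M))//; exact: indep_past.
apply: smallest_sub; first exact: smallest_sigma_algebra.
move=> B [sB|[mB B0]]; apply: sub_sigma_algebra.
  exists B, setT; split => //; [by rewrite setIT|].
  by right; rewrite setCT measure0.
by exists setT, B; split => //; [rewrite setTI|left].
Qed.

End past.
End wiener.

(** * Integrals of continuous functions over segments *)
Section segment_integral.
Context (R : realType).
Local Notation mu := (@lebesgue_measure R).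
Implicit Types (f g : R -> R) (s t : R).

Definition integral_itv (s t : R) (f : R -> R) : R := (\int[mu]_(u in `[s, t]) f u)%R.

Lemma integrable_itv f s t : continuous f -> mu.-integrable `[s, t] (EFin \o f).
Proof.
move=> cf; apply: continuous_compact_integrable; first exact: segment_compact.
exact: continuous_subspaceT.
Qed.

Lemma integral_itvxx f t : integral_itv t t f = 0.
Proof. by rewrite /integral_itv set_itv1 Rintegral_set1. Qed.

Lemma integral_itv_split f r s t : continuous f -> r <= s -> s <= t ->
  integral_itv r t f = integral_itv r s f + integral_itv s t f.
Proof.
move=> cf rs st; rewrite /integral_itv.
have int := integrable_itv r t cf.
have := @Rintegral_itvB R f (BLeft r) (BRight t) s int.
rewrite !bnd_simp => /(_ rs st).
rewrite Rintegral_itv_obnd_cbnd => [<-|]; first by rewrite addrC subrK.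
by apply: integrableS (integrable_itv s t cf) => //; apply: subset_itvr; rewrite bnd_simp.
Qed.

Lemma integral_itvB f g s t : continuous f -> continuous g ->
  integral_itv s t (fun u => f u - g u) = integral_itv s t f - integral_itv s t g.
Proof. by move=> cf cg; apply: RintegralB => //; apply: integrable_itv. Qed.

Lemma integral_itvD f g s t : continuous f -> continuous g ->
  integral_itv s t (fun u => f u + g u) = integral_itv s t f + integral_itv s t g.
Proof. by move=> cf cg; apply: RintegralD => //; exact: integrable_itv. Qed.

Lemma integral_itvZ f c s t : continuous f ->
  integral_itv s t (fun u => c * f u) = c * integral_itv s t f.
Proof. by move=> cf; apply: RintegralZl => //; exact: integrable_itv. Qed.

Lemma integral_itv_cst c s t : s <= t -> integral_itv s t (fun=> c) = c * (t - s).
Proof.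
move=> st; rewrite /integral_itv Rintegral_cst//; congr (_ * _).
rewrite [X in fine X](@lebesgue_measure_itv R `[s, t]) /=.
by case: ifPn => //; rewrite lte_fin -leNgt => ts; rewrite (@le_anti _ _ s t) ?subrr// st ts.
Qed.

Lemma le_integral_itv f g s t : continuous f -> continuous g ->
  (forall u, s <= u <= t -> f u <= g u) -> integral_itv s t f <= integral_itv s t g.
Proof.
by move=> cf cg fg; apply: le_Rintegral => //; exact: integrable_itv.
Qed.

Lemma normr_integral_itv_le f s t c : s <= t -> continuous f ->
  (forall u, s <= u <= t -> `|f u| <= c) -> `|integral_itv s t f| <= c * (t - s).
Proof.
move=> st cf fc; rewrite -integral_itv_cst// ler_norml -mulN1r -integral_itvZ;
  last exact: cst_continuous.
apply/andP; split; apply: le_integral_itv => //; try exact: cst_continuous.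
  by move=> u /fc; rewrite ler_norml mulN1r => /andP[].
by move=> u /fc; rewrite ler_norml => /andP[].
Qed.

(** The first point u ranges over the segment, the second one v over the line,
    which spares the boundary cases in the applications. *)
Lemma heine_cantor f s t e : continuous f -> 0 < e ->
  exists2 d, 0 < d & forall u v, s <= u <= t -> `|v - u| < d -> `|f v - f u| < e.
Proof.
move=> cf e0.
have e20 : 0 < e / 2 by rewrite divr_gt0.
have /compact_near_coveringP/(_ R (0^'+) (fun d u => forall v, `|v - u| < d -> `|f v - f u| <
  e)) := @segment_compact R s t.
move=> /(_ _ _)[].
  move=> x _.
  have /cvgrPdist_lt /(_ _ e20) [/= r r0 fr] := cf x.
  have r20 : 0 < r / 2 by rewrite divr_gt0.
  exists (ball x (r / 2), [set d | d < r / 2]).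
    split; first exact: nbhsx_ballx.
    exact: nbhs_right_lt.
  move=> [u d] /= [xu dr] v vu.
  have h1 : `|f x - f u| < e / 2 by apply: fr => /=; apply: lt_trans xu _; lra.
  have h2 : `|f x - f v| < e / 2.
    apply: fr => /=; have -> : x - v = (x - u) - (v - u) by ring.
    apply: le_lt_trans (ler_normB _ _) _; have -> : r = r / 2 + r / 2 by lra.
    by apply: ltrD => //; exact: lt_trans dr.
  have -> : f v - f u = (f x - f u) - (f x - f v) by ring.
  apply: le_lt_trans (ler_normB _ _) _; have -> : e = e / 2 + e / 2 by lra.
  exact: ltrD.
move=> r /= r0 H; exists (r / 2); first by rewrite divr_gt0.
move=> u v ust; apply: H; rewrite /= ?in_itv//= ?divr_gt0//.
by rewrite sub0r normrN gtr0_norm ?divr_gt0//; lra.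
Qed.

End segment_integral.

(** * Pathwise estimates for the integral equation *)
Section euler.
Context (R : realType).
Variables (a : R -> R) (L : R).
Hypothesis L0 : 0 <= L.
Hypothesis aL : forall x y, `|a x - a y| <= L * `|x - y|.

Lemma lipschitz_continuous : continuous a.
Proof.
move=> x; apply/cvgrPdist_lt => e e0.
have [L_0|Ln0] := eqVneq L 0.
  by apply: nearW => y; apply: le_lt_trans (aL _ _) _; rewrite L_0 mul0r.
have L_gt0 : 0 < L by rewrite lt_neqAle eq_sym Ln0.
exists (e / L) => /=; first by rewrite divr_gt0.
move=> y /= xy; apply: le_lt_trans (aL _ _) _.
by rewrite mulrC -ltr_pdivlMr.
Qed.

Fixpoint euler (h x : R) (dw : nat -> R) (k : nat) : R :=
  if k is k'.+1 then
    let y := euler h x dw k' in y + h * a y + dw k'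
  else x.

Variables (X w : R -> R).
Hypothesis cX : continuous X.

(** Comparison with one step: if X oscillates by at most e over a step h, the
    error E satisfies E_(k+1) <= E_k + h L (E_k + e), whence
    E_k <= e ((1 + h L)^k - 1). *)
Lemma euler_error s t n e : 0 <= t -> 0 <= e ->
  (forall r r', s <= r -> r <= r' -> r' <= s + t ->
    X r' - X r = integral_itv r r' (a \o X) + (w r' - w r)) ->
  (forall u v, s <= u <= s + t -> `|v - u| <= t / n.+1%:R -> `|X v - X u| <= e) ->
  `|X (s + t) - euler (t / n.+1%:R) (X s)
     (fun k => w (s + t / n.+1%:R * k.+1%:R) - w (s + t / n.+1%:R * k%:R)) n.+1|
  <= e * expR (L * t).
Proof.
move=> t0 e0 eqX osc; set h := t / n.+1%:R; set dw := fun k => _.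
have h0 : 0 <= h by rewrite divr_ge0.
have cb : continuous (a \o X).
  by move=> u; apply: continuous_comp; [exact: cX|exact: lipschitz_continuous].
have hn : h * n.+1%:R = t by rewrite /h divfK.
have hk k : (k <= n.+1)%N -> h * k%:R <= t.
  by move=> kn; rewrite -hn ler_wpM2l// ler_nat.
suff main k : (k <= n.+1)%N ->
    `|X (s + h * k%:R) - euler h (X s) dw k| <= e * ((1 + h * L) ^+ k - 1).
  have := main n.+1 (leqnn _); rewrite hn => /le_trans; apply.
  apply: ler_wpM2l => //.
  rewrite -hn mulrA (mulrC L) expRM_natr lerBlDr.
  apply: (@le_trans _ _ (expR (h * L) ^+ n.+1)); last by rewrite lerDl.
  by rewrite lerXn2r ?nnegrE ?expR_ge0 ?expR_ge1Dx// addr_ge0// mulr_ge0.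
elim: k => [_|k IH kn] /=; first by rewrite mulr0 addr0 subrr normr0 expr0 subrr mulr0.
have {}IH := IH (ltnW kn).
set y := euler h (X s) dw k in IH *.
set r := s + h * k%:R in IH *; set r' := s + h * k.+1%:R.
have r'E : r' = r + h by rewrite /r' /r -addrA -[X in _ = s + (_ + X)]mulr1 -mulrDr natr1.
have rr' : r <= r' by rewrite r'E lerDl.
have sr : s <= r by rewrite lerDl mulr_ge0.
have r't : r' <= s + t by rewrite lerD2l hk.
have dwE : dw k = w r' - w r by [].
have step : X r' - (y + h * a y + dw k) = (X r - y) + integral_itv r r' (fun u => a (X u) - a
  y).
  rewrite (integral_itvB (f := a \o X)) ?integral_itv_cst//; last exact: cst_continuous.
  have := eqX _ _ sr rr' r't; rewrite dwE r'E => /eqP; rewrite subr_eq => /eqP ->.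
  by ring.
rewrite step.
have bnd : `|integral_itv r r' (fun u => a (X u) - a y)| <= L * (`|X r - y| + e) * h.
  have -> : h = r' - r by rewrite r'E; ring.
  apply: normr_integral_itv_le => //.
    by move=> u; apply: cvgB; [exact: cb|exact: cvg_cst].
  move=> u /andP[ru ur']; apply: le_trans (aL _ _) _; apply: ler_wpM2l => //.
  have -> : X u - y = (X r - y) + (X u - X r) by ring.
  apply: le_trans (ler_normD _ _) _; rewrite lerD2l; apply: osc.
    by rewrite sr (le_trans rr').
  by rewrite ger0_norm ?subr_ge0// -/h; move: ur'; rewrite r'E; lra.
apply: le_trans (ler_normD _ _) _; apply: le_trans (lerD IH bnd) _.
apply: (@le_trans _ _ (e * ((1 + h * L) ^+ k - 1) + L * (e * ((1 + h * L) ^+ k - 1) + e) * h)).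
  by rewrite lerD2l ler_wpM2r// ler_wpM2l// lerD2r.
by rewrite le_eqVlt; apply/orP; left; apply/eqP; rewrite exprS; ring.
Qed.

Lemma euler_cvg s t : 0 <= t ->
  (forall r r', s <= r -> r <= r' -> r' <= s + t ->
    X r' - X r = integral_itv r r' (a \o X) + (w r' - w r)) ->
  euler (t / n.+1%:R) (X s)
     (fun k => w (s + t / n.+1%:R * k.+1%:R) - w (s + t / n.+1%:R * k%:R)) n.+1
  @[n --> \oo] --> X (s + t).
Proof.
move=> t0 eqX; apply/cvgrPdist_le => e e0.
have e'0 : 0 < e / expR (L * t) by rewrite divr_gt0// expR_gt0.
have [r r0 Xr] := heine_cantor s (s + t) cX e'0.
near=> n.
apply: le_trans (@euler_error s t n _ t0 (ltW e'0) eqX _) _; last first.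
  by rewrite divfK// gt_eqF// expR_gt0.
move=> u v ust vu; apply/ltW/Xr => //; apply: le_lt_trans vu _.
near: n.
have [->|tn0] := eqVneq t 0; first by apply: nearW => n; rewrite mul0r.
have t_gt0 : 0 < t by rewrite lt_neqAle eq_sym tn0.
have rt0 : 0 < r / t by rewrite divr_gt0.
have := @near_infty_natSinv_lt R (PosNum rt0).
by apply: filterS => n /=; rewrite ltr_pdivlMr// mulrC.
Unshelve. all: by end_near. Qed.

End euler.

Section bounds.
Context (R : realType).

(** Before the first meeting time, the distance D of two solutions has drift
    b <= - lambda D, hence a nonpositive one. So D 1 <= D s + B 1 - B s for all s,
    which bounds the integral of D over [0, 1] from below by D 1 up to noise;
    inserting this in the equation for D 1 gains the factor 1 + lambda. *)
Lemma distance_bound (D b B : R -> R) (delta lambda : R) : 0 <= lambda ->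
  continuous D -> continuous b -> continuous B ->
  (forall t, 0 <= t <= 1 -> D t = delta + integral_itv 0 t b + B t) ->
  (forall t, 0 <= t <= 1 -> 0 < D t) ->
  (forall t, 0 <= t <= 1 -> b t <= - lambda * D t) ->
  D 1 <= delta + B 1 /\
  (1 + lambda) * D 1 <= delta + (1 + lambda) * B 1 - lambda * integral_itv 0 1 B.
Proof.
move=> l0 cD cb cB eqD D0 bD.
have z01 : (0 : R) <= 0 <= (1 : R) by rewrite lexx ler01.
have o01 : (0 : R) <= 1 <= (1 : R) by rewrite ler01 lexx.
have b0 t : 0 <= t <= 1 -> b t <= 0.
  by move=> t01; apply: le_trans (bD _ t01) _; rewrite mulNr oppr_le0 mulr_ge0// ltW// D0.
have cz : continuous (fun _ : R => 0 : R) by exact: cst_continuous.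
have I0 s : 0 <= s <= 1 -> integral_itv s 1 b <= 0.
  move=> /andP[s0 s1]; rewrite -[leRHS](mul0r (1 - s)) -integral_itv_cst//.
  by apply: le_integral_itv => // u /andP[su u1]; apply: b0; rewrite (le_trans s0).
split; first by have := I0 _ z01; rewrite (eqD _ o01); lra.
have DB s : 0 <= s <= 1 -> D 1 - B 1 + B s <= D s.
  move=> s01; have := I0 s s01; have /andP[s0 s1] := s01.
  by rewrite (eqD _ o01) (eqD _ s01) (integral_itv_split cb s0 s1); lra.
have I1 : D 1 - B 1 + integral_itv 0 1 B <= integral_itv 0 1 D.
  have cc : continuous (fun _ : R => D 1 - B 1) by exact: cst_continuous.
  rewrite -[X in X + _](mulr1) -[X in _ * X](subr0 1) -integral_itv_cst// -integral_itvD//.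
  have cDB : continuous (fun u => D 1 - B 1 + B u).
    by move=> u; apply: cvgD; [exact: cvg_cst|exact: cB].
  by apply: le_integral_itv => // u; exact: DB.
have I2 : integral_itv 0 1 b <= - lambda * integral_itv 0 1 D.
  rewrite -integral_itvZ//; apply: le_integral_itv => // u.
  by apply: cvgM; [exact: cvg_cst|exact: cD].
by have := ler_wpM2l l0 I1; have := eqD _ o01; move: I2; lra.
Qed.

(** If Z increases at rate at most m as long as it is nonnegative, integrating
    from its last zero bounds it by the integral of m. *)
Lemma last_zero_bound (Z c m : R -> R) :
  continuous Z -> continuous c -> continuous m ->
  (forall s t, 0 <= s -> s <= t -> t <= 1 -> Z t - Z s = integral_itv s t c) ->
  Z 0 <= 0 -> (forall u, 0 <= m u) ->
  (forall u, 0 <= u <= 1 -> 0 <= Z u -> c u <= m u) ->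
  Z 1 <= integral_itv 0 1 m.
Proof.
move=> cZ cc cm eqZ Z0 m0 Zc.
have cz : continuous (fun _ : R => 0 : R) by exact: cst_continuous.
have m_ge0 s t : s <= t -> 0 <= integral_itv s t m.
  by move=> st; rewrite -[leLHS](mul0r (t - s)) -integral_itv_cst//; exact: le_integral_itv.
have [Z1|Z1] := leP (Z 1) 0; first by rewrite (le_trans Z1)// m_ge0.
(* The last zero of Z before 1. *)
pose S := [set u | 0 <= u <= 1 /\ Z u <= 0].
have S0 : S 0 by split => //; apply/andP; split; lra.
have supS : has_sup S by split; [exists 0|exists 1 => u [/andP[]]].
pose s := sup S.
have s0 : 0 <= s by apply: ub_le_sup => //; case: supS.
have s1 : s <= 1 by apply: ge_sup; [exists 0|move=> u [/andP[]]].
have Zs_le : Z s <= 0.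
  rewrite leNgt; apply/negP => Zs.
  have /cvgrPdist_lt/(_ _ Zs) [/= r r0 Hr] := cZ s.
  have [u [u01 Zu] us] := sup_adherent r0 supS.
  have us' : u <= s by apply: ub_le_sup => //; case: supS.
  have : `|Z s - Z u| < Z s by apply: Hr; rewrite /= ger0_norm ?subr_ge0//; move: us;
    rewrite -/s; lra.
  by rewrite ltr_norml => /andP[]; lra.
have s_lt1 : s < 1 by rewrite lt_neqAle s1 andbT; apply: contraTneq Zs_le => ->; rewrite -ltNge.
have Zpos u : s < u -> u <= 1 -> 0 < Z u.
  move=> su u1; rewrite ltNge; apply/negP => Zu.
  have : u <= s by apply: ub_le_sup; [case: supS|split=> //; rewrite (le_trans s0)// ltW].
  by rewrite leNgt su.
have Zs_ge : 0 <= Z s.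
  rewrite leNgt; apply/negP => Zs.
  have Zs' : 0 < - Z s by rewrite oppr_gt0.
  have /cvgrPdist_lt/(_ _ Zs') [/= r r0 Hr] := cZ s.
  pose u := Num.min (s + r / 2) 1.
  have su : s < u by rewrite lt_min s_lt1 andbT ltrDl divr_gt0.
  have u1 : u <= 1 by rewrite ge_min lexx orbT.
  have ur : u <= s + r / 2 by rewrite ge_min lexx.
  have : `|Z s - Z u| < - Z s.
    by apply: Hr; rewrite /= distrC ger0_norm ?subr_ge0 ?(ltW su)//; lra.
  by have := Zpos _ su u1; rewrite ltr_norml => ? /andP[]; lra.
have H : Z 1 <= integral_itv s 1 c by have := eqZ s 1 s0 s1 (lexx _); lra.
apply: (le_trans H); apply: (@le_trans _ _ (integral_itv s 1 m)).
  apply: le_integral_itv => // u /andP[su u1]; apply: Zc; first by rewrite (le_trans s0).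
  by move: su; rewrite le_eqVlt => /predU1P[<-//|su]; apply/ltW/Zpos.
by rewrite (integral_itv_split cm s0 s1) lerDr m_ge0.
Qed.

End bounds.

(** * Mixtures of measures and independence *)
Section mixtures.
Context (R : realType).

(** The right-hand side of the Markov property is a measure in the target set,
    which allows it to be checked on a pi-system of targets. *)
Lemma mixture_measure d (T : measurableType d) d' (E : measurableType d')
    (mu : {measure set T -> \bar R}) (F : set T) (k : T -> {measure set E -> \bar R}) :
  measurable F ->
  (forall B, measurable B -> measurable_fun setT (fun x => k x B)) ->
  exists m : {measure set E -> \bar R},
    forall B, m B = (\int[mu]_(x in F) k x B)%E.
Proof.
move=> mF mk; pose m B := (\int[mu]_(x in F) k x B)%E.
have m0 : m set0 = 0%E by rewrite /m integral0_eq.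
have m_ge0 A : (0 <= m A)%E by apply: integral_ge0.
have m_add : semi_sigma_additive m.
  move=> G mG tG mUG; rewrite /m.
  under [X in _ --> X]eq_integral.
    move=> x _.
    have /cvg_lim <- // := @measure_semi_sigma_additive _ _ _ (k x) G mG tG mUG.
    over.
  rewrite integral_nneseries//; last by move=> n; apply: measurable_funTS; exact: mk.
  by apply: is_cvg_ereal_nneg_natsum_cond => n _ _; exact: integral_ge0.
pose mB := isMeasure.Build d' E R m m0 m_ge0 m_add.
pose M : {measure set E -> \bar R} := HB.pack m mB.
by exists M.
Qed.

(** The counterpart of [mixture_measure] for the left-hand side. *)
Lemma restricted_image_measure d (T : measurableType d) d' (E : measurableType d')
    (mu : {measure set T -> \bar R}) (F : set T) (Y : T -> E) :
  measurable F -> measurable_fun setT Y ->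
  exists m : {measure set E -> \bar R},
    forall B, measurable B -> m B = mu (F `&` Y @^-1` B).
Proof.
move=> mF mY.
have mk B : measurable B -> measurable_fun setT (fun x => (\d_(Y x) B : \bar R)).
  move=> mB; rewrite (_ : (fun x => _) = fun x => (\1_(Y @^-1` B) x)%:E).
    apply/measurable_EFinP/measurable_indic.
    by rewrite -[X in measurable X]setTI; exact: mY.
  by apply/funext => x; rewrite diracE indicE/=.
have [m mE] := mixture_measure mu mF mk; exists m => B mB; rewrite mE.
rewrite (eq_integral (fun x => (\1_(Y @^-1` B) x)%:E)); last first.
  by move=> x _; rewrite [LHS]diracE indicE.
have mYB : measurable (Y @^-1` B) by rewrite -[X in measurable X]setTI; exact: mY.
by rewrite integral_indic// setIC.
Qed.

Context d (T : measurableType d) (Pr : probability T R).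

(** The law of (Z, D) is the product of the law of Z and N; then the Tonelli
    theorem applies. *)
Lemma indep_integral d1 (E : measurableType d1) d2 (E2 : measurableType d2)
    (Z : T -> E) (D : T -> E2) (N : probability E2 R) (g : E * E2 -> \bar R) :
  measurable_fun setT Z -> measurable_fun setT D ->
  (forall A B, measurable A -> measurable B ->
    Pr (Z @^-1` A `&` D @^-1` B) = (Pr (Z @^-1` A) * N B)%E) ->
  measurable_fun setT g -> (forall x, (0 <= g x)%E) ->
  (\int[Pr]_o g (Z o, D o) = \int[Pr]_o \int[N]_z g (Z o, z))%E.
Proof.
move=> mZ mD ind mg g0.
have mZD : measurable_fun setT (fun o => (Z o, D o)) by exact: measurable_fun_pair.
pose ZB := isMeasurableFun.Build _ _ _ _ Z mZ.
pose Zm : {mfun T >-> E} := HB.pack Z ZB.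
pose ZDB := isMeasurableFun.Build _ _ _ _ _ mZD.
pose ZDm : {mfun T >-> (E * E2)%type} := HB.pack (fun o => (Z o, D o)) ZDB.
have <- : (\int[distribution Pr ZDm]_y g y = \int[Pr]_o g (Z o, D o))%E.
  by rewrite ge0_integral_distribution.
have prodE : forall X, measurable X -> (distribution Pr Zm \x N)%E X = distribution Pr ZDm X.
  apply: product_measure_unique => A B mA mB.
  by rewrite /distribution /pushforward/= -ind.
rewrite -(eq_measure_integral _ (fun A mA _ => prodE A mA)) fubini_tonelli1//.
have mF : measurable_fun setT (fun x => \int[N]_z g (x, z))%E.
  exact: (@measurable_fun_fubini_tonelli_F _ _ _ _ _ N g).
rewrite (@ge0_integral_distribution _ _ _ _ _ _ Zm (fun x => \int[N]_z g (x, z))%E)//.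
by move=> x; apply: integral_ge0.
Qed.

Lemma bounded_cvg_integral (F : set T) (f_ : nat -> T -> R) (f : T -> R) :
  measurable F -> (forall n, measurable_fun setT (f_ n)) -> measurable_fun setT f ->
  (forall n x, 0 <= f_ n x <= 1) ->
  {ae Pr, forall x, f_ n x @[n --> \oo] --> f x} ->
  (\int[Pr]_(x in F) (f_ n x)%:E @[n --> \oo] --> \int[Pr]_(x in F) (f x)%:E)%E.
Proof.
move=> mF mf_ mf f01 cvf.
have i1 : Pr.-integrable F (fun=> 1%:E).
  apply: (@integrableS _ _ _ _ setT) => //.
  exact: finite_measure_integrable_cst.
have [] := @dominated_convergence _ _ _ Pr F mF (fun n x => (f_ n x)%:E) (fun x => (f x)%:E)
  (fun=> 1%:E) _ _ _ i1 _ => //.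
- by move=> n; apply/measurable_EFinP; apply: measurable_funTS.
- by apply/measurable_EFinP; apply: measurable_funTS.
- by apply: filterS cvf => x Hx _; apply: cvg_EFin; [exact: nearW|exact: Hx].
- apply: nearW => x n _; have /andP[? ?] := f01 n x.
  by rewrite lee_fin ger0_norm.
Qed.

End mixtures.

(** * The Markov property of the strong solution *)
Section markov.
Context (R : realType) d (T : measurableType d) (Pr : probability T R).
Variables (a : R -> R) (L : R).
Hypotheses (L0 : 0 <= L) (aL : forall x y, `|a x - a y| <= L * `|x - y|).
Variable w : R -> T -> R.
Hypothesis Ww : wiener_process Pr w.

Let ca : continuous a := lipschitz_continuous L0 aL.
Let ma : measurable_fun setT a.
Proof. exact: continuous_measurable_fun. Qed.

Definition euler_op (h : R) (f : R -> \bar R) (x : R) : \bar R :=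
  (\int[normal_prob 0 (Num.sqrt h)]_z f (x + h * a x + z)%R)%E.

Lemma euler_op_ge0 h f : (forall x, (0 <= f x)%E) -> forall x, (0 <= euler_op h f x)%E.
Proof. by move=> f0 x; exact: integral_ge0. Qed.

Let measurable_step h : measurable_fun setT (fun p : R * R => p.1 + h * a p.1 + p.2).
Proof.
apply: measurable_funD; last exact: measurable_snd.
apply: measurable_funD; first exact: measurable_fst.
by apply: measurable_funM => //; apply: measurableT_comp => //; exact: measurable_fst.
Qed.

Lemma measurable_euler_op h f : measurable_fun setT f -> (forall x, (0 <= f x)%E) ->
  measurable_fun setT (euler_op h f).
Proof.
move=> mf f0.
apply: (@measurable_fun_fubini_tonelli_F _ _ _ _ _ (normal_prob 0 (Num.sqrt h))
   (fun p : R * R => f (p.1 + h * a p.1 + p.2)%R)) => //.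
exact: measurableT_comp (measurable_step h).
Qed.

Definition past_measurable (u : R) (Y : T -> R) :=
  forall B, measurable B -> augmented_filtration Pr w u (Y @^-1` B).

(** The increment over [u, u + h] is independent of the pair formed by Y and the
    indicator of F, so it can be integrated out first. *)
Lemma euler_op_step u h F Y f : 0 <= u -> 0 < h ->
  augmented_filtration Pr w u F -> past_measurable u Y ->
  measurable_fun setT f -> (forall x, (0 <= f x)%E) ->
  (\int[Pr]_(o in F) f (Y o + h * a (Y o) + (w (u + h)%R o - w u o))%R =
   \int[Pr]_(o in F) euler_op h f (Y o))%E.
Proof.
move=> u0 h0 uF uY mf f0.
have mA := augmented_measurable Ww (u := u).
have mF : measurable F := mA _ uF.
have mY : measurable_fun setT Y by move=> _ B mB; rewrite setTI; apply: mA; exact: uY.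
pose G := sigma_gen `[0, u] w `|` [set N | measurable N /\ Pr N = 0%E].
have mYG : measurable_fun (setT : set (g_sigma_algebraType G)) Y.
  by move=> _ B mB; rewrite setTI; exact: uY.
have mFG : measurable_fun (setT : set (g_sigma_algebraType G)) (\1_F : _ -> R).
  exact: measurable_indic.
have mZG : measurable_fun (setT : set (g_sigma_algebraType G)) (fun o => (\1_F o : R, Y o)).
  exact: measurable_fun_pair.
have mZ : measurable_fun setT (fun o => (\1_F o : R, Y o)).
  by apply: measurable_fun_pair => //; exact: measurable_indic.
have uh0 : 0 <= u + h by rewrite addr_ge0// ltW.
have mD := wiener_increment_measurable Ww u0 uh0.
pose g (p : (R * R) * R) := (f (p.1.2 + h * a p.1.2 + p.2)%R * `|p.1.1|%:E)%E.
have mg : measurable_fun setT g.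
  apply: emeasurable_funM.
    apply: measurableT_comp => //.
    apply: (@measurableT_comp _ _ _ _ _ _ (fun p : R * R => p.1 + h * a p.1 + p.2) _
      (fun p : (R * R) * R => (p.1.2, p.2))); first exact: measurable_step.
    apply: measurable_fun_pair; last exact: measurable_snd.
    by apply: measurableT_comp; [exact: measurable_snd|exact: measurable_fst].
  apply/measurable_EFinP; apply: measurableT_comp => //.
  by apply: measurableT_comp; [exact: measurable_fst|exact: measurable_fst].
have g0 p : (0 <= g p)%E by rewrite mule_ge0// lee_fin.
have normI o : `|\1_F o| = \1_F o :> R by rewrite ger0_norm// indicE.
rewrite integral_mkcond epatch_indic [in RHS]integral_mkcond epatch_indic.
transitivity (\int[Pr]_o g ((\1_F o, Y o), w (u + h)%R o - w u o)%R)%E.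
  by apply: eq_integral => o _; rewrite /g; congr (_ * _%:E)%E; exact/esym/normI.
rewrite (indep_integral (Z := fun o => (\1_F o : R, Y o)) (N := normal_prob 0 (Num.sqrt h)) mZ
  mD _ mg g0).
  apply: eq_integral => o _; rewrite /g/=.
  rewrite ge0_integralZr//=; first by congr (_ * _%:E)%E; exact: normI.
  apply: measurableT_comp => //; apply: measurable_funD => //.
move=> A B mA' mB; apply: wiener_increment_independent => //.
by have := mZG measurableT A mA'; rewrite setTI.
Qed.

Section chain.
Variables (u h : R) (Y0 : T -> R).
Hypotheses (u0 : 0 <= u) (h0 : 0 < h) (uY0 : past_measurable u Y0).

Definition increments (o : T) (k : nat) : R :=
  w (u + h * k.+1%:R) o - w (u + h * k%:R) o.

Lemma euler_past_measurable k :
  past_measurable (u + h * k%:R) (fun o => euler a h (Y0 o) (increments o) k).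
Proof.
elim: k => [|k IH] /=; first by rewrite mulr0 addr0.
pose G v := sigma_gen `[0, v] w `|` [set N | measurable N /\ Pr N = 0%E].
have kk : u + h * k%:R <= u + h * k.+1%:R by rewrite lerD2l; apply: ler_wpM2l;
  [exact: ltW|rewrite ler_nat].
have k0 j : 0 <= u + h * j%:R by rewrite addr_ge0// mulr_ge0// ltW.
set v := u + h * k.+1%:R in kk *.
have mw r : 0 <= r <= v -> measurable_fun (setT : set (g_sigma_algebraType (G v))) (w r).
  move=> rv _ B mB; rewrite setTI; apply: sub_sigma_algebra; left.
  by apply: sigma_gen_preimage => //=; rewrite in_itv.
have mY : measurable_fun (setT : set (g_sigma_algebraType (G v)))
    (fun o => euler a h (Y0 o) (increments o) k).
  by move=> _ B mB; rewrite setTI; apply: augmented_sub kk _ _; exact: IH.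
have : measurable_fun (setT : set (g_sigma_algebraType (G v)))
    (fun o => let y := euler a h (Y0 o) (increments o) k in
       y + h * a y + increments o k).
  apply: measurable_funD.
    apply: measurable_funD => //.
    by apply: measurable_funM => //; exact: measurableT_comp.
  by apply: measurable_funB; apply: mw; rewrite k0 ?lexx.
by move=> mE B mB; have := mE measurableT B mB; rewrite setTI.
Qed.

(** Iterating [euler_op_step]: the distribution of the Euler scheme only
    depends on its starting point. *)
Lemma euler_integral F f k : augmented_filtration Pr w u F ->
  measurable_fun setT f -> (forall x, (0 <= f x)%E) ->
  (\int[Pr]_(o in F) f (euler a h (Y0 o) (increments o) k) =
   \int[Pr]_(o in F) iter k (euler_op h) f (Y0 o))%E.
Proof.
move=> uF; elim: k f => [//|k IH] f mf f0.
rewrite iterSr -IH; [|exact: measurable_euler_op|exact: euler_op_ge0].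
have k0 : 0 <= u + h * k%:R by rewrite addr_ge0// mulr_ge0// ltW.
rewrite -(euler_op_step k0 h0 _ (@euler_past_measurable k))//; last first.
  by apply: augmented_sub uF; rewrite lerDl mulr_ge0// ltW.
apply: eq_integral => o _ /=; rewrite /increments -natr1 mulrDr mulr1.
by congr f; rewrite !addrA.
Qed.

End chain.

Section solution.
Variables (x : R) (X : R -> T -> R).
Hypothesis solX : strong_solution Pr a w x X.

Definition solution_path (o : T) (t : R) : R := X (Num.max 0 t) o.

Lemma solution_path_continuous o : continuous (solution_path o).
Proof. exact: (@continuous_extend0 R (X ^~ o) (@solution_continuous _ _ _ _ _ _ _ _ solX o)).
  Qed.

Lemma solution_pathE o t : 0 <= t -> solution_path o t = X t o.
Proof. by move=> t0; rewrite /solution_path (max_idPr t0). Qed.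

Lemma solution_path_eq : {ae Pr, forall o, X 0 o = x /\
  forall t, 0 <= t ->
    X t o = x + integral_itv 0 t (a \o solution_path o) + w t o}.
Proof.
apply: filterS (solution_eq solX) => o eqX.
have eqX' t : 0 <= t -> X t o = x + integral_itv 0 t (a \o solution_path o) + w t o.
  move=> t0; rewrite eqX//; congr (_ + _ + _); apply: eq_Rintegral => s.
  by rewrite inE/= in_itv/= => /andP[s0 _]; rewrite solution_pathE.
split; last by [].
by rewrite eqX'// integral_itvxx (wiener0 Ww) !addr0.
Qed.

Lemma solution_path_increment : {ae Pr, forall o, forall r r', 0 <= r -> r <= r' ->
  solution_path o r' - solution_path o r =
  integral_itv r r' (a \o solution_path o) + (w r' o - w r o)}.
Proof.
apply: filterS solution_path_eq => o [_ eqX] r r' r0 rr'.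
have r'0 : 0 <= r' by exact: le_trans rr'.
have cb : continuous (a \o solution_path o).
  by move=> u; apply: continuous_comp; [exact: solution_path_continuous|exact: ca].
rewrite !solution_pathE// !eqX// (integral_itv_split cb r0 rr'); ring.
Qed.

Lemma solution_euler_cvg s t : 0 <= s -> 0 <= t ->
  {ae Pr, forall o,
    euler a (t / n.+1%:R) (X s o) (increments s (t / n.+1%:R) o) n.+1
      @[n --> \oo] --> X (s + t) o}.
Proof.
move=> s0 t0; apply: filterS solution_path_increment => o eqX.
have := @euler_cvg R a L L0 aL (solution_path o) (w ^~ o) (@solution_path_continuous o) s t t0.
rewrite !solution_pathE ?addr_ge0//; apply.
by move=> r r' sr rr' _; apply: eqX => //; exact: le_trans sr.
Qed.

End solution.

Variable X : R -> R -> T -> R.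
Hypothesis solX : forall x, strong_solution Pr a w x (X x).
Variable P1 : semigroup_on R 1.
Hypothesis P1E : forall t x A, 0 <= t -> measurable A ->
  P1 t [tuple x] A = Pr [set o | A [tuple X x t o]].

Lemma measurable_tuple1 : measurable_fun setT (fun x : R => [tuple x]).
Proof.
apply/measurable_fun_tnthP => i.
by rewrite (_ : _ \o _ = id)//; apply/funext => x; rewrite /= (ord1 i).
Qed.

Lemma tuple1_eta (y : 1.-tuple R) : [tuple thead y] = y.
Proof. by apply/eq_from_tnth => i; rewrite (ord1 i) (tnth_nth 0). Qed.

Lemma measurable_thead : measurable_fun setT (fun y : 1.-tuple R => thead y).
Proof. exact: measurable_tnth. Qed.

Let mX x t : 0 <= t -> measurable_fun setT (X x t).
Proof. exact: (solution_measurable (solX x)). Qed.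

Let mP1 t B : measurable B -> measurable_fun setT (fun x => P1 t [tuple x] B).
Proof.
move=> mB; apply: (measurableT_comp (f := fun y => P1 t y B)).
  exact: measurable_kernel.
exact: measurable_tuple1.
Qed.

Section fixed_start.
Variables (x s t : R) (F : set T).
Hypotheses (s0 : 0 <= s) (t_gt0 : 0 < t) (sF : augmented_filtration Pr w s F).

Let mF : measurable F. Proof. exact: augmented_measurable sF. Qed.
Let st0 : 0 <= s + t. Proof. by rewrite addr_ge0// ltW. Qed.

Let phi (f : R -> R) (y : R) : \bar R := (\int[Pr]_o (f (X y t o))%:E)%E.

(** The Markov property for continuous test functions, as a limit of
    [euler_integral]; the same limit at the time origin identifies the
    transition operator. *)
Lemma markov_continuous (f : R -> R) : continuous f -> (forall y, 0 <= f y <= 1) ->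
  measurable_fun setT (phi f) /\
  (\int[Pr]_(o in F) (f (X x (s + t) o))%:E = \int[Pr]_(o in F) phi f (X x s o))%E.
Proof.
move=> cf f01.
have mf : measurable_fun setT f by exact: continuous_measurable_fun.
have mEf : measurable_fun setT (EFin \o f) by exact/measurable_EFinP.
have Ef0 y : (0 <= (EFin \o f) y)%E by rewrite /= lee_fin; case/andP: (f01 y).
pose h n : R := t / n.+1%:R.
have h0 n : 0 < h n by rewrite divr_gt0.
pose phin n := iter n.+1 (euler_op (h n)) (EFin \o f).
have iter_ge0 n k y : (0 <= iter k (euler_op (h n)) (EFin \o f) y)%E.
  by elim: k y => [//|k IH] y; exact: euler_op_ge0.
have miter n k : measurable_fun setT (iter k (euler_op (h n)) (EFin \o f)).
  by elim: k => [//|k IH]; apply: measurable_euler_op => // y; exact: iter_ge0.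
have past_cst y : past_measurable 0 (cst y).
  move=> B mB; rewrite preimage_cst; case: ifP => _.
    exact: (@measurableT _ (g_sigma_algebraType _)).
  apply: (@measurable0 _ (g_sigma_algebraType _)).
have past_X : past_measurable s (X x s).
  by move=> B mB; apply: (solution_adapted (solX x)).
have m_euler u (Y : T -> R) n : 0 <= u -> past_measurable u Y ->
    measurable_fun setT (fun o => euler a (h n) (Y o) (increments u (h n) o) n.+1).
  move=> u0 uY _ B mB; rewrite setTI.
  apply: (augmented_measurable Ww (u := u + h n * n.+1%:R)).
  exact: (euler_past_measurable u0 (h0 n) uY).
have f01' n u (Y : T -> R) o : 0 <= f (euler a (h n) (Y o) (increments u (h n) o) n.+1) <= 1
  by [].
have phinE n y : phin n y =
    (\int[Pr]_o (f (euler a (h n) y (increments 0 (h n) o) n.+1))%:E)%E.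
  have sT : augmented_filtration Pr w 0 setT by exact: (@measurableT _ (g_sigma_algebraType _)).
  have := euler_integral (lexx 0) (h0 n) (past_cst y) n.+1 sT mEf Ef0.
  rewrite /= => ->; rewrite -[LHS]mule1 -(@probability_setT _ _ _ Pr).
  by rewrite -integral_cst.
have cvg_phin y : phin n y @[n --> \oo] --> phi f y.
  under eq_fun do rewrite phinE.
  apply: (@bounded_cvg_integral R _ T Pr setT (fun n o => f (euler a (h n) y (increments 0 (h
    n) o) n.+1)) (fun o => f (X y t o))) => //.
  - by move=> n; apply: measurableT_comp => //; exact: (m_euler 0 (cst y)).
  - by apply: measurableT_comp => //; apply: mX; exact: ltW.
  - have := solution_euler_cvg (solX y) (lexx 0) (ltW t_gt0).
    move=> H; have := solution_path_eq (solX y).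
    apply: filterS2 H => o H [X0 _].
    by rewrite add0r X0 in H; exact: (continuous_cvg_seq cf H).
have phin1 n y : (phin n y <= 1)%E.
  rewrite phinE -(@probability_setT _ _ _ Pr) -[leRHS]mul1e -integral_cst//.
  apply: ge0_le_integral => //.
  - by move=> o _; exact: Ef0.
  - by apply/measurable_EFinP; apply: measurableT_comp => //; exact: (m_euler 0 (cst y)).
  - by move=> o _; rewrite lee_fin; case/andP: (f01 (euler a (h n) y (increments 0 (h n) o)
    n.+1)).
have mphi : measurable_fun setT (phi f).
  by apply: (emeasurable_fun_cvg phin) => // n; exact: miter.
split => //.
have lhs : (\int[Pr]_(o in F) (f (euler a (h n) (X x s o) (increments s (h n) o) n.+1))%:E
    @[n --> \oo] --> \int[Pr]_(o in F) (f (X x (s + t) o))%:E)%E.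
  apply: (@bounded_cvg_integral R _ T Pr F (fun n o => f (euler a (h n) (X x s o) (increments
    s (h n) o) n.+1)) (fun o => f (X x (s + t) o))) => //.
  - by move=> n; apply: measurableT_comp => //; exact: (m_euler s).
  - by apply: measurableT_comp => //; exact: mX.
  - apply: filterS (solution_euler_cvg (solX x) s0 (ltW t_gt0)) => o H.
    exact: (continuous_cvg_seq cf H).
have rhs : (\int[Pr]_(o in F) phin n (X x s o)
    @[n --> \oo] --> \int[Pr]_(o in F) phi f (X x s o))%E.
  have i1 : Pr.-integrable F (fun=> 1%:E).
    apply: (@integrableS _ _ _ _ setT) => //.
    exact: finite_measure_integrable_cst.
  have mXs := mX x s0.
  have [] := @dominated_convergence _ _ _ Pr F mF (fun n o => phin n (X x s o)) (fun o => phi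
    f (X x s o)) (fun=> 1%:E) _ _ _ i1 _ => //.
  - by move=> n; apply: measurable_funTS; apply: measurableT_comp => //; exact: miter.
  - by apply: measurable_funTS; apply: measurableT_comp.
  - by apply: nearW => o _; exact: cvg_phin.
  - by apply: nearW => o n _; rewrite gee0_abs//; exact: iter_ge0.
apply: (cvg_unique _ lhs) => //.
move: rhs; under eq_fun do rewrite -(euler_integral s0 (h0 _) past_X _ sF mEf Ef0).
exact.
Qed.

(** Indicators of half-lines are increasing limits of continuous functions with
    values in [0, 1]. *)
Lemma markov_halfline c : let B := [set y : 1.-tuple R | c < thead y] in
  Pr (F `&` [set o | B [tuple X x (s + t) o]]) =
  (\int[Pr]_(o in F) P1 t [tuple X x s o] B)%E.
Proof.
move=> B.
have mB : measurable B.
  rewrite (_ : B = (fun y : 1.-tuple R => thead y) @^-1` `]c, +oo[).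
    by rewrite -[X in measurable X]setTI; apply: measurable_thead.
  by apply/seteqP; split => y; rewrite /= in_itv/= andbT.
pose f m (y : R) : R := Num.min 1 (Num.max 0 (m%:R * (y - c))).
have f01 m y : 0 <= f m y <= 1.
  by rewrite /f ge_min lexx le_min ler01 le_max lexx.
have clampL (u v : R) : `|Num.min 1 (Num.max 0 u) - Num.min 1 (Num.max 0 v)| <= `|u - v|.
  rewrite ler_norml; have := ler_norm (u - v); have := ler_norm (v - u).
  rewrite (distrC v) !minEle !maxEle.
  by case: (lerP 0 u) => ?; case: (lerP 0 v) => ?; do ?case: (lerP 1 _) => ? *;
    apply/andP; split; lra.
have cf m : continuous (f m).
  apply: (@lipschitz_continuous R (f m) m%:R) => // y z.
  apply: le_trans (clampL _ _) _.
  by rewrite -mulrBr normrM ger0_norm// (_ : y - c - (z - c) = y - z)//; ring.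
have f_cvg y : f m y @[m --> \oo] --> (\1_[set y : R | c < y] y : R).
  rewrite indicE; have [cy|yc] := ltP c y.
    rewrite mem_set//=; apply: cvg_near_cst; near=> m.
    rewrite /f; apply/min_idPl; rewrite le_max; apply/orP; right.
    rewrite -ler_pdivrMr ?subr_gt0//.
    near: m; exact: nbhs_infty_ger.
  rewrite memNset/=; last by apply/negP; rewrite -leNgt.
  apply: cvg_near_cst; apply: nearW => m; rewrite /f (max_idPl _) ?(min_idPr _)//.
  by rewrite mulr_ge0_le0// subr_le0.
have mf m : measurable_fun setT (f m) by exact: continuous_measurable_fun.
have m1 : measurable_fun setT (\1_[set y : R | c < y] : R -> R).
  apply: measurable_indic; rewrite (_ : [set _ | _] = `]c, +oo[%classic)//.
  by apply/seteqP; split => y; rewrite /= in_itv/= andbT.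
have mXs := mX x s0; have mXst := mX x st0.
have i1 : Pr.-integrable F (fun=> 1%:E).
  apply: (@integrableS _ _ _ _ setT) => //.
  exact: finite_measure_integrable_cst.
have indE (Y : T -> R) G : measurable_fun setT Y -> measurable G ->
    (\int[Pr]_(o in G) ((\1_[set y : R | (c < y)%R] (Y o) : R)%:E) =
    Pr (G `&` [set o | B [tuple Y o]]))%E.
  move=> mY mG.
  have mYc : measurable [set o | B [tuple Y o]].
    rewrite -[X in measurable X]setTI.
    exact: (measurableT_comp measurable_tuple1 mY).
  rewrite (eq_integral (fun o => (\1_[set o | B [tuple Y o]] o)%:E)).
    by rewrite integral_indic// setIC.
  by move=> o _; rewrite !indicE.
have lhs : (\int[Pr]_(o in F) (f m (X x (s + t) o))%:E
    @[m --> \oo] --> Pr (F `&` [set o | B [tuple X x (s + t) o]]))%E.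
  rewrite -indE//.
  apply: (@bounded_cvg_integral R _ T Pr F (fun m o => f m (X x (s + t) o)) (fun o => \1_[set
    y : R | c < y] (X x (s + t) o))) => //.
  - by move=> m; apply: measurableT_comp.
  - exact: measurableT_comp.
  - by apply: nearW => o; exact: f_cvg.
have phi_cvg y : phi (f m) y @[m --> \oo] --> P1 t [tuple y] B.
  have t0 := ltW t_gt0; have mXy := mX y t0.
  rewrite P1E// -[X in Pr X]setTI -indE//.
  apply: (@bounded_cvg_integral R _ T Pr setT (fun m o => f m (X y t o)) (fun o => \1_[set y :
    R | c < y] (X y t o))) => //.
  - by move=> m; apply: measurableT_comp.
  - exact: measurableT_comp.
  - by apply: nearW => o; exact: f_cvg.
have phi01 m y : (0 <= phi (f m) y <= 1)%E.
  have t0 := ltW t_gt0; have mXy := mX y t0.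
  apply/andP; split.
    by apply: integral_ge0 => o _; rewrite lee_fin; case/andP: (f01 m (X y t o)).
  rewrite -(@probability_setT _ _ _ Pr) -[leRHS]mul1e -integral_cst//.
  apply: ge0_le_integral => //.
  - by move=> o _; rewrite lee_fin; case/andP: (f01 m (X y t o)).
  - by apply/measurable_EFinP; apply: measurableT_comp.
  - by move=> o _; rewrite lee_fin; case/andP: (f01 m (X y t o)).
have rhs : (\int[Pr]_(o in F) phi (f m) (X x s o)
    @[m --> \oo] --> \int[Pr]_(o in F) P1 t [tuple X x s o] B)%E.
  have [] := @dominated_convergence _ _ _ Pr F mF (fun m o => phi (f m) (X x s o)) (fun o =>
    P1 t [tuple X x s o] B) (fun=> 1%:E) _ _ _ i1 _ => //.
  - move=> m; apply: measurable_funTS; apply: measurableT_comp => //.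
    by have [] := markov_continuous (cf m) (f01 m).
  - by apply: measurable_funTS; exact: (measurableT_comp (mP1 t mB) mXs).
  - by apply: nearW => o _; exact: phi_cvg.
  - by apply: nearW => o n _; have /andP[? ?] := phi01 n (X x s o); rewrite gee0_abs.
apply: (cvg_unique _ lhs) => //.
move: rhs; under eq_fun do rewrite -(markov_continuous (cf _) (f01 _)).2.
exact.
Unshelve. all: by end_near. Qed.

(** Half-lines form a pi-system generating the Borel sets. *)
Lemma markov_pos B : measurable B ->
  Pr (F `&` [set o | B [tuple X x (s + t) o]]) =
  (\int[Pr]_(o in F) P1 t [tuple X x s o] B)%E.
Proof.
have mXs := mX x s0; have mXst := mX x st0.
have mY : measurable_fun setT (fun o => [tuple X x (s + t) o]).
  exact: (measurableT_comp measurable_tuple1 mXst).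
have [m1 m1E] := restricted_image_measure Pr mF mY.
have [m2 m2E] := @mixture_measure R _ T _ _ Pr F (fun o => P1 t [tuple X x s o]) mF
  (fun B mB => measurableT_comp (mP1 t mB) mXs).
have [n1 n1E] := restricted_image_measure m1 measurableT measurable_thead.
have [n2 n2E] := restricted_image_measure m2 measurableT measurable_thead.
have n12 A : measurable A -> n1 A = n2 A.
  move=> mA; apply: (@eq_measure_on_pi_system _ _ R ([set setT] `|` @RGenOInfty.G R)).
  - move=> _ [->|[c ->]]//; exact: measurable_itv.
  - move=> A1 A2 [->|[c1 ->]] [->|[c2 ->]].
    + by left; rewrite setTI.
    + by right; exists c2; rewrite setTI.
    + by right; exists c1; rewrite setIT.
    + right; exists (Num.max c1 c2); apply/seteqP; split => y /=;
      by rewrite !in_itv/= !andbT gt_max => /andP.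
  - by left.
  - rewrite n1E// setTI preimage_setT m1E// preimage_setT setIT.
    by apply: le_lt_trans (ltry 1); exact: probability_le1.
  - move=> _ [->|[c ->]].
      rewrite n1E// n2E// setTI preimage_setT m1E// m2E preimage_setT setIT.
      rewrite (eq_integral (fun=> 1%E)) ?integral_cst ?mul1e//.
      by move=> o _; rewrite /= prob_kernel.
    rewrite n1E// n2E// !setTI m2E m1E; last first.
      by rewrite -[X in measurable X]setTI; apply: measurable_thead.
    have := markov_halfline c.
    rewrite (_ : [set y : 1.-tuple R | c < thead y] = (fun y : 1.-tuple R => thead y) @^-1`
      `]c, +oo[)//.
    by apply/seteqP; split => y; rewrite /= in_itv/= andbT.
  - move: mA; rewrite [measurable](RGenOInfty.measurableE R).
    by apply: sub_smallest2r; [exact: smallest_sigma_algebra|move=> ? ?; right].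
move=> mB; rewrite -[LHS](m1E B mB) -m2E.
pose A := [set r : R | B [tuple r]].
have mA : measurable A by rewrite -[X in measurable X]setTI; exact: measurable_tuple1.
have BE : B = (fun y : 1.-tuple R => thead y) @^-1` A.
  by apply/funext => y; rewrite /preimage/= /A/= tuple1_eta.
by have := n12 _ mA; rewrite n1E// n2E// !setTI -BE.
Qed.

End fixed_start.

Hypothesis P1_0 : forall x A, measurable A -> P1 0 x A = \d_x A.

(** The past is that of the noise completed by null sets, to which a strong
    solution is adapted; it contains the past of the solution itself. *)
Lemma solution_markov x s t F B : 0 <= s -> 0 <= t ->
  augmented_filtration Pr w s F -> measurable B ->
  Pr (F `&` [set o | B [tuple X x (s + t) o]]) =
  (\int[Pr]_(o in F) P1 t [tuple X x s o] B)%E.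
Proof.
move=> s0; rewrite le_eqVlt => /predU1P[<-|t0] sF mB; last exact: markov_pos.
have mF : measurable F by exact: augmented_measurable sF.
have mXs := mX x s0.
have mXB : measurable [set o | B [tuple X x s o]].
  rewrite -[X in measurable X]setTI.
  exact: (measurableT_comp measurable_tuple1 mXs).
rewrite addr0 (eq_integral (fun o => (\1_[set o | B [tuple X x s o]] o)%:E)).
  by rewrite integral_indic// setIC.
by move=> o _; rewrite P1_0// diracE indicE.
Qed.

End markov.

(** * Feller processes built from independent solutions *)
Section product_probability.
Context (R : realType) d1 d2 (T1 : measurableType d1) (T2 : measurableType d2).
Variables (P1 : probability T1 R) (P2 : probability T2 R).

Definition product_prob : set (T1 * T2) -> \bar R := (P1 \x P2)%E.

HB.instance Definition _ := Measure.on product_prob.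

Let product_prob_setT : product_prob setT = 1%E.
Proof.
transitivity (P1 setT * P2 setT)%E; last by rewrite !probability_setT mule1.
by rewrite -setXTT; exact: product_measure1E.
Qed.

HB.instance Definition _ :=
  Measure_isProbability.Build _ _ _ product_prob product_prob_setT.

Lemma product_probE A B : measurable A -> measurable B ->
  product_prob (A `*` B) = (P1 A * P2 B)%E.
Proof. by move=> mA mB; rewrite [LHS]product_measure1E. Qed.

Lemma ae_product_fst (Q : T1 -> Prop) : {ae P1, forall x, Q x} ->
  {ae product_prob, forall p, Q p.1}.
Proof.
move=> [N [mN N0 sN]]; exists (N `*` setT); split.
- exact: measurableX.
- by rewrite product_probE// N0 mul0e.
- by move=> p /= Qp; split => //; exact: sN.
Qed.

Lemma ae_product_snd (Q : T2 -> Prop) : {ae P2, forall x, Q x} ->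
  {ae product_prob, forall p, Q p.2}.
Proof.
move=> [N [mN N0 sN]]; exists (setT `*` N); split.
- exact: measurableX.
- by rewrite product_probE// N0 mule0.
- by move=> p /= Qp; split => //; exact: sN.
Qed.

Lemma product_prob_integral (f : T1 * T2 -> \bar R) :
  measurable_fun setT f -> (forall x, (0 <= f x)%E) ->
  (\int[product_prob]_p f p = \int[P1]_x \int[P2]_y f (x, y))%E.
Proof. by move=> mf f0; rewrite -[RHS]fubini_tonelli1. Qed.

Lemma product_prob_integral_fst (f : T1 -> \bar R) :
  measurable_fun setT f -> (forall x, (0 <= f x)%E) ->
  (\int[product_prob]_p f p.1 = \int[P1]_x f x)%E.
Proof.
move=> mf f0; rewrite product_prob_integral//; last exact: measurableT_comp measurable_fst.
apply: eq_integral => x _ /=; rewrite integral_cst//.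
by rewrite [X in (_ * X)%E](_ : _ = 1%E) ?mule1//; exact: probability_setT.
Qed.

Lemma product_prob_integral_snd (f : T2 -> \bar R) :
  measurable_fun setT f -> (forall x, (0 <= f x)%E) ->
  (\int[product_prob]_p f p.2 = \int[P2]_x f x)%E.
Proof.
move=> mf f0; rewrite product_prob_integral//; last exact: measurableT_comp measurable_snd.
rewrite (eq_integral (cst (\int[P2]_y f y)%E))//.
by rewrite integral_cst// [X in (_ * X)%E](_ : _ = 1%E) ?mule1//; exact: probability_setT.
Qed.

Lemma product_prob_integral_rect (F1 : set T1) (F2 : set T2) (f : T1 -> \bar R) (g : T2 ->
  \bar R) :
  measurable F1 -> measurable F2 ->
  measurable_fun setT f -> (forall x, (0 <= f x)%E) ->
  measurable_fun setT g -> (forall x, (0 <= g x)%E) ->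
  (\int[product_prob]_(p in F1 `*` F2) (f p.1 * g p.2) =
   (\int[P1]_(x in F1) f x) * (\int[P2]_(y in F2) g y))%E.
Proof.
move=> mF1 mF2 mf f0 mg g0.
rewrite integral_mkcond [in RHS]integral_mkcond [X in (_ * X)%E]integral_mkcond.
have mf' : measurable_fun setT (f \_ F1) by apply/(measurable_restrictT _ mF1)/measurable_funTS.
have mg' : measurable_fun setT (g \_ F2) by apply/(measurable_restrictT _ mF2)/measurable_funTS.
have f'0 x : (0 <= (f \_ F1) x)%E by rewrite patchE; case: ifP.
have g'0 x : (0 <= (g \_ F2) x)%E by rewrite patchE; case: ifP.
rewrite (eq_integral (fun p => (f \_ F1) p.1 * (g \_ F2) p.2)%E); last first.
  move=> [x y] _; rewrite !patchE/=.
  have -> : ((x, y) \in F1 `*` F2) = (x \in F1) && (y \in F2).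
    by apply/idP/andP; rewrite !inE.
  by case: (x \in F1); case: (y \in F2); rewrite ?mul0e ?mule0.
rewrite product_prob_integral.
- rewrite -ge0_integralZr//; last exact: integral_ge0.
  by apply: eq_integral => x _ /=; rewrite ge0_integralZl.
- apply: emeasurable_funM; first exact: measurableT_comp measurable_fst.
  exact: measurableT_comp measurable_snd.
- by move=> p; exact: mule_ge0.
Qed.

End product_probability.

Section boxes.
Context (R : realType).

Definition box n (A : 'I_n -> set R) : set (n.-tuple R) :=
  [set y | forall i, A i (tnth y i)].

Lemma measurable_box n (A : 'I_n -> set R) :
  (forall i, measurable (A i)) -> measurable (box A).
Proof.
move=> mA; rewrite (_ : box A = \bigcap_(i in [set: 'I_n]) (fun y : n.-tuple R => tnth y i)
  @^-1` A i).
  apply: fin_bigcap_measurable; first exact: finite_finset.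
  by move=> i _; rewrite -[X in measurable X]setTI; apply: measurable_tnth.
by apply/seteqP; split => y /= H i; [move=> _; exact: H|exact: (H i I)].
Qed.

Lemma eq_measure_on_boxes n (m1 m2 : {measure set (n.-tuple R) -> \bar R}) :
  (m1 setT < +oo)%E ->
  (forall A : 'I_n -> set R, (forall i, measurable (A i)) -> m1 (box A) = m2 (box A)) ->
  forall B, measurable B -> m1 B = m2 B.
Proof.
move=> fin1 eq12 B mB.
pose G := [set C | exists2 A : 'I_n -> set R, (forall i, measurable (A i)) & C = box A].
apply: (@eq_measure_on_pi_system _ _ R G) => //.
- by move=> _ [A mA ->]; exact: measurable_box.
- move=> _ _ [A mA ->] [A' mA' ->]; exists (fun i => A i `&` A' i).
    by move=> i; exact: measurableI.
  by apply/seteqP; split => y /= => [[H H'] i|H]; split => // i; have [] := H i.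
- by exists (fun=> setT) => //; apply/seteqP; split.
- by move=> _ [A mA ->]; exact: eq12.
- move: B mB; apply: smallest_sub; first exact: smallest_sigma_algebra.
  move=> C; rewrite -bigcup_seq => -[i _] [A mA <-].
  apply: sub_sigma_algebra; exists (fun j => if j == i then A else setT).
    by move=> j; case: ifP.
  rewrite setTI; apply/seteqP; split => y /=; first by move=> Ay j; case: eqP => [->|].
  by move=> /(_ i); rewrite eqxx.
Qed.

End boxes.

Lemma continuous_cadlag (R : realType) (f : R -> R) :
  {within `[0, +oo[, continuous f} ->
  (forall t, 0 <= t -> f s @[s --> t^'+] --> f t) /\
  (forall t, 0 < t -> cvg (f s @[s --> t^'-])).
Proof.
move=> /continuous_extend0 cf; split => t t0.
  have H : f (Num.max 0 s) @[s --> t^'+] --> f t.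
    by have := cvg_at_right_filter (cf t); rewrite (max_idPr t0).
  apply: cvg_trans H; apply: near_eq_cvg; near=> s.
  rewrite (max_idPr _)//; apply: le_trans t0 _; near: s.
  exact: nbhs_right_ge.
apply/cvg_ex; exists (f t).
have H : f (Num.max 0 s) @[s --> t^'-] --> f t.
  by have := cvg_at_left_filter (cf t); rewrite (max_idPr (ltW t0)).
apply: cvg_trans H; apply: near_eq_cvg; near=> s.
rewrite (max_idPr _)//; near: s.
exact: nbhs_left_ge.
Unshelve. all: by end_near. Qed.

Section feller.
Context (R : realType) d (T : measurableType d) (Pr : probability T R).
Variables (a : R -> R) (L : R).
Hypotheses (L0 : 0 <= L) (aL : forall x y, `|a x - a y| <= L * `|x - y|).
Variable w : R -> T -> R.
Hypothesis Ww : wiener_process Pr w.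
Variable X : R -> R -> T -> R.
Hypothesis solX : forall x, strong_solution Pr a w x (X x).
Variable P1 : semigroup_on R 1.
Hypothesis P1E : forall t x A, 0 <= t -> measurable A ->
  P1 t [tuple x] A = Pr [set o | A [tuple X x t o]].
Hypothesis P1_0 : forall x A, measurable A -> P1 0 x A = \d_x A.

Let mX x t : 0 <= t -> measurable_fun setT (X x t).
Proof. exact: (solution_measurable (solX x)). Qed.

Let cX x o : {within `[0, +oo[, continuous (X x ^~ o)}.
Proof. by move=> ? ?; apply: (solution_continuous (solX x)). Qed.

Let startX x : {ae Pr, forall o, X x 0 o = x}.
Proof. by apply: filterS (solution_path_eq Ww (solX x)) => o []. Qed.

Lemma solution_past x s F : sigma_gen `[0, s] (X x) F -> augmented_filtration Pr w s F.
Proof.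
move: F; apply: smallest_sub; first exact: smallest_sigma_algebra.
move=> _ [r /= rs [B mB <-]]; rewrite setTI.
move: rs; rewrite in_itv/= => /andP[r0 rs].
by apply: (augmented_sub rs); apply: (solution_adapted (solX x)).
Qed.

Definition solution_single (x t : R) (o : T) : 1.-tuple R := [tuple X x t o].

(** In dimension 1 the semigroup of independent solutions is that of the
    equation, and the Markov property is [solution_markov]. *)
Lemma feller_single (Q : semigroup_on R 1) x : independent_semigroup P1 Q ->
  feller_process Pr Q [tuple x] (solution_single x).
Proof.
move=> [_ indQ].
have QE t y B : 0 <= t -> measurable B -> Q t y B = P1 t y B.
  move=> t0 mB; have mA : measurable [set r : R | B [tuple r]].
    by rewrite -[X in measurable X]setTI; exact: measurable_tuple1.
  have := indQ t y (fun=> [set r : R | B [tuple r]]) t0 (fun=> mA).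
  rewrite big_ord1.
  have -> : [set y0 : 1.-tuple R | forall i, [set r | B [tuple r]] (tnth y0 i)] = B.
    apply/seteqP; split => z /=; first by move=> /(_ ord0); rewrite [[tuple _]]tuple1_eta.
    by move=> Bz i; rewrite (ord1 i) [[tuple _]]tuple1_eta.
  have -> : [set y0 : 1.-tuple R | [set r | B [tuple r]] (thead y0)] = B.
    by apply/seteqP; split => z /=; rewrite tuple1_eta.
  by rewrite [[tuple _]]tuple1_eta.
split.
- by move=> t t0; exact: (measurableT_comp (@measurable_tuple1 R) (mX x t0)).
- move=> o i; rewrite (ord1 i); have [H1 H2] := continuous_cadlag (@cX x o).
  by split => t t0; [exact: H1|exact: H2].
- by apply: filterS (startX x) => o; rewrite /solution_single => ->.
- move=> s t F A s0 t0 sF mA.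
  have sF' : augmented_filtration Pr w s F.
    apply: (solution_past (x := x)).
    move: F sF; apply: smallest_sub; first exact: smallest_sigma_algebra.
    move=> _ [r rs [B mB <-]]; rewrite setTI.
    apply: (sigma_gen_preimage (B := [set y | B [tuple y]])) => //.
    by rewrite -[X in measurable X]setTI; exact: measurable_tuple1.
  rewrite [LHS](solution_markov L0 aL Ww solX P1E P1_0 x s0 t0 sF' mA).
  by apply: eq_integral => o _; rewrite QE.
Qed.

Definition pair_prob : probability (T * T)%type R := product_prob Pr Pr.

(** Two solutions driven by independent Wiener processes live on the square of
    the probability space. *)
Definition solution_pair (x y t : R) (o : T * T) : 2.-tuple R := [tuple X x t o.1; X y t o.2].

Lemma tnth_pair0 x y t o : tnth (solution_pair x y t o) ord0 = X x t o.1.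
Proof. by []. Qed.

Lemma tnth_pair1 x y t o : tnth (solution_pair x y t o) ord_max = X y t o.2.
Proof. by []. Qed.

Lemma ord2P (i : 'I_2) : i = ord0 \/ i = ord_max.
Proof. by case: i => -[|[|//]] i; [left|right]; exact/val_inj. Qed.

Lemma measurable_pair x y t : 0 <= t -> measurable_fun setT (solution_pair x y t).
Proof.
move=> t0; apply/measurable_fun_tnthP => i; case: (ord2P i) => ->.
  by apply: (measurableT_comp (mX x t0)); exact: measurable_fst.
by apply: (measurableT_comp (mX y t0)); exact: measurable_snd.
Qed.

Section pair_markov.
Variables (Q : semigroup_on R 2) (x y s t : R).
Hypotheses (indQ : independent_semigroup P1 Q) (s0 : 0 <= s) (t0 : 0 <= t).

Let st0 : 0 <= s + t. Proof. exact: addr_ge0. Qed.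

Let past_rect (F : set (T * T)) := exists F1 F2,
  [/\ F = F1 `*` F2, sigma_gen `[0, s] (X x) F1 & sigma_gen `[0, s] (X y) F2].

Let past_m z : sigma_gen `[0, s] (X z) `<=` measurable.
Proof.
apply: sigma_gen_measurable => r /=; rewrite in_itv/= => /andP[r0 _]; exact: mX.
Qed.

Let sigmaT z : sigma_gen `[0, s] (X z) setT.
Proof. exact: (@measurableT _ (g_sigma_algebraType _)). Qed.

Let past_rectT : past_rect setT.
Proof. by exists setT, setT; split => //; rewrite setXTT. Qed.

Let past_rect_m : past_rect `<=` measurable.
Proof. by move=> _ [F1 [F2 [-> /past_m m1 /past_m m2]]]; exact: measurableX. Qed.

Let past_sub : sigma_gen `[0, s] (solution_pair x y) `<=` <<s past_rect >>.
Proof.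
apply: smallest_sub; first exact: smallest_sigma_algebra.
move=> _ [r rs [B mB <-]].
suff : measurable_fun (setT : set (g_sigma_algebraType past_rect)) (solution_pair x y r).
  by move=> /(_ measurableT B mB).
apply/measurable_fun_tnthP => i _ A mA; rewrite setTI.
apply: sub_sigma_algebra; case: (ord2P i) => ->.
  exists (X x r @^-1` A), setT; split => //; last exact: sigma_gen_preimage.
  by apply/seteqP; split => o //= [].
exists setT, (X y r @^-1` A); split => //; last exact: sigma_gen_preimage.
by apply/seteqP; split => o //= [].
Qed.

Let mQ B : measurable B -> measurable_fun setT (fun o => Q t (solution_pair x y s o) B).
Proof.
move=> mB; apply: (measurableT_comp (f := fun z => Q t z B)).
  exact: measurable_kernel.
exact: measurable_pair.
Qed.

(* For a past rectangle F and a box B, both sides factor into the Markov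
   properties of the two solutions. *)
Let markov_rect F B : past_rect F -> measurable B ->
  pair_prob (F `&` solution_pair x y (s + t) @^-1` B) =
  (\int[pair_prob]_(o in F) Q t (solution_pair x y s o) B)%E.
Proof.
move=> rF mB; have mF := past_rect_m rF.
have mY := measurable_pair x y st0.
have [m1 m1E] := restricted_image_measure pair_prob mF mY.
have [m2 m2E] := @mixture_measure R _ _ _ _ pair_prob F (fun o => Q t (solution_pair x y s o))
  mF mQ.
rewrite -m1E// -m2E; apply: eq_measure_on_boxes mB.
  rewrite m1E// preimage_setT setIT.
  by apply: le_lt_trans (ltry 1); exact: probability_le1.
move=> A mA; have mbox := measurable_box mA.
rewrite m1E// m2E; case: rF => F1 [F2 [-> sF1 sF2]].
have mF1 := past_m sF1; have mF2 := past_m sF2.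
pose C i : set (1.-tuple R) := [set z | A i (thead z)].
have mC i : measurable (C i).
  by rewrite -[X in measurable X]setTI; apply: measurable_thead.
have -> : F1 `*` F2 `&` solution_pair x y (s + t) @^-1` box A =
    (F1 `&` [set o | C ord0 [tuple X x (s + t) o]]) `*`
    (F2 `&` [set o | C ord_max [tuple X y (s + t) o]]).
  apply/seteqP; split; case=> o1 o2 /=.
    by move=> [[Fo1 Fo2] Ao]; split; split; [|exact: (Ao ord0)| |exact: (Ao ord_max)].
  move=> [[Fo1 Ao1] [Fo2 Ao2]]; split => // i.
  by case: (ord2P i) => ->.
have mXt z : measurable_fun setT (fun o => [tuple X z (s + t) o]).
  exact: (measurableT_comp (@measurable_tuple1 R) (mX z st0)).
have mXC z i : measurable [set o | C i [tuple X z (s + t) o]].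
  by rewrite -[X in measurable X]setTI; exact: mXt.
rewrite [LHS]product_probE; [|exact: measurableI|exact: measurableI].
have mk := solution_markov L0 aL Ww solX P1E P1_0.
rewrite (mk x s t _ _ s0 t0 (solution_past sF1) (mC _)).
rewrite (mk y s t _ _ s0 t0 (solution_past sF2) (mC _)).
have mP z i : measurable_fun setT (fun o => P1 t [tuple X z s o] (C i)).
  apply: (measurableT_comp (f := fun z => P1 t z (C i))).
    exact: measurable_kernel.
  exact: (measurableT_comp (@measurable_tuple1 R) (mX z s0)).
rewrite -product_prob_integral_rect//.
apply: eq_integral => o _; rewrite (indQ.2 t _ A t0 mA).
by rewrite big_ord_recl big_ord1 (_ : lift ord0 ord0 = ord_max :> 'I_2)//; exact/val_inj.
Qed.

(** Both sides are measures in F, and the past of the pair is generated by the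
    pi-system of rectangles. *)
Lemma pair_markov F B : sigma_gen `[0, s] (solution_pair x y) F -> measurable B ->
  pair_prob (F `&` solution_pair x y (s + t) @^-1` B) =
  (\int[pair_prob]_(o in F) Q t (solution_pair x y s o) B)%E.
Proof.
move=> /past_sub sF mB.
have mPB : measurable (solution_pair x y (s + t) @^-1` B).
  by rewrite -[X in measurable X]setTI; exact: measurable_pair.
have [m2 m2E] := density_measure pair_prob (mQ mB) (fun o => measure_ge0 (Q t (solution_pair x
  y s o)) B).
rewrite -m2E.
apply: (@eq_measure_on_pi_system _ _ R past_rect (mrestr pair_prob mPB) m2 _ _ _ _ _ F sF) =>
  //.
- move=> _ _ [F1 [F2 [-> s1 s2]]] [G1 [G2 [-> t1 t2]]].
  exists (F1 `&` G1), (F2 `&` G2); split; [|exact: sigma_setI|exact: sigma_setI].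
  by rewrite setXI.
- rewrite /= /mrestr setTI; apply: le_lt_trans (ltry 1); exact: probability_le1.
- by move=> G rG; rewrite m2E -markov_rect.
Qed.

End pair_markov.

(** This is what makes the law of the two-point motion of the flow, up to the
    meeting time, computable: it can be compared with [solution_pair]. *)
Lemma feller_pair (Q : semigroup_on R 2) x y : independent_semigroup P1 Q ->
  feller_process pair_prob Q [tuple x; y] (solution_pair x y).
Proof.
move=> indQ; split.
- by move=> t; exact: measurable_pair.
- move=> o i; case: (ord2P i) => ->.
    have [H1 H2] := continuous_cadlag (@cX x o.1).
    by split => t t0; [exact: H1|exact: H2].
  have [H1 H2] := continuous_cadlag (@cX y o.2).
  by split => t t0; [exact: H1|exact: H2].
- have H1 := ae_product_fst Pr (startX x).
  have H2 := ae_product_snd Pr (startX y).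
  by apply: filterS2 H1 H2 => o; rewrite /solution_pair => -> ->.
- by move=> s t F A s0 t0 sF mA; exact: pair_markov.
Qed.

End feller.

(** * Meeting times *)
Section meeting.
Context (R : realType).
Variable f : R -> 2.-tuple R.
Hypothesis cf : forall i, {within `[0, +oo[, continuous (fun t : R => tnth (f t) i)}.

Definition gap (g : R -> 2.-tuple R) (t : R) : R := tnth (g t) ord0 - tnth (g t) ord_max.

Lemma gap_continuous : continuous (fun t : R => gap f (Num.max 0 t)).
Proof.
have c0 := continuous_extend0 (@cf ord0); have c1 := continuous_extend0 (@cf ord_max).
by move=> t; apply: cvgB; [exact: c0|exact: c1].
Qed.

(** Continuity makes the infimum defining the meeting time attained. *)
Lemma meeting_timeP :
  ((forall r, 0 <= r -> gap f r != 0) /\ meeting_time f = +oo%E) \/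
  exists t, [/\ 0 <= t, meeting_time f = t%:E, gap f t = 0 &
    forall r, 0 <= r < t -> gap f r != 0].
Proof.
pose S := [set t | 0 <= t /\ exists i j, i != j /\ tnth (f t) i = tnth (f t) j].
have SE t : S t <-> 0 <= t /\ gap f t = 0.
  split => -[t0].
    move=> [i [j [ij fij]]]; split => //; move: ij fij.
    by case: (ord2P i) => ->; case: (ord2P j) => -> //= _; rewrite /gap => ->; rewrite subrr.
  move=> /eqP; rewrite subr_eq0 => /eqP Dt; split => //.
  by exists ord0, ord_max.
have mE : meeting_time f = ereal_inf (EFin @` S) by [].
have [S0|/nonemptyPn S0] := pselect (S !=set0); last first.
  left; split; last by rewrite mE S0 image_set0 ereal_inf0.
  by move=> r r0; apply/eqP => Dr; have : S r; [apply/SE|rewrite S0].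
right.
have lbS : has_lbound S by exists 0 => t [].
have infS : has_inf S by [].
pose t := inf S; exists t.
have t0 : 0 <= t by apply: lb_le_inf => // r [].
have below r : 0 <= r < t -> gap f r != 0.
  move=> /andP[r0 rt]; apply/eqP => Dr.
  have : t <= r by apply: ge_inf => //; apply/SE.
  by rewrite leNgt rt.
split => //; first by rewrite mE ereal_inf_EFin.
apply/eqP; rewrite -normr_eq0 -[_ == 0]negbK; apply/negP => Dt.
have Dt_gt0 : 0 < `|gap f t| by rewrite lt_neqAle eq_sym Dt normr_ge0.
have := @gap_continuous t; rewrite /= => /cvgrPdist_lt/(_ _ Dt_gt0) [/= e e0 He].
have [r Sr rt] := inf_adherent e0 infS.
have tr : t <= r by exact: ge_inf.
have [r0 Dr] := (SE r).1 Sr.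
have : `|gap f (Num.max 0 t) - gap f (Num.max 0 r)| < `|gap f t|.
  by apply: He; rewrite /= ler0_norm ?subr_le0//; move: rt; rewrite -/t; lra.
by rewrite (max_idPr t0) (max_idPr r0) Dr subr0 ltxx.
Qed.

Definition stop_time (g : R -> 2.-tuple R) (t : R) : R :=
  fine (mine t%:E (meeting_time g)).

Lemma stop_timeP t : 0 <= t ->
  ((forall r, 0 <= r <= t -> gap f r != 0) /\ stop_time f t = t) \/
  [/\ 0 <= stop_time f t <= t, gap f (stop_time f t) = 0 &
    forall r, 0 <= r < stop_time f t -> gap f r != 0].
Proof.
move=> t0; rewrite /stop_time; have [[H ->]|[m [m0 -> Dm below]]] := meeting_timeP.
  left; rewrite (min_idPl _) ?leey//; split => // r /andP[r0 _]; exact: H.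
have [mt|tm] := leP m t.
  right; rewrite (min_idPr _) ?lee_fin//=; split => //.
  by rewrite m0.
left; rewrite (min_idPl _) ?lee_fin ?ltW//=; split => // r /andP[r0 rt].
by apply: below; rewrite r0 (le_lt_trans rt).
Qed.

Lemma stop_time_ge0 t : 0 <= t -> 0 <= stop_time f t.
Proof. by move=> t0; have [[_ ->]//|[/andP[]]] := stop_timeP t0. Qed.

(** Reduces the measurability of the stopping time to that of the event that no
    meeting occurs up to a deterministic time. *)
Lemma stop_time_gt t c : 0 <= c -> c < t ->
  c < stop_time f t <-> forall r, 0 <= r <= c -> gap f r != 0.
Proof.
move=> c0 ct; have t0 : 0 <= t by rewrite (le_trans c0)// ltW.
have [[H ->]|[/andP[s0 st] Ds below]] := stop_timeP t0; split.
- by move=> _ r /andP[r0 rc]; apply: H; rewrite r0 (le_trans rc)// ltW.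
- by [].
- by move=> cs r /andP[r0 rc]; apply: below; rewrite r0 (le_lt_trans rc).
- move=> H; rewrite ltNge; apply/negP => sc.
  by have := H _ (introT andP (conj s0 sc)); rewrite Ds eqxx.
Qed.

End meeting.

Section stopped_measurable.
Context (R : realType) d (T : measurableType d).
Variable Y : R -> T -> 2.-tuple R.
Hypothesis mY : forall t, 0 <= t -> measurable_fun setT (Y t).
Hypothesis cY : forall o i, {within `[0, +oo[, continuous (fun t : R => tnth (Y t o) i)}.

Let D t o : R := gap (Y ^~ o) t.

Let mD t : 0 <= t -> measurable_fun setT (D t).
Proof.
move=> t0; apply: measurable_funB.
  exact: (measurableT_comp (measurable_tnth ord0) (mY t0)).
exact: (measurableT_comp (measurable_tnth ord_max) (mY t0)).
Qed.

Let cD o : continuous (fun t : R => D (Num.max 0 t) o).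
Proof. exact: (gap_continuous (@cY o)). Qed.

(** By compactness and continuity, the gap does not vanish on [0, c] if and only
    if it is bounded away from 0 on countably many grids. *)
Lemma measurable_no_meeting c : 0 <= c ->
  measurable [set o | forall r, 0 <= r <= c -> D r o != 0].
Proof.
move=> c0.
(* The grid of step c / n.+1, truncated at c. *)
pose g n j : R := c * Num.min 1 (j%:R / n.+1%:R).
have g_ge0 n j : 0 <= g n j by rewrite mulr_ge0// le_min ler01 divr_ge0.
have g_le n j : g n j <= c by rewrite ler_piMr// ge_min lexx.
rewrite (_ : [set o | _] = \bigcup_k \bigcap_n \bigcap_j
    (fun o => `|D (g n j) o|) @^-1` `[k.+1%:R^-1, +oo[).
  apply: bigcupT_measurable => k; apply: bigcapT_measurable => n.
  apply: bigcapT_measurable => j; rewrite -[X in measurable X]setTI.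
  have mN : measurable_fun setT (fun o => `|D (g n j) o|).
    by apply: measurableT_comp => //; exact: mD.
  exact: mN.
apply/seteqP; split => o /=.
  move=> H.
  have cN : {within `[0, c], continuous (fun t : R => `|D (Num.max 0 t) o|)}.
    apply: continuous_subspaceT => t.
    by apply: cvg_norm; exact: cD.
  have [m m0c Hm] := EVT_min c0 cN.
  move: m0c; rewrite in_itv/= => /andP[m0 mc].
  have Dm0 : 0 < `|D m o| by rewrite normr_gt0; apply: H; rewrite m0.
  have [k _ Hk] := near_infty_natSinv_lt (PosNum Dm0).
  exists k => // n _ j _ /=; rewrite in_itv/= andbT.
  apply: le_trans (ltW (Hk k (leqnn k))) _ => /=.
  have := Hm (g n j); rewrite in_itv/= g_ge0 g_le => /(_ isT).
  by rewrite (max_idPr m0) (max_idPr (g_ge0 n j)).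
move=> [k _ Hk] r /andP[r0 rc]; apply/eqP => Dr.
have Hk' n j : k.+1%:R^-1 <= `|D (g n j) o|.
  by have := Hk n I j I; rewrite /= in_itv/= andbT.
have k0 : (0 : R) < k.+1%:R^-1 by rewrite invr_gt0.
move: c0; rewrite le_eqVlt => /predU1P[c0|c_gt0].
  have := Hk' 0%N 0%N; have -> : g 0%N 0%N = r.
    by rewrite /g mul0r (min_idPr ler01) mulr0; apply/eqP; rewrite eq_le r0 c0.
  by rewrite Dr normr0 leNgt k0.
have rc0 : 0 <= r / c by rewrite divr_ge0// ltW.
have cvr : g n (Num.trunc (r / c * n.+1%:R)) @[n --> \oo] --> r.
  have H : c * ((Num.trunc (r / c * n.+1%:R))%:R / n.+1%:R) @[n --> \oo] --> c * (r / c).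
    by apply: cvgM; [exact: cvg_cst|exact: grid_cvg].
  rewrite [c * (r / c)]mulrC divfK ?gt_eqF// in H.
  apply: cvg_trans H; apply: near_eq_cvg; apply: nearW => n.
  rewrite /g (min_idPr _)// ler_pdivrMr// mul1r.
  apply: le_trans (_ : r / c * n.+1%:R <= _); first by rewrite truncn_le mulr_ge0.
  by rewrite ler_piMl// ler_pdivrMr// mul1r.
have := continuous_cvg_seq (@cD o) cvr; rewrite (max_idPr r0) Dr.
move=> /cvgr0Pnorm_lt/(_ _ k0) [N _ HN].
have := HN N (leqnn N); rewrite /= (max_idPr (g_ge0 _ _)).
by rewrite ltNge Hk'.
Qed.

Lemma measurable_stop_time t : 0 <= t ->
  measurable_fun setT (fun o => stop_time (Y ^~ o) t).
Proof.
move=> t0; apply: (measurability _ (RGenOInfty.measurableE R)) => //.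
move=> _ [_ [c ->] <-]; rewrite setTI.
have [c0|c0] := ltP c 0.
  rewrite (_ : _ @^-1` _ = setT)//; apply/seteqP; split => // o _ /=.
  by rewrite in_itv/= andbT (lt_le_trans c0)//; apply: stop_time_ge0 => //; exact: cY.
have [tc|ct] := leP t c.
  rewrite (_ : _ @^-1` _ = set0)//; apply/seteqP; split => // o /=.
  rewrite in_itv/= andbT ltNge.
  suff -> : stop_time (Y ^~ o) t <= c by [].
  apply: le_trans tc; have [[_ ->//]|[/andP[]//]] := stop_timeP (@cY o) t0.
rewrite (_ : _ @^-1` _ = [set o | forall r, 0 <= r <= c -> D r o != 0]).
  exact: measurable_no_meeting.
apply/seteqP; split => o /=; rewrite in_itv/= andbT.
  by move=> /(stop_time_gt (@cY o) c0 ct).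
by move=> H; apply/(stop_time_gt (@cY o) c0 ct).
Qed.

Lemma measurable_stopped t : 0 <= t -> measurable_fun setT (stopped Y t).
Proof.
move=> t0; apply/measurable_fun_tnthP => i.
have mj : measurable_fun setT (fun p : R * T => tnth (Y (Num.max 0 p.1) p.2) i).
  apply: (measurable_fun_caratheodory (X := fun t o => tnth (Y t o) i)).
    by move=> s s0; exact: (measurableT_comp (measurable_tnth i) (mY s0)).
  by move=> o ?; apply: cY.
rewrite (_ : _ \o _ = (fun p : R * T => tnth (Y (Num.max 0 p.1) p.2) i) \o
    (fun o => (stop_time (Y ^~ o) t, o))).
  apply: measurableT_comp => //; apply: measurable_fun_pair => //.
  exact: measurable_stop_time.
apply/funext => o /=; rewrite (max_idPr _)//.
by apply: stop_time_ge0 => //; exact: cY.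
Qed.

End stopped_measurable.

(** * Moments of the Wiener process *)

(** Integration against a measure with a density, by the layer-cake formula
    f x = \int 1_(0 <= r < f x) dr and the Tonelli theorem. *)
Lemma integral_density (R : realType) d (T : measurableType d)
    (mu m : {sigma_finite_measure set T -> \bar R}) (h : T -> \bar R) (f : T -> R) :
  measurable_fun setT h -> (forall x, (0 <= h x)%E) ->
  (forall A, measurable A -> m A = (\int[mu]_(x in A) h x)%E) ->
  measurable_fun setT f -> (forall x, 0 <= f x) ->
  (\int[m]_x (f x)%:E = \int[mu]_x (h x * (f x)%:E))%E.
Proof.
move=> mh h0 mE mf f0.
pose M := measurableTypeR R.
pose leb : {sigma_finite_measure set M -> \bar R} := @lebesgue_measure R.
pose E := [set p : T * M | 0 <= p.2 < f p.1].
have mEset : measurable E.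
  have m2 : measurable_fun setT (fun p : T * M => f p.1 - p.2).
    apply: measurable_funB; last exact: measurable_snd.
    by apply: measurableT_comp => //; exact: measurable_fst.
  rewrite (_ : E = (snd @^-1` `[0, +oo[) `&` ((fun p : T * M => f p.1 - p.2) @^-1` `]0, +oo[)).
    apply: measurableI; rewrite -[X in measurable X]setTI.
      by apply: measurable_snd.
    exact: m2.
  apply/seteqP; split => -[x r] /=; rewrite !in_itv/= !andbT subr_gt0; first by move=> /andP[].
  by move=> [r0 fr]; apply/andP.
have secE x : leb (xsection E x) = (f x)%:E.
  rewrite (_ : xsection E x = `[0, f x[%classic).
    rewrite [LHS](@lebesgue_measure_itv R `[0, f x[) /= lte_fin.
    have := f0 x; rewrite le_eqVlt => /predU1P[<-|->]; last by rewrite oppr0 adde0.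
    by rewrite ltxx.
  by apply/seteqP; split => r; rewrite /xsection/= inE/= in_itv.
have := @indic_fubini_tonelli _ _ T M R m leb E mEset.
rewrite indic_fubini_tonelli_FE// indic_fubini_tonelli_GE//.
under eq_integral do rewrite /= secE.
move=> ->.
pose g (p : T * M) : \bar R := (h p.1 * (\1_E p)%:E)%E.
have mg : measurable_fun setT g.
  apply: emeasurable_funM; first exact: measurableT_comp measurable_fst.
  by apply/measurable_EFinP; exact: measurable_indic.
have g0 p : (0 <= g p)%E by rewrite mule_ge0// lee_fin.
have fub := @fubini_tonelli _ _ T M R mu leb g mg g0.
have <- : (\int[mu]_x \int[leb]_y g (x, y) = \int[mu]_x (h x * (f x)%:E))%E.
  apply: eq_integral => x _; rewrite /g/= ge0_integralZl//.
  - rewrite -secE -[in RHS](setIT (xsection E x)) -integral_indic//;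
    last exact: measurable_xsection.
    congr (_ * _)%E; apply: eq_integral => r _.
    by rewrite !indicE mem_xsection.
  - apply/measurable_EFinP.
    have mI : measurable_fun setT (\1_E : T * M -> R) by exact: measurable_indic.
    exact: (measurableT_comp mI (measurable_pair1 x)).
rewrite fub; apply: eq_integral => r _.
rewrite /g /= mE; last exact: measurable_ysection.
rewrite integral_mkcond epatch_indic; apply: eq_integral => x _ /=.
by rewrite !indicE mem_ysection.
Qed.

Section normal.
Context (R : realType).

(** The crude constant 2 comes from the comparison of |x| times the density of
    standard deviation s with 2 s times the density of standard deviation 2 s,
    whose integral is 1. *)
Lemma normal_first_moment (s : R) : 0 < s ->
  (\int[normal_prob 0 s]_x `|x|%:E <= (2 * s)%:E)%E.
Proof.
move=> s0.
have s_n0 : s != 0 by rewrite gt_eqF.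
have s2_n0 : 2 * s != 0 by rewrite mulf_neq0.
rewrite (@integral_density R _ _ lebesgue_measure (normal_prob 0 s) (fun x => (normal_pdf 0 s
  x)%:E) (fun x => `|x|)) //.
- rewrite -[leRHS]mule1 -(integral_normal_pdf 0 (2 * s)) -ge0_integralZl//.
  + apply: ge0_le_integral => //.
    * by move=> x _; rewrite mule_ge0// lee_fin// normal_pdf_ge0.
    * apply/measurable_EFinP; apply: measurable_funM; first exact: measurable_normal_pdf.
      exact: normr_measurable.
    * apply/measurable_EFinP; apply: measurable_funM => //.
      exact: measurable_normal_pdf.
    * move=> x _; rewrite -!EFinM lee_fin !normal_pdfE// /normal_peak /normal_fun !subr0.
      have -> : Num.sqrt ((2 * s) ^+ 2 * pi *+ 2) = 2 * Num.sqrt (s ^+ 2 * pi *+ 2) :> R.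
        rewrite (_ : (2 * s) ^+ 2 * pi *+ 2 = 2 ^+ 2 * (s ^+ 2 * pi *+ 2)); last by ring.
        by rewrite sqrtrM ?sqr_ge0// sqrtr_sqr ger0_norm.
      set p := Num.sqrt _.
      have p0 : 0 < p by rewrite sqrtr_gt0 pmulrn_lgt0// mulr_gt0 ?pi_gt0// exprn_gt0.
      pose u := `|x| / s.
      have x2 : x ^+ 2 = (u * s) ^+ 2 by rewrite divfK// real_normK// num_real.
      have -> : - x ^+ 2 / (s ^+ 2 *+ 2) = - (3 / 8 * u ^+ 2) + - (u ^+ 2 / 8).
        by rewrite x2; field.
      have -> : - x ^+ 2 / ((2 * s) ^+ 2 *+ 2) = - (u ^+ 2 / 8).
        by rewrite x2; field.
      rewrite expRD expRN; set e1 := expR (- (u ^+ 2 / 8)); set e2 := expR _.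
      have e2_ge : 1 + 3 / 8 * u ^+ 2 <= e2 by exact: expR_ge1Dx.
      have e1_gt0 : 0 < e1 by exact: expR_gt0.
      have e2_gt0 : 0 < e2 by exact: expR_gt0.
      have ue : u <= e2.
        apply: le_trans e2_ge; have := sqr_ge0 (u - 4 / 3); rewrite expr2 expr2; lra.
      have -> : `|x| = u * s by rewrite divfK.
      rewrite -subr_ge0.
      have -> : 2 * s * ((2 * p)^-1 * e1) - p^-1 * (e2^-1 * e1) * (u * s) =
          p^-1 * e1 * s * e2^-1 * (e2 - u).
        by field; rewrite !gt_eqF.
      by do !apply: mulr_ge0; rewrite ?invr_ge0 ?subr_ge0// ltW.
  + apply/measurable_EFinP; exact: measurable_normal_pdf.
  + by move=> x _; rewrite lee_fin normal_pdf_ge0.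
  + by rewrite lee_fin mulr_ge0// ltW.
- apply/measurable_EFinP; exact: measurable_normal_pdf.
- by move=> x; rewrite lee_fin normal_pdf_ge0.
- exact: normr_measurable.
Qed.

Lemma normal_prob_itv_gt0 (s c : R) : 0 < s -> (0 < normal_prob 0 s `[c, (c + 1)%R])%E.
Proof.
move=> s0; have s_n0 : s != 0 by rewrite gt_eqF.
set A := `[c, c + 1]%classic.
have mA : measurable (A : set (measurableTypeR R)) by exact: measurable_itv.
pose m := Num.max `|c| `|c + 1|.
have m0 : 0 <= m by rewrite le_max normr_ge0.
pose q := normal_pdf 0 s m.
have q0 : 0 < q.
  by rewrite /q normal_pdfE// mulr_gt0 ?normal_peak_gt0// expR_gt0.
have muA : lebesgue_measure A = 1%E :> \bar R.
  rewrite [LHS](@lebesgue_measure_itv R `[c, c + 1]) /= lte_fin ltrDl ltr01.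
  by rewrite -EFinB; congr (_%:E); ring.
apply: (@lt_le_trans _ _ (\int[lebesgue_measure]_(x in A) q%:E)%E).
  by rewrite integral_cst// [X in (_ * X)%E](_ : _ = 1%E) ?mule1 ?lte_fin//; exact: muA.
apply: ge0_le_integral => //.
- by move=> x _; rewrite lee_fin ltW.
- apply: measurable_funTS; apply/measurable_EFinP; exact: measurable_normal_pdf.
- move=> x; rewrite /A/= in_itv/= => /andP[cx xc].
  rewrite lee_fin /q !normal_pdfE// ler_wpM2l ?normal_peak_ge0//.
  rewrite ler_expR !subr0 ler_pM2r ?invr_gt0 ?pmulrn_lgt0 ?exprn_gt0// lerN2.
  rewrite -[x ^+ 2]real_normK ?num_real// lerXn2r ?nnegrE//.
  rewrite le_max !ler_norml.
  have := ler_norm c; have := ler_norm (c + 1); have := ler_norm (- c); rewrite normrN => *.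
  have [x0|x0] := leP 0 x; apply/orP; [right|left]; apply/andP; split; lra.
Qed.

End normal.

Section wiener_moments.
Context (R : realType) d (T : measurableType d) (Pr : probability T R).
Variable w : R -> T -> R.
Hypothesis Ww : wiener_process Pr w.

Let mw t : 0 <= t -> measurable_fun setT (w t).
Proof. exact: (wiener_measurable Ww). Qed.

Let cw o : {within `[0, +oo[, continuous (w ^~ o)}.
Proof. by move=> ? ?; apply: (wiener_continuous Ww). Qed.

Let w_law t A : 0 < t -> measurable A ->
  Pr (w t @^-1` A) = normal_prob 0 (Num.sqrt t) A.
Proof.
move=> t0 mA; have := wiener_gaussian Ww (lexx 0) t0 mA; rewrite subr0 => <-.
by congr (Pr _); apply/seteqP; split => o /=; rewrite (wiener0 Ww) subr0.
Qed.

Lemma wiener_first_moment t : 0 <= t <= 1 -> (\int[Pr]_o `|w t o|%:E <= 2%:E)%E.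
Proof.
move=> /andP[]; rewrite le_eqVlt => /predU1P[<- _|t0 t1].
  rewrite integral0_eq ?lee_fin//.
  by move=> o _; rewrite (wiener0 Ww) normr0.
have mwt : measurable_fun setT (w t : T -> measurableTypeR R) by exact: mw (ltW t0).
pose wB := isMeasurableFun.Build _ _ _ _ (w t : T -> measurableTypeR R) mwt.
pose W : {mfun T >-> measurableTypeR R} := HB.pack (w t) wB.
have -> : (\int[Pr]_o `|w t o|%:E = \int[distribution Pr W]_x `|x|%:E)%E.
  rewrite ge0_integral_distribution//.
  by apply/measurable_EFinP; exact: normr_measurable.
rewrite (eq_measure_integral (normal_prob 0 (Num.sqrt t))); last first.
  by move=> A mA _; exact: (w_law t0 mA).
apply: le_trans (normal_first_moment _) _; first by rewrite sqrtr_gt0.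
rewrite lee_fin ler_piMr// -[leRHS](@sqrtr1 R) ler_sqrt//.
Qed.

Lemma wiener_le_gt0 (K : R) : (0 < Pr [set o | (w 1 o <= K)%R])%E.
Proof.
have H : (0 < Pr (w 1 @^-1` `[(K - 1)%R, (K - 1 + 1)%R]))%E.
  rewrite w_law//; apply: normal_prob_itv_gt0; rewrite sqrtr1//.
have m1 (I : interval R) : measurable (w 1 @^-1` [set` I]).
  by rewrite -[X in measurable X]setTI; apply: mw.
apply: lt_le_trans H _; apply: le_measure; rewrite ?inE//.
  rewrite (_ : [set _ | _] = w 1 @^-1` `]-oo, K]); first exact: m1.
  by apply/seteqP; split => o /=; rewrite in_itv.
by move=> o /=; rewrite in_itv/= subrK => /andP[].
Qed.

Lemma wiener_ge_gt0 (K : R) : (0 < Pr [set o | (K <= w 1 o)%R])%E.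
Proof.
have H : (0 < Pr (w 1 @^-1` `[K, (K + 1)%R]))%E.
  rewrite w_law//; apply: normal_prob_itv_gt0; rewrite sqrtr1//.
have m1 (I : interval R) : measurable (w 1 @^-1` [set` I]).
  by rewrite -[X in measurable X]setTI; apply: mw.
apply: lt_le_trans H _; apply: le_measure; rewrite ?inE//.
  rewrite (_ : [set _ | _] = w 1 @^-1` `[K, +oo[); first exact: m1.
  by apply/seteqP; split => o /=; rewrite in_itv/= andbT.
by move=> o /=; rewrite in_itv/= => /andP[].
Qed.

Definition wiener_path (o : T) (t : R) : R := w (Num.max 0 t) o.

Lemma wiener_path_continuous o : continuous (wiener_path o).
Proof. exact: (@continuous_extend0 R (w ^~ o) (@cw o)). Qed.

(** A functional of the noise that is linear in |w|, so that its expectation only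
    involves first moments, and yet controls solutions over one unit of time. *)
Definition wiener_size (o : T) : R :=
  `|w 1 o| + integral_itv 0 1 (fun t => `|wiener_path o t|).

Let cn o : continuous (fun t => `|wiener_path o t|).
Proof. by move=> t; apply: cvg_norm; exact: wiener_path_continuous. Qed.

Let M := measurableTypeR R.
Let g (p : M * T) : \bar R := (`|w (Num.max 0 p.1) p.2| * \1_(`[0, 1]%classic : set M) p.1)%:E.

Let mg : measurable_fun setT g.
Proof.
apply/measurable_EFinP; apply: measurable_funM.
  apply: measurableT_comp => //.
  exact: (measurable_fun_caratheodory mw cw).
have mI : measurable_fun setT (\1_(`[0, 1]%classic : set M) : M -> R) by exact:
  measurable_indic.
exact: (measurableT_comp mI measurable_fst).
Qed.

Let g0 p : (0 <= g p)%E.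
Proof. by rewrite lee_fin mulr_ge0// indicE. Qed.

Let int_gE o : (\int[lebesgue_measure]_t g (t, o))%E =
  (integral_itv 0 1 (fun t => `|wiener_path o t|))%:E.
Proof.
rewrite /integral_itv /Rintegral fineK; last first.
  by apply: integrable_fin_num => //; exact: (integrable_itv 0 1 (@cn o)).
rewrite [RHS]integral_mkcond epatch_indic; apply: eq_integral => t _.
by rewrite /g/= EFinM.
Qed.

Lemma measurable_wiener_size : measurable_fun setT wiener_size.
Proof.
apply: measurable_funD; first by apply: measurableT_comp => //; exact: mw.
apply/measurable_EFinP.
have := @measurable_fun_fubini_tonelli_G _ _ M T R lebesgue_measure g mg g0.
by apply: eq_measurable_fun => o _; exact: int_gE.
Qed.

Lemma wiener_size_ge0 o : 0 <= wiener_size o.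
Proof.
rewrite addr_ge0//; apply: Rintegral_ge0 => t _; exact: normr_ge0.
Qed.

Lemma wiener_size_moment : (\int[Pr]_o (wiener_size o)%:E <= 4%:E)%E.
Proof.
have m1 : measurable_fun setT (fun o => `|w 1 o|).
  by apply: measurableT_comp => //; exact: mw.
rewrite (eq_integral (fun o => `|w 1 o|%:E + \int[lebesgue_measure]_t g (t, o))%E); last first.
  by move=> o _; rewrite int_gE.
have mG := @measurable_fun_fubini_tonelli_G _ _ M T R lebesgue_measure g mg g0.
pose I01 : set M := `[0, 1]%classic.
have mI : measurable I01 by exact: measurable_itv.
rewrite ge0_integralD//.
- rewrite (_ : 4 = 2 + 2 :> R); last by ring.
  rewrite EFinD; apply: leeD; first by apply: wiener_first_moment; rewrite ler01 lexx.
  rewrite -(@fubini_tonelli _ _ M T R lebesgue_measure Pr g mg g0).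
  rewrite (_ : 2%:E = \int[lebesgue_measure]_(t in I01) (cst 2%:E t))%E; last first.
    rewrite integral_cst//= [X in (_ * X)%E](@lebesgue_measure_itv R `[0%R, 1%R]) /=.
    by rewrite lte_fin ltr01 oppr0 adde0 mule1.
  rewrite [leRHS]integral_mkcond; apply: ge0_le_integral => //.
  + by move=> t _; apply: integral_ge0.
  + exact: (@measurable_fun_fubini_tonelli_F _ _ M T R Pr g mg g0).
  + by apply/(measurable_restrictT (cst 2%:E) mI).
  + move=> t _; rewrite patchE; case: ifPn => t01.
      rewrite inE /I01/= in_itv/= in t01; have /andP[t0 _] := t01.
      apply: le_trans (wiener_first_moment t01).
      rewrite le_eqVlt; apply/orP; left; apply/eqP; apply: eq_integral => o _.
      by rewrite /g/= indicE mem_set/= ?in_itv// mulr1 (max_idPr t0).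
    by rewrite integral0_eq// => o _; rewrite /g/= indicE (negbTE t01) mulr0.
- by apply/measurable_EFinP.
- by move=> o _; apply: integral_ge0.
Qed.

End wiener_moments.

(** * One unit of time of two independent solutions *)
Section lyapunov.
Context (R : realType).

(** Its jump from 0 to 1 as two points separate makes its expectation dominate
    the probability of not having met. *)
Definition lyap (c : R) (z : 2.-tuple R) : R :=
  if tnth z ord_max < tnth z ord0 then 1 + c * (tnth z ord0 - tnth z ord_max) else 0.

Lemma lyap_ge0 c z : 0 <= c -> 0 <= lyap c z.
Proof.
by move=> c0; rewrite /lyap; case: ifPn => // zz; rewrite addr_ge0// mulr_ge0// subr_ge0 ltW.
Qed.

Lemma measurable_lyap c : measurable_fun setT (lyap c).
Proof.
have m0 := measurable_tnth (T := R) (ord0 : 'I_2).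
have m1 := measurable_tnth (T := R) (ord_max : 'I_2).
apply: measurable_fun_ifT => //.
- exact: measurable_fun_ltr.
- apply: measurable_funD => //; apply: measurable_funM => //.
  exact: measurable_funB.
Qed.

End lyapunov.

Section one_step.
Context (R : realType) d (T : measurableType d) (Pr : probability T R).
Variables (a : R -> R) (L lambda : R).
Hypotheses (L0 : 0 <= L) (aL : forall x y, `|a x - a y| <= L * `|x - y|).
Hypothesis lambda_gt0 : 0 < lambda.
Hypothesis a_diss : forall x y, (a x - a y) * (x - y) <= - lambda * (x - y) ^+ 2.
Variable w : R -> T -> R.
Hypothesis Ww : wiener_process Pr w.
Variable X : R -> R -> T -> R.
Hypothesis solX : forall x, strong_solution Pr a w x (X x).

Let ca : continuous a := lipschitz_continuous L0 aL.
Let mX x t : 0 <= t -> measurable_fun setT (X x t).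
Proof. exact: (solution_measurable (solX x)). Qed.
Let cX x o : {within `[0, +oo[, continuous (X x ^~ o)}.
Proof. by move=> ? ?; apply: (solution_continuous (solX x)). Qed.
Let path x o := solution_path (X x) o.
Let cpath x o : continuous (path x o).
Proof. exact: (solution_path_continuous (solX x)). Qed.
Let cw o : continuous (wiener_path w o) := @wiener_path_continuous _ _ _ _ _ Ww o.
Let U := wiener_size w.

Let mw1 : measurable_fun setT (w 1) := wiener_measurable Ww (ler01 : 0 <= (1 : R)).

Let m_le (K : R) : measurable [set o | w 1 o <= K].
Proof.
rewrite (_ : [set _ | _] = w 1 @^-1` `]-oo, K]); first by rewrite -[X in measurable X]setTI;
  apply: mw1.
by apply/seteqP; split => o; rewrite /= in_itv.
Qed.

Let m_ge (K : R) : measurable [set o | K <= w 1 o].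
Proof.
rewrite (_ : [set _ | _] = w 1 @^-1` `[K, +oo[); first by rewrite -[X in measurable X]setTI;
  apply: mw1.
by apply/seteqP; split => o; rewrite /= in_itv/= andbT.
Qed.

Let dissP p q : q < p -> a p - a q <= - lambda * (p - q).
Proof.
move=> qp; have pq : 0 < p - q by rewrite subr_gt0.
by rewrite -(ler_pM2r pq) -mulrA -expr2; exact: a_diss.
Qed.

Lemma drift_decr p q : 0 <= p -> a (p + q) <= a q.
Proof.
rewrite le_eqVlt => /predU1P[<-|p0]; first by rewrite add0r.
have := @dissP (p + q) q; rewrite addrK ltrDr p0 => /(_ isT).
have : 0 <= lambda * p by rewrite mulr_ge0// ltW.
lra.
Qed.

(** The difference Z between the solution and the noise is differentiable; while
    Z >= 0 its drift a (Z + w) is at most a w, and while Z <= 0 at least a w. *)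
Lemma solution_bound : {ae Pr, forall o, `|X 0 1 o| <= `|a 0| + (1 + L) * U o}.
Proof.
have H1 := solution_path_eq Ww (solX 0).
have H2 := solution_path_increment L0 aL Ww (solX 0).
apply: filterS2 H1 H2 => o [X0 _] incr.
pose Z t := path 0 o t - wiener_path w o t.
have cZ : continuous Z by move=> t; apply: cvgB; [exact: cpath|exact: cw].
pose c := a \o path 0 o.
have cc : continuous c by move=> t; apply: continuous_comp; [exact: cpath|exact: ca].
pose m t := `|a (wiener_path w o t)|.
have cm : continuous m.
  move=> t; apply: cvg_norm; apply: (continuous_comp (@cw o t)); exact: ca.
have eqZ s t : 0 <= s -> s <= t -> t <= 1 -> Z t - Z s = integral_itv s t c.
  move=> s0 st _; have t0 := le_trans s0 st.
  have : path 0 o t - path 0 o s = integral_itv s t c + (w t o - w s o) by exact: incr.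
  rewrite /Z /wiener_path (max_idPr s0) (max_idPr t0); lra.
have Z0 : Z 0 = 0.
  by rewrite /Z /path solution_pathE// /wiener_path (max_idPr (lexx 0)) X0 (wiener0 Ww) subrr.
have m0 u : 0 <= m u by exact: normr_ge0.
have pE u : path 0 o u = Z u + wiener_path w o u by rewrite /Z subrK.
have up : Z 1 <= integral_itv 0 1 m.
  apply: (last_zero_bound cZ cc cm eqZ) => //; first by rewrite Z0.
  move=> u _ Zu; rewrite /c/= pE; apply: le_trans (drift_decr _ Zu) _.
  exact: ler_norm.
have dn : - Z 1 <= integral_itv 0 1 m.
  have cZ' : continuous (fun t => - Z t) by move=> t; apply: cvgN; exact: cZ.
  have cc' : continuous (fun t => -1 * c t).
    by move=> t; apply: cvgM; [exact: cvg_cst|exact: cc].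
  apply: (last_zero_bound cZ' cc' cm) => //.
  - by move=> s t s0 st t1; rewrite integral_itvZ// -eqZ//; ring.
  - by rewrite Z0 oppr0.
  - move=> u _ Zu; rewrite mulN1r /c/= pE.
    have := drift_decr (Z u + wiener_path w o u) Zu; rewrite addKr => H.
    by have := ler_norm (- a (wiener_path w o u)); rewrite normrN /m; lra.
have mint : integral_itv 0 1 m <= `|a 0| + L * integral_itv 0 1 (fun t => `|wiener_path w o t|).
  have cn : continuous (fun t => `|wiener_path w o t|) by move=> t; apply: cvg_norm; exact: cw.
  have cLn : continuous (fun t => L * `|wiener_path w o t|).
    by move=> t; apply: cvgM; [exact: cvg_cst|exact: cn].
  rewrite -integral_itvZ// -[X in X + _]mulr1 -[X in _ * X]subr0 -integral_itv_cst//.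
  have ck : continuous (fun _ : R => `|a 0|) by exact: cst_continuous.
  rewrite -integral_itvD//; apply: le_integral_itv => //.
    by move=> t; apply: cvgD; [exact: ck|exact: cLn].
  move=> t _; rewrite /m; have := aL (wiener_path w o t) 0; rewrite subr0 => H.
  by have := ler_normD (a (wiener_path w o t) - a 0) (a 0); rewrite subrK; lra.
have XE : X 0 1 o = Z 1 + w 1 o.
  by rewrite /Z /path solution_pathE// /wiener_path (max_idPr ler01) subrK.
rewrite XE; apply: le_trans (ler_normD _ _) _.
have ZN : `|Z 1| <= integral_itv 0 1 m by rewrite ler_norml; apply/andP; split; lra.
have w0 : 0 <= L * `|w 1 o| by rewrite mulr_ge0.
have I0 : 0 <= integral_itv 0 1 (fun t => `|wiener_path w o t|).
  by apply: Rintegral_ge0 => t _.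
rewrite /U /wiener_size; move: mint ZN w0 I0; set I := integral_itv _ _ _;
  set J := integral_itv _ _ _.
lra.
Qed.

Section pair.
Variables (x y : R).
Hypothesis yx : y < x.

Definition no_meeting := [set o : T * T | forall r, 0 <= r <= 1 -> gap ((solution_pair X x
  y)^~ o) r != 0].

Let rho := (1 + lambda)^-1.

(** Two independent solutions that have not met are still in the same order, so
    the drift of their distance is at most - lambda times the distance. *)
Lemma pair_bound : {ae pair_prob Pr, forall o, no_meeting o ->
  [/\ 0 < X x 1 o.1 - X y 1 o.2,
      0 < x - y + w 1 o.1 - w 1 o.2 &
      X x 1 o.1 - X y 1 o.2 <= rho * (x - y) + (U o.1 + U o.2)]}.
Proof.
have H1 := ae_product_fst Pr (solution_path_eq Ww (solX x)).
have H2 := ae_product_snd Pr (solution_path_eq Ww (solX y)).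
apply: filterS2 H1 H2 => o [X0 eqX] [Y0 eqY] nm.
pose D t := path x o.1 t - path y o.2 t.
have cD : continuous D by move=> t; apply: cvgB; exact: cpath.
pose bx := a \o path x o.1; pose by_ := a \o path y o.2.
have cbx : continuous bx by move=> t; apply: continuous_comp; [exact: cpath|exact: ca].
have cby : continuous by_ by move=> t; apply: continuous_comp; [exact: cpath|exact: ca].
pose b t := bx t - by_ t.
have cb : continuous b by move=> t; apply: cvgB; [exact: cbx|exact: cby].
pose B t := wiener_path w o.1 t - wiener_path w o.2 t.
have cB : continuous B by move=> t; apply: cvgB; exact: cw.
have DE t : 0 <= t -> D t = X x t o.1 - X y t o.2.
  by move=> t0; rewrite /D /path !solution_pathE.
have BE t : 0 <= t -> B t = w t o.1 - w t o.2.
  by move=> t0; rewrite /B /wiener_path !(max_idPr t0).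
have eqD t : 0 <= t <= 1 -> D t = (x - y) + integral_itv 0 t b + B t.
  move=> /andP[t0 _]; rewrite DE// BE// eqX// eqY// /b integral_itvB//; ring.
have D_gt0 t : 0 <= t <= 1 -> 0 < D t.
  move=> /andP[t0 t1]; rewrite ltNge; apply/negP => Dt.
  have D0 : D 0 = x - y by rewrite DE// X0 Y0.
  have D0_ge : 0 <= D 0 by rewrite D0 subr_ge0 ltW.
  have cDt : {within `[0, t], continuous D} by exact: continuous_subspaceT.
  have [|r] := IVT t0 cDt (v := 0).
    by rewrite ge_min Dt orbT le_max D0_ge.
  rewrite in_itv/= => /andP[r0 rt] Dr.
  have := nm r; rewrite r0 (le_trans rt t1) => /(_ isT) /eqP; apply.
  by rewrite /gap -DE.
have bD t : 0 <= t <= 1 -> b t <= - lambda * D t.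
  by move=> t01; apply: dissP; rewrite -subr_gt0; exact: D_gt0.
have [d1 d2] := distance_bound (ltW lambda_gt0) cD cb cB eqD D_gt0 bD.
have D1 := D_gt0 1; rewrite ler01 lexx in D1; have {}D1 := D1 isT.
have l1 : 0 < 1 + lambda by rewrite ltr_wpDl.
rewrite -DE// -/(path _) ; split => //.
  by apply: lt_le_trans D1 _; apply: le_trans d1 _; rewrite BE//; lra.
have c1 : continuous (fun t => `|wiener_path w o.1 t|) by move=> t; apply: cvg_norm; exact: cw.
have c2 : continuous (fun t => `|wiener_path w o.2 t|) by move=> t; apply: cvg_norm; exact: cw.
have IB : - integral_itv 0 1 B <= integral_itv 0 1 (fun t => `|wiener_path w o.1 t|) +
  integral_itv 0 1 (fun t => `|wiener_path w o.2 t|).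
  rewrite -integral_itvD// -mulN1r -integral_itvZ//; apply: le_integral_itv.
  - by move=> t; apply: cvgM; [exact: cvg_cst|exact: cB].
  - by move=> t; apply: cvgD; [exact: c1|exact: c2].
  - move=> t _; rewrite mulN1r /B opprB addrC lerD//; last exact: ler_norm.
    by rewrite -normrN ler_norm.
move: IB; rewrite /U /wiener_size; set I1 := integral_itv _ _ _;
  set I2 := integral_itv _ _ (fun t => `|wiener_path w o.1 t|);
  set I3 := integral_itv _ _ _ => IB.
have I2_ge0 : 0 <= I2 by apply: Rintegral_ge0 => t _.
have I3_ge0 : 0 <= I3 by apply: Rintegral_ge0 => t _.
have B1 : B 1 <= `|w 1 o.1| + `|w 1 o.2|.
  by rewrite BE//; have := ler_norm (w 1 o.1); have := ler_norm (- w 1 o.2); rewrite normrN;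
    lra.
rewrite -(ler_pM2l l1) [leRHS]mulrDr /rho mulVKf ?gt_eqF//.
apply: (le_trans d2); rewrite -/I1.
have h1 : lambda * - I1 <= lambda * (I2 + I3) by rewrite ler_wpM2l// ltW.
have h2 : (1 + lambda) * B 1 <= (1 + lambda) * (`|w 1 o.1| + `|w 1 o.2|).
  by rewrite ler_wpM2l// ltW.
lra.
Qed.

Let mpair t : 0 <= t -> measurable_fun setT (solution_pair X x y t).
Proof. exact: (measurable_pair solX). Qed.

Let cpair (o : T * T) i : {within `[0, +oo[, continuous (fun t : R => tnth (solution_pair X x
  y t o) i)}.
Proof.
case: (ord2P i) => ->; first exact: (@cX x o.1).
exact: (@cX y o.2).
Qed.

Lemma measurable_pair_stopped : measurable_fun setT (stopped (solution_pair X x y) 1).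
Proof. exact: (measurable_stopped mpair cpair). Qed.

Lemma measurable_no_meeting_pair : measurable no_meeting.
Proof. exact: (measurable_no_meeting mpair cpair ler01). Qed.

(** By [pair_bound], the solutions almost surely meet if the noise of the upper
    one goes down by at least K while that of the lower one does not go down. *)
Lemma no_meeting_prob K : x - y <= K ->
  (pair_prob Pr no_meeting <=
   1 - Pr [set o | (w 1 o <= - K)%R] * Pr [set o | (0 <= w 1 o)%R])%E.
Proof.
move=> xyK.
pose A := [set o | w 1 o <= - K]; pose B := [set o | 0 <= w 1 o].
have mA : measurable A by exact: m_le.
have mB : measurable B by exact: m_ge.
have mAB : measurable (A `*` B) by exact: measurableX.
have -> : (Pr [set o | (w 1 o <= - K)%R] * Pr [set o | (0 <= w 1 o)%R] = pair_prob Pr (A `*`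
  B))%E.
  by rewrite /pair_prob [RHS]product_probE.
rewrite -probability_setC//.
have [N [mN N0 subN]] := pair_bound.
have mC := measurableC mAB.
rewrite -[leRHS]adde0 -N0.
apply: le_trans (measureU2 _ mC mN).
apply: le_measure; rewrite ?inE//; first exact: measurable_no_meeting_pair.
  exact: measurableU.
move=> o nm; have [No|No] := pselect (N o); [by right|left].
have : ~ ~ (no_meeting o -> [/\ 0 < X x 1 o.1 - X y 1 o.2,
      0 < x - y + w 1 o.1 - w 1 o.2 &
      X x 1 o.1 - X y 1 o.2 <= rho * (x - y) + (U o.1 + U o.2)]).
  by move=> H; apply: No; apply: subN.
move=> /contrapT/(_ nm)[_ H _] [/= Ao Bo].
by move: H; rewrite /A /B/= in Ao Bo *; lra.
Qed.

Lemma stopped_pairP (o : T * T) :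
  (no_meeting o /\ stopped (solution_pair X x y) 1 o = solution_pair X x y 1 o) \/
  tnth (stopped (solution_pair X x y) 1 o) ord0 = tnth (stopped (solution_pair X x y) 1 o)
    ord_max.
Proof.
have [[nm st]|[_ gap0 _]] := stop_timeP (@cpair o) ler01; [left|right].
  by split => //; rewrite /stopped -/(stop_time _ _) st.
by apply/eqP; rewrite -subr_eq0; apply/eqP; exact: gap0.
Qed.

(** Once the pair has met, lyap vanishes; otherwise its constant part contributes
    the probability of not meeting, and its linear part is bounded by
    [pair_bound], the constant 8 being twice the bound of
    [wiener_size_moment]. *)
Lemma lyap_stopped_pair c : 0 <= c ->
  (\int[pair_prob Pr]_o (lyap c (stopped (solution_pair X x y) 1 o))%:E <=
   pair_prob Pr no_meeting + (c * (rho * (x - y) + 8))%:E)%E.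
Proof.
move=> c0.
have l1 : 0 < 1 + lambda by rewrite ltr_wpDl.
have rho0 : 0 <= rho by rewrite invr_ge0 ltW.
have mU := measurable_wiener_size Ww; have U0 := wiener_size_ge0 w.
have cr0 : 0 <= c * (rho * (x - y)) by rewrite !mulr_ge0// subr_ge0 ltW.
have mU1 : measurable_fun setT (fun o : T * T => (U o.1)%:E).
  by apply/measurable_EFinP; exact: (measurableT_comp mU measurable_fst).
have mU2 : measurable_fun setT (fun o : T * T => (U o.2)%:E).
  by apply/measurable_EFinP; exact: (measurableT_comp mU measurable_snd).
have mnm := measurable_no_meeting_pair.
pose f2 (o : T * T) : \bar R := ((\1_no_meeting o)%:E + ((c * (rho * (x - y)))%:E + (c%:E * (U
  o.1)%:E + c%:E * (U o.2)%:E)))%E.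
have mcU1 : measurable_fun setT (fun o : T * T => c%:E * (U o.1)%:E)%E by exact:
  measurable_funeM.
have mcU2 : measurable_fun setT (fun o : T * T => c%:E * (U o.2)%:E)%E by exact:
  measurable_funeM.
have mI : measurable_fun setT (fun o => (\1_no_meeting o : R)%:E).
  by apply/measurable_EFinP; exact: measurable_indic.
have cU0 o : (0 <= c%:E * (U o)%:E)%E by rewrite mule_ge0// lee_fin.
apply: (@le_trans _ _ (\int[pair_prob Pr]_o f2 o)%E).
  apply: ae_ge0_le_integral => //.
  - by move=> o _; rewrite lee_fin lyap_ge0.
  - apply/measurable_EFinP; exact: (measurableT_comp (measurable_lyap c)
    measurable_pair_stopped).
  - by move=> o _; rewrite /f2 !adde_ge0// lee_fin ?indicE//.
  - apply: emeasurable_funD => //; apply: emeasurable_funD => //.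
    exact: emeasurable_funD.
  apply: filterS pair_bound => o bnd _.
  rewrite /f2 -!EFinM -!EFinD lee_fin.
  have cU1 : 0 <= c * U o.1 by rewrite mulr_ge0.
  have cU2 : 0 <= c * U o.2 by rewrite mulr_ge0.
  have [[nm ->]|eq01] := stopped_pairP o.
    have [D0 _ D1] := bnd nm.
    rewrite /lyap tnth_pair0 tnth_pair1 -subr_gt0 D0 indicE mem_set//= lerD2l.
    by apply: le_trans (ler_wpM2l c0 D1) _; rewrite !mulrDr.
  by rewrite /lyap eq01 ltxx addr_ge0 ?indicE// addr_ge0// addr_ge0.
rewrite /f2 ge0_integralD//; last 2 first.
- by move=> o _; rewrite !adde_ge0// lee_fin.
- by apply: emeasurable_funD => //; exact: emeasurable_funD.
rewrite integral_indic// setIT leeD2l// ge0_integralD//; last 2 first.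
- by move=> o _; rewrite adde_ge0.
- exact: emeasurable_funD.
rewrite integral_cst//= [X in (_ * X)%E](_ : _ = 1%E) ?mule1; last exact: probability_setT.
rewrite [leRHS](_ : _ = (c * (rho * (x - y)))%:E + (c * 8)%:E)%E;
  last by rewrite -EFinD -mulrDr.
rewrite leeD2l// ge0_integralD//.
rewrite ge0_integralZl//; [|by move=> o _; rewrite lee_fin].
rewrite ge0_integralZl//; [|by move=> o _; rewrite lee_fin].
have mUE : measurable_fun setT (fun o => (U o)%:E) by exact/measurable_EFinP.
have UE0 o : (0 <= (U o)%:E)%E by rewrite lee_fin.
rewrite (product_prob_integral_fst Pr Pr mUE UE0) (product_prob_integral_snd Pr Pr mUE UE0).
rewrite (_ : (c * 8)%:E = c%:E * 4%:E + c%:E * 4%:E)%E; last first.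
  by rewrite -!EFinM -EFinD; congr (_%:E); ring.
by apply: leeD; apply: lee_wpmul2l; rewrite ?lee_fin//; exact: wiener_size_moment.
Qed.

End pair.

(** The Lyapunov function decreases by a fixed factor in one unit of time: for
    close starting points by the positive probability of meeting, for distant
    ones by the dissipativity of the drift. *)
Lemma lyap_contraction : exists c r : R, [/\ 0 < c, 0 < r < 1 &
  forall x y, y < x ->
    (\int[pair_prob Pr]_o (lyap c (stopped (solution_pair X x y) 1 o))%:E <=
     (r * lyap c [tuple x; y])%:E)%E].
Proof.
pose rho := (1 + lambda)^-1.
have l1 : 0 < 1 + lambda by rewrite ltr_wpDl.
have rho0 : 0 < rho by rewrite invr_gt0.
have rho1 : rho < 1 by rewrite invf_lt1// ltrDl.
(* Beyond the distance K, contracting c (x - y) by rho instead of (1 + rho) / 2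
   gains c (x - y) (1 - rho) / 2 >= 10 c, more than the noise term 8 c and the
   loss c on the constant part. Within K, the gain q on the constant part
   outweighs the noise term 8 c = q / 2. *)
pose K := 20 / (1 - rho).
have K0 : 0 < K by rewrite divr_gt0// subr_gt0.
have KE : K * (1 - rho) = 20 by rewrite divfK// subr_eq0 gt_eqF.
set A := Pr [set o | (w 1 o <= - K)%R]; set B := Pr [set o | (0 <= w 1 o)%R].
have AB0 : (0 < A * B)%E by rewrite mule_gt0// ?(wiener_le_gt0 Ww) ?(wiener_ge_gt0 Ww).
have mA := m_le (- K); have mB := m_ge 0.
have A1 : (A <= 1)%E by exact: probability_le1.
have B1 : (B <= 1)%E by exact: probability_le1.
have [q ABq q01] : exists2 q : R, (A * B = q%:E)%E & 0 < q <= 1.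
  exists (fine (A * B)%E); first by rewrite fineK// fin_numM// fin_num_measure.
  have fAB : (A * B)%E \is a fin_num by rewrite fin_numM// fin_num_measure.
  rewrite -!lte_fin -lee_fin fineK// AB0/=.
  by rewrite -[leRHS]mule1; apply: lee_pmul => //; exact: measure_ge0.
have /andP[q0 q1] := q01.
pose c := q / 16.
pose r := Num.max ((1 + rho) / 2) (Num.max (1 - q / 2) (1 - c)).
have c0 : 0 < c by rewrite divr_gt0.
have r_rho : (1 + rho) / 2 <= r by rewrite le_max lexx.
have r_q : 1 - q / 2 <= r by rewrite !le_max lexx /= !orbT.
have r_c : 1 - c <= r by rewrite !le_max lexx !orbT.
exists c, r; split => //.
  rewrite (lt_le_trans _ r_rho)/=; last by lra.
  rewrite !gt_max; apply/andP; split; first lra.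
  by apply/andP; split; lra.
move=> x y yx.
apply: (le_trans (lyap_stopped_pair yx (ltW c0))); rewrite -/rho.
have lE : lyap c [tuple x; y] = 1 + c * (x - y).
  by rewrite /lyap /= !(tnth_nth 0)/= yx.
rewrite lE.
have d0 : 0 < x - y by rewrite subr_gt0.
have cE : 16 * c = q by rewrite /c; field.
have [xyK|Kxy] := leP (x - y) K.
  have := no_meeting_prob yx xyK; rewrite -/A -/B ABq -EFinB => nm.
  apply: le_trans (leeD nm (lexx _)) _.
  rewrite -EFinD lee_fin.
  have h : c * (rho * (x - y)) <= r * (c * (x - y)).
    rewrite mulrCA; apply: ler_wpM2r; first by rewrite mulr_ge0// ltW.
    by lra.
  lra.
have nm : (pair_prob Pr (no_meeting x y) <= 1)%E.
  by apply: probability_le1; exact: measurable_no_meeting_pair.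
apply: le_trans (leeD nm (lexx _)) _.
rewrite -EFinD lee_fin.
have h1 : c * 20 <= c * ((x - y) * (1 - rho)).
  apply: ler_wpM2l; first exact: ltW.
  by rewrite -KE; apply: ler_wpM2r; [rewrite subr_ge0 ltW|exact: ltW].
have h2 : (1 + rho) / 2 * (c * (x - y)) <= r * (c * (x - y)).
  by apply: ler_wpM2r => //; rewrite mulr_ge0// ltW.
lra.
Qed.

End one_step.

(** * Coalescence in the flow *)

Lemma lipschitz_bound (R : realType) (a : R -> R) :
  (exists k : R, k.-lipschitz a) ->
  exists2 L : R, 0 <= L & forall x y, `|a x - a y| <= L * `|x - y|.
Proof.
move=> [k ka]; exists `|k| => // x y.
have := ka (x, y) => /(_ (conj I I)) /= H.
by apply: le_trans H _; rewrite ler_wpM2r// ler_norm.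
Qed.

Lemma same_law_at (R : realType) I d1 (T1 : measurableType d1) (Q1 : probability T1 R)
    d2 (T2 : measurableType d2) (Q2 : probability T2 R) d (E : measurableType d)
    (D : set I) (Y1 : I -> T1 -> E) (Y2 : I -> T2 -> E) (i : I) (f : E -> \bar R) :
  same_law D Q1 Y1 Q2 Y2 -> D i ->
  measurable_fun setT (Y1 i) -> measurable_fun setT (Y2 i) ->
  measurable_fun setT f -> (forall x, (0 <= f x)%E) ->
  (\int[Q1]_w f (Y1 i w) = \int[Q2]_w f (Y2 i w))%E.
Proof.
move=> law12 Di m1 m2 mf f0.
pose B1 := isMeasurableFun.Build _ _ _ _ (Y1 i) m1.
pose Z1 : {mfun T1 >-> E} := HB.pack (Y1 i) B1.
pose B2 := isMeasurableFun.Build _ _ _ _ (Y2 i) m2.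
pose Z2 : {mfun T2 >-> E} := HB.pack (Y2 i) B2.
have -> : (\int[Q1]_w f (Y1 i w) = \int[distribution Q1 Z1]_x f x)%E.
  by rewrite ge0_integral_distribution.
have -> : (\int[Q2]_w f (Y2 i w) = \int[distribution Q2 Z2]_x f x)%E.
  by rewrite ge0_integral_distribution.
apply: eq_measure_integral => A mA _.
apply: (law12 [set g | A (g i)]).
by apply: sub_sigma_algebra; exists i => //; exists A => //; rewrite setTI.
Qed.

Section rds.
Context (R : realType) (a : R -> R) (d : measure_display) (T : measurableType d).
Variables (Pr : probability T R) (theta : R -> T -> T) (phi : R -> T -> R -> R).
Hypothesis H : arratia_rds Pr a theta phi.

Lemma rds0 w x : phi 0 w x = x.
Proof.
have [sf _] := rds_arratia H.
by have := flow_id sf 0 x w; rewrite subrr (group0 (rds_group H)).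
Qed.

Lemma rdsD s t w x : 0 <= s -> 0 <= t ->
  phi (t + s) w x = phi t (theta s w) (phi s w x).
Proof. exact: (rds_cocycle H). Qed.

Let cphi w x : {within `[0, +oo[, continuous (fun t => phi t w x)}.
Proof. by move=> ? ?; apply: (rds_continuous H). Qed.

Lemma rds_coalesced s t w x y : 0 <= s -> s <= t ->
  phi s w x = phi s w y -> phi t w x = phi t w y.
Proof.
move=> s0 st e; have ts : 0 <= t - s by rewrite subr_ge0.
by have := rdsD w x s0 ts; have := rdsD w y s0 ts; rewrite subrK e => -> ->.
Qed.

(** Two continuous trajectories cannot cross without meeting, and they stay
    together once they have met. *)
Lemma rds_mono t w x y : 0 <= t -> x <= y -> phi t w x <= phi t w y.
Proof.
move=> t0 xy; rewrite leNgt; apply/negP => yx.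
pose D s := phi (Num.max 0 s) w y - phi (Num.max 0 s) w x.
have cD : continuous D.
  have c1 := continuous_extend0 (@cphi w y); have c2 := continuous_extend0 (@cphi w x).
  by move=> s; apply: cvgB; [exact: c1|exact: c2].
have cDt : {within `[0, t], continuous D} by exact: continuous_subspaceT.
have D0 : 0 <= D 0 by rewrite /D (max_idPr (lexx 0)) !rds0 subr_ge0.
have Dt : D t <= 0 by rewrite /D (max_idPr t0) subr_le0 ltW.
have [|s] := IVT t0 cDt (v := 0).
  by rewrite ge_min Dt orbT le_max D0.
rewrite in_itv/= => /andP[s0 st]; rewrite /D (max_idPr s0) => /eqP.
rewrite subr_eq0 => /eqP e.
by move: yx; rewrite (rds_coalesced s0 st e) ltxx.
Qed.

Lemma measurable_rds : measurable_fun setT (fun p : R * T * R => phi (Num.max 0 p.1.1) p.1.2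
  p.2).
Proof.
have mD : measurable [set p : R * T * R | 0 <= p.1.1].
  rewrite (_ : [set _ | _] = (fun p : R * T * R => p.1.1) @^-1` `[0, +oo[).
    rewrite -[X in measurable X]setTI.
    have m11 : measurable_fun setT (fun p : R * T * R => p.1.1).
      exact: (measurableT_comp measurable_fst measurable_fst).
    exact: m11.
  by apply/seteqP; split => p; rewrite /= in_itv/= andbT.
apply: (@measurable_comp _ _ _ _ _ _ [set p : R * T * R | 0 <= p.1.1] (fun p => phi p.1.1
  p.1.2 p.2)
  setT (fun p : R * T * R => (Num.max 0 p.1.1, p.1.2, p.2)) mD _ (rds_measurable H)).
  by move=> _ [p _ <-] /=; rewrite le_max lexx.
apply: measurable_fun_pair; last exact: measurable_snd.
apply: measurable_fun_pair.
  apply: measurable_maxr => //.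
  exact: (measurableT_comp measurable_fst measurable_fst).
exact: (measurableT_comp measurable_snd measurable_fst).
Qed.

Lemma measurable_rds_comp d' (S : measurableType d') (f : S -> R) (g : S -> T) (h : S -> R) :
  (forall s, 0 <= f s) ->
  measurable_fun setT f -> measurable_fun setT g -> measurable_fun setT h ->
  measurable_fun setT (fun s => phi (f s) (g s) (h s)).
Proof.
move=> f0 mf mg mh.
rewrite (_ : (fun s => _) = (fun p : R * T * R => phi (Num.max 0 p.1.1) p.1.2 p.2) \o (fun s
  => (f s, g s, h s))).
  apply: measurableT_comp measurable_rds _.
  by apply: measurable_fun_pair => //; exact: measurable_fun_pair.
by apply/funext => s /=; rewrite (max_idPr (f0 s)).
Qed.

Lemma measurable_rds_fixed t x : 0 <= t -> measurable_fun setT (fun w => phi t w x).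
Proof.
by move=> t0; apply: (measurable_rds_comp (f := fun=> t) (g := id) (h := fun=> x)).
Qed.

Definition flow_pair (x y t : R) (w : T) : 2.-tuple R := [tuple phi t w x; phi t w y].

Lemma measurable_flow_pair x y t : 0 <= t -> measurable_fun setT (flow_pair x y t).
Proof.
move=> t0; apply/measurable_fun_tnthP => i.
by case: (ord2P i) => ->; exact: measurable_rds_fixed.
Qed.

Lemma flow_pair_continuous x y w i :
  {within `[0, +oo[, continuous (fun t => tnth (flow_pair x y t w) i)}.
Proof. by case: (ord2P i) => ->; [exact: (@cphi w x)|exact: (@cphi w y)]. Qed.

(** After the meeting time the flow has coalesced, so running until time 1 rather
    than stopping can only decrease lyap. *)
Lemma lyap_stopped_flow c x y w : 0 <= c ->
  lyap c (flow_pair x y 1 w) <= lyap c (stopped (flow_pair x y) 1 w).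
Proof.
move=> c0; rewrite /stopped -/(stop_time _ _).
have [[_ ->//]|[/andP[s0 s1] + _]] := stop_timeP (@flow_pair_continuous x y w) ler01.
move=> /eqP; rewrite subr_eq0 => /eqP e.
rewrite [leLHS](_ : _ = 0) ?lyap_ge0// /lyap.
have -> : tnth (flow_pair x y 1 w) ord0 = tnth (flow_pair x y 1 w) ord_max.
  exact: rds_coalesced s0 s1 e.
by rewrite ltxx.
Qed.

Section semigroups.
Variable Pc : forall n, semigroup_on R n.
Hypothesis coal : coalescing_semigroups a Pc.
Hypothesis fellerPc : forall s n (x : n.-tuple R), (0 < n)%N ->
  feller_process Pr (Pc n) x
    (fun t w => [tuple phi (s + t - s) (theta s w) (tnth x i) | i < n]).

Lemma feller_flow_pair x y : feller_process Pr (Pc 2) [tuple x; y] (flow_pair x y).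
Proof.
have := @fellerPc 0 2 [tuple x; y] isT.
rewrite (_ : (fun t w => _) = flow_pair x y)//.
apply/funext => t; apply/funext => w; apply/eq_from_tnth => i.
rewrite tnth_mktuple add0r subr0 (group0 (rds_group H)).
by case: (ord2P i) => ->.
Qed.

Lemma feller_flow_single x : feller_process Pr (Pc 1) [tuple x] (fun t w => [tuple phi t w x]).
Proof.
have := @fellerPc 0 1 [tuple x] isT.
rewrite (_ : (fun t w => _) = (fun t w => [tuple phi t w x]))//.
apply/funext => t; apply/funext => w; apply/eq_from_tnth => i.
rewrite tnth_mktuple add0r subr0 (group0 (rds_group H)).
by rewrite (ord1 i).
Qed.

(** The Markov property at time 0, where the process has a deterministic value,
    turns the semigroup into the law of the two-point motion. *)
Lemma semigroup_flow_pair x y t A : 0 <= t -> measurable A ->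
  Pc 2 t [tuple x; y] A = Pr (flow_pair x y t @^-1` A).
Proof.
move=> t0 mA.
have sT : sigma_gen `[0, 0] (flow_pair x y) setT by exact: (@measurableT _
  (g_sigma_algebraType _)).
have := feller_markov (feller_flow_pair x y) (lexx 0) t0 sT mA.
rewrite setTI add0r => ->.
rewrite (eq_integral (fun=> Pc 2 t [tuple x; y] A)).
  rewrite integral_cst// [X in (_ * X)%E](_ : _ = 1%E) ?mule1//; exact: probability_setT.
by move=> w _; rewrite /flow_pair !rds0.
Qed.

Variables (L lambda : R).
Hypotheses (L0 : 0 <= L) (aL : forall x y, `|a x - a y| <= L * `|x - y|).
Hypothesis lambda_gt0 : 0 < lambda.
Hypothesis a_diss : forall x y, (a x - a y) * (x - y) <= - lambda * (x - y) ^+ 2.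

(** For y < x, lyap is bounded by its value on the stopped motion, which has the
    same law as the stopped pair of independent solutions. For x <= y, the flow
    preserves the order and lyap stays 0. *)
Lemma lyap_one_step : exists c r : R, [/\ 0 < c, 0 < r < 1 &
  forall z, (\int[Pc 2 1%R z]_y (lyap c y)%:E <= (r * lyap c z)%:E)%E].
Proof.
have [P1 [[fP1 [d' [T' [Pr' [w [X [Ww solX P1E]]]]]]] [Pind HP]]] := coalescing_until_meeting
  coal.
have P1_0 : forall x A, measurable A -> P1 0 x A = \d_x A by exact: (semigroup0 fP1).
have [c [r [c0 r01 contr]]] := lyap_contraction L0 aL lambda_gt0 a_diss Ww solX.
exists c, r; split => // z.
have -> : z = [tuple tnth z ord0; tnth z ord_max].
  by apply/eq_from_tnth => i; case: (ord2P i) => ->; rewrite !(tnth_nth 0).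
move: (tnth z ord0) (tnth z ord_max) => x y.
have c0' := ltW c0.
have mF1 := measurable_flow_pair x y ler01.
have mlyap : measurable_fun setT (fun z => (lyap c z)%:E) by apply/measurable_EFinP;
  exact: measurable_lyap.
have lyap0 z' : (0 <= (lyap c z')%:E)%E by rewrite lee_fin lyap_ge0.
have -> : (\int[Pc 2 1%R [tuple x; y]]_y (lyap c y)%:E = \int[Pr]_w (lyap c (flow_pair x y 1%R
  w))%:E)%E.
  pose B1 := isMeasurableFun.Build _ _ _ _ _ mF1.
  pose Z1 : {mfun T >-> 2.-tuple R} := HB.pack (flow_pair x y 1) B1.
  transitivity (\int[distribution Pr Z1]_y (lyap c y)%:E)%E.
    by apply: eq_measure_integral => A mA _; exact: semigroup_flow_pair.
  by rewrite ge0_integral_distribution.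
have [xy|yx] := leP x y.
  rewrite integral0_eq; first by rewrite lee_fin mulr_ge0 ?lyap_ge0// ltW//; case/andP: r01.
  by move=> w' _; rewrite /lyap ltNge /= !(tnth_nth 0)/= rds_mono.
have [indP stopP] := HP 2%N isT.
have mY := measurable_pair solX x y.
have mYs t : 0 <= t -> measurable_fun setT (stopped (solution_pair X x y) t).
  move=> t0; apply: (measurable_stopped mY) => // o i.
  case: (ord2P i) => -> ? ?; first exact: (solution_continuous (solX x)).
  exact: (solution_continuous (solX y)).
have mFs t : 0 <= t -> measurable_fun setT (stopped (flow_pair x y) t).
  move=> t0; apply: (measurable_stopped (@measurable_flow_pair x y)) => // o i.
  exact: flow_pair_continuous.
have law := stopP [tuple x; y] _ _ _ _ _ _ _ _ (feller_flow_pair x y)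
  (feller_pair L0 aL Ww solX P1E P1_0 x y indP) mFs mYs.
apply: le_trans (contr x y yx).
have one : `[0%R, +oo[%classic (1 : R) by rewrite /= in_itv/= andbT ler01.
rewrite -(same_law_at law one (mFs _ ler01) (mYs _ ler01) mlyap lyap0).
apply: ge0_le_integral => //.
- by apply: measurableT_comp mlyap _.
- by apply: measurableT_comp mlyap _; exact: mFs.
- by move=> w' _; rewrite lee_fin; exact: lyap_stopped_flow.
Qed.

Lemma lyap_iterate c r : 0 < c -> 0 < r ->
  (forall z, (\int[Pc 2 1%R z]_y (lyap c y)%:E <= (r * lyap c z)%:E)%E) ->
  forall n z, (\int[Pc 2 n%:R%R z]_y (lyap c y)%:E <= (r ^+ n * lyap c z)%:E)%E.
Proof.
move=> c0 r0 step; have c0' := ltW c0.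
have fP2 := coalescing_feller coal (isT : (0 < 2)%N).
have mlyap : measurable_fun setT (fun z : 2.-tuple R => (lyap c z)%:E).
  by apply/measurable_EFinP; exact: measurable_lyap.
have lyap0 (z : 2.-tuple R) : (0 <= (lyap c z)%:E)%E by rewrite lee_fin lyap_ge0.
elim=> [|n IH] z.
  rewrite expr0 mul1r (eq_measure_integral (\d_z)).
    by rewrite integral_dirac// diracT mul1e.
  by move=> A mA _; exact: (semigroup0 fP2).
rewrite -natr1.
have -> : (\int[Pc 2 (n%:R + 1)%R z]_y (lyap c y)%:E =
    \int[kcomp (Pc 2 n%:R%R) (kernel.kernel_snd (Pc 2 1%R)) z]_y (lyap c y)%:E)%E.
  apply: eq_measure_integral => A mA _.
  by rewrite (semigroupD fP2).
rewrite integral_kcomp//.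
apply: (@le_trans _ _ (\int[Pc 2 n%:R%R z]_y (r%:E * (lyap c y)%:E))%E).
  apply: ge0_le_integral => //.
  - by move=> y _; exact: integral_ge0.
  - apply: measurable_fun_integral_kernel => //.
    by move=> B mB; exact: measurable_kernel.
  - exact: measurable_funeM.
  - by move=> y _; rewrite -EFinM; exact: step.
rewrite ge0_integralZl//; last by rewrite lee_fin ltW.
apply: le_trans (lee_wpmul2l _ (IH z)) _; first by rewrite lee_fin ltW.
by rewrite -EFinM mulrA exprS.
Qed.

Lemma rds_coalescence : exists c r : R, [/\ 0 < c, 0 < r < 1 &
  forall n x y, x <= y ->
    (Pr [set w | (phi n%:R w x != phi n%:R w y)%R] <= (r ^+ n * (1 + c * (y - x)))%:E)%E].
Proof.
have [c [r [c0 /andP[r0 r1] step]]] := lyap_one_step.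
exists c, r; split => //; first by rewrite r0.
move=> n x y xy; have c0' := ltW c0.
have n0 : 0 <= n%:R :> R by [].
have mlyap : measurable_fun setT (fun z : 2.-tuple R => (lyap c z)%:E).
  by apply/measurable_EFinP; exact: measurable_lyap.
have lyap0 (z : 2.-tuple R) : (0 <= (lyap c z)%:E)%E by rewrite lee_fin lyap_ge0.
have mF := measurable_flow_pair y x n0.
have mE : measurable [set w | phi n%:R w x != phi n%:R w y].
  rewrite (_ : [set w | _] = (fun w => phi n%:R w x - phi n%:R w y) @^-1` (~` [set 0])).
    rewrite -[X in measurable X]setTI.
    have mB : measurable_fun setT (fun w => phi n%:R w x - phi n%:R w y).
      by apply: measurable_funB; exact: measurable_rds_fixed.
    by apply: mB => //; exact: measurableC.
  by apply/seteqP; split => w /=; rewrite -subr_eq0 => /eqP.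
apply: (@le_trans _ _ (\int[Pr]_w (lyap c (flow_pair y x n%:R%R w))%:E)%E).
  rewrite -[X in Pr X]setIT -integral_indic//.
  apply: ge0_le_integral => //.
  - by apply/measurable_EFinP; exact: measurable_indic.
  - exact: (measurableT_comp mlyap mF).
  - move=> w _; rewrite lee_fin indicE /lyap /= !(tnth_nth 0)/=.
    have := rds_mono w n0 xy; rewrite le_eqVlt => /predU1P[e|lt].
      by rewrite memNset/=; [case: ifP => //; rewrite e ltxx|rewrite e eqxx].
    rewrite lt mem_set/=; last by rewrite lt_eqF.
    by rewrite lerDl mulr_ge0// subr_ge0 ltW.
have -> : (\int[Pr]_w (lyap c (flow_pair y x n%:R%R w))%:E = \int[Pc 2 n%:R%R [tuple y;
  x]]_z (lyap c z)%:E)%E.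
  pose B1 := isMeasurableFun.Build _ _ _ _ _ mF.
  pose Z1 : {mfun T >-> 2.-tuple R} := HB.pack (flow_pair y x n%:R) B1.
  transitivity (\int[distribution Pr Z1]_y (lyap c y)%:E)%E.
    by rewrite ge0_integral_distribution.
  by apply: eq_measure_integral => A mA _; rewrite semigroup_flow_pair.
apply: le_trans (lyap_iterate c0 r0 step n _) _.
rewrite lee_fin; apply: ler_wpM2l; first by rewrite exprn_ge0// ltW.
rewrite /lyap /= !(tnth_nth 0)/=; case: ifPn => // _.
by rewrite addr_ge0// mulr_ge0// subr_ge0.
Qed.

(** A single coordinate never meets another one: its stopped process is the
    process itself, so the one-point motion has the law of the solution. *)
Lemma rds_moment : exists2 m : R, 0 <= m & (\int[Pr]_w `|phi 1 w 0|%R%:E <= m%:E)%E.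
Proof.
have [P1 [[fP1 [d' [T' [Pr' [w [X [Ww solX P1E]]]]]]] [Pind HP]]] := coalescing_until_meeting
  coal.
have P1_0 : forall x A, measurable A -> P1 0 x A = \d_x A by exact: (semigroup0 fP1).
have [indP stopP] := HP 1%N isT.
have no_meet (f : R -> 1.-tuple R) : meeting_time f = +oo%E.
  rewrite /meeting_time; rewrite (_ : [set t | _] = set0) ?image_set0 ?ereal_inf0//.
  by apply/seteqP; split => // t [_ [i [j]]]; rewrite (ord1 i) (ord1 j) eqxx => -[].
have stoppedE S (Y : R -> S -> 1.-tuple R) : stopped Y = Y.
  by apply/funext => t; apply/funext => s; rewrite /stopped no_meet (min_idPl _) ?leey.
have mS t : 0 <= t -> measurable_fun setT (solution_single X 0 t).
  by move=> t0; exact: (measurableT_comp (@measurable_tuple1 R) (solution_measurable (solX 0)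
    t0)).
have mF t : 0 <= t -> measurable_fun setT (fun w => [tuple phi t w 0]).
  by move=> t0; exact: (measurableT_comp (@measurable_tuple1 R) (measurable_rds_fixed 0 t0)).
have law := stopP [tuple 0] _ _ _ _ _ _ _ _ (feller_flow_single 0)
  (feller_single L0 aL Ww solX P1E P1_0 0 indP).
rewrite !stoppedE in law; have {}law := law mF mS.
have one : `[0%R, +oo[%classic (1 : R) by rewrite /= in_itv/= andbT ler01.
have mf : measurable_fun setT (fun z : 1.-tuple R => `|thead z|%:E).
  apply/measurable_EFinP; apply: measurableT_comp => //; exact: measurable_thead.
have f0 (z : 1.-tuple R) : (0 <= `|thead z|%:E)%E by rewrite lee_fin.
exists (`|a 0| + (1 + L) * 4); first by rewrite addr_ge0// mulr_ge0// addr_ge0.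
have -> := same_law_at law one (mF _ ler01) (mS _ ler01) mf f0.
have mU := measurable_wiener_size Ww; have U0 := wiener_size_ge0 w.
have mUE : measurable_fun setT (fun o => (wiener_size w o)%:E) by exact/measurable_EFinP.
have L1 : 0 <= 1 + L by rewrite addr_ge0.
apply: (@le_trans _ _ (\int[Pr']_o (`|a 0|%R%:E + (1 + L)%:E * (wiener_size w o)%:E))%E).
  apply: ae_ge0_le_integral => //.
  - exact: (measurableT_comp mf (mS _ ler01)).
  - by move=> o _; rewrite adde_ge0 ?mule_ge0 ?lee_fin.
  - by apply: emeasurable_funD => //; exact: measurable_funeM.
  - apply: filterS (solution_bound L0 aL lambda_gt0 a_diss Ww solX) => o bnd _.
    by rewrite -EFinM -EFinD lee_fin.
rewrite ge0_integralD//; last 2 first.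
- by move=> o _; rewrite mule_ge0// lee_fin.
- exact: measurable_funeM.
rewrite integral_cst// [X in (_ * X)%E](_ : _ = 1%E) ?mule1; last exact: probability_setT.
rewrite [leRHS]EFinD leeD2l// ge0_integralZl//; last by move=> o _; rewrite lee_fin.
rewrite [leRHS]EFinM; apply: lee_wpmul2l; first by rewrite lee_fin.
exact: wiener_size_moment.
Qed.

End semigroups.
End rds.

(** * Stationary points *)

Lemma lebesgue_measure_translate (R : realType) (t : R) (A : set (measurableTypeR R)) :
  measurable A -> lebesgue_measure ((fun s : measurableTypeR R => s - t) @^-1` A) =
    lebesgue_measure A.
Proof.
move=> mA; pose M := measurableTypeR R.
have mf : measurable_fun setT (fun s : M => (s - t : M)) by exact: measurable_funB.
have [m mE] := @restricted_image_measure R _ M _ M (@lebesgue_measure R) setT _ measurableT mf.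
have := mE _ mA; rewrite setTI => <-.
apply/esym; apply: lebesgue_measure_unique => // _ [[x y] _ <-] /=.
rewrite mE; last exact: measurable_itv.
rewrite setTI (_ : _ @^-1` _ = `](x + t), (y + t)]%classic).
  rewrite lebesgue_measure_itv [RHS](@lebesgue_measure_itv R `](x + t), (y + t)])/= !lte_fin
    ltrD2r; case: ifP => // _.
  by rewrite -!EFinB; congr (_%:E); ring.
apply/seteqP; split => s /=; rewrite !in_itv/= => /andP[? ?]; apply/andP; split; lra.
Qed.

(** The upper limit serves as a measurable choice of a limit: it is always
    defined, and is the expected value for an eventually constant sequence. *)
Lemma limn_esup_eventually (R : realType) (u : nat -> R) (c : R) (N : nat) :
  (forall n, (N <= n)%N -> u n = c) -> limn_esup (fun n => (u n)%:E) = c%:E.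
Proof.
move=> uc; have H : (u n)%:E @[n --> \oo] --> c%:E.
  by apply: cvg_near_cst; exists N => // n /= Nn; rewrite uc.
rewrite is_cvg_limn_esupE; last by apply/cvg_ex; exists c%:E.
exact/cvg_lim.
Qed.

Lemma cvg0_lt (R : realType) (u : nat -> \bar R) (e : R) :
  u n @[n --> \oo] --> 0%E -> 0 < e -> \forall n \near \oo, (u n < e%:E)%E.
Proof.
by move=> u0 e0; apply: (u0 [set y | (y < e%:E)%E]); apply: open_ereal_lt'; rewrite lte_fin.
Qed.

Section stationary.
Context (R : realType) (a : R -> R) (d : measure_display) (T : measurableType d).
Variables (Pr : probability T R) (theta : R -> T -> T) (phi : R -> T -> R -> R).
Hypothesis H : arratia_rds Pr a theta phi.
Variables c r : R.
Hypotheses (c0 : 0 < c) (r01 : 0 < r < 1).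
Hypothesis coalescence : forall n x y, x <= y ->
  (Pr [set w | (phi n%:R w x != phi n%:R w y)%R] <= (r ^+ n * (1 + c * (y - x)))%:E)%E.

Let mtheta t : measurable_fun setT (theta t).
Proof.
exact: (measurableT_comp (group_measurable (rds_group H)) (measurable_pair1 t)).
Qed.

Let theta0 w : theta 0 w = w. Proof. exact: (group0 (rds_group H)). Qed.
Let thetaD s t w : theta (s + t) w = theta s (theta t w).
Proof. exact: (groupD (rds_group H)). Qed.
Let thetaNK s w : theta s (theta (- s) w) = w.
Proof. by rewrite -thetaD addrN theta0. Qed.
Let thetaC s t w : theta s (theta t w) = theta t (theta s w).
Proof. by rewrite -!thetaD addrC. Qed.
Let Pr_theta t A : measurable A -> Pr (theta t @^-1` A) = Pr A.
Proof. exact: (group_preserving (rds_group H)). Qed.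

Let ae_theta t (Q : T -> Prop) : {ae Pr, forall w, Q w} -> {ae Pr, forall w, Q (theta t w)}.
Proof.
move=> [N [mN N0 sub]]; exists (theta t @^-1` N); split.
- by rewrite -[X in measurable X]setTI; exact: mtheta.
- by rewrite Pr_theta.
- by move=> w /= Qw; exact: sub.
Qed.

(** Integer times suffice for uniqueness, and the exceptional null set may depend
    on the time: a weak property that limits of pullbacks enjoy. *)
Definition crude_stationary (eta : T -> R) :=
  measurable_fun setT eta /\
  forall n : nat, {ae Pr, forall w, eta (theta n%:R w) = phi n%:R w (eta w)}.

Let measurable_neq (f g : T -> R) : measurable_fun setT f -> measurable_fun setT g ->
  measurable [set w | f w != g w].
Proof.
move=> mf mg; rewrite (_ : [set w | _] = (fun w => f w - g w) @^-1` (~` [set 0])).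
  rewrite -[X in measurable X]setTI.
  have mB : measurable_fun setT (fun w => f w - g w) by exact: measurable_funB.
  by apply: mB => //; exact: measurableC.
by apply/seteqP; split => w /=; rewrite -subr_eq0 => /eqP.
Qed.

Let measurable_big (f : T -> R) (K : R) : measurable_fun setT f ->
  measurable [set w | K < `|f w|].
Proof.
move=> mf; rewrite (_ : [set w | _] = (fun w => `|f w|) @^-1` `]K, +oo[).
  rewrite -[X in measurable X]setTI.
  have mB : measurable_fun setT (fun w => `|f w|) by exact: measurableT_comp.
  exact: mB.
by apply/seteqP; split => w /=; rewrite in_itv/= andbT.
Qed.

Let coalescence_cvg K : (r ^+ n * (1 + c * K)) @[n --> \oo] --> 0.
Proof.
rewrite -(mul0r (1 + c * K)); apply: cvgMl; apply: cvg_expr.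
by have /andP[r0 r1] := r01; rewrite ger0_norm// ltW.
Qed.

Let tail_cvg (f : T -> R) : measurable_fun setT f ->
  (Pr [set w | (k%:R < `|f w|)%R] @[k --> \oo] --> 0)%E.
Proof.
move=> mf; pose F k := [set w | k%:R < `|f w|].
have -> : 0%E = Pr (\bigcap_k F k).
  rewrite (_ : \bigcap_k F k = set0) ?measure0//.
  apply/seteqP; split => // w Hw.
  have := Hw (Num.trunc `|f w|).+1 I; rewrite /F/=.
  by rewrite ltNge (ltW (truncnS_gt _)).
apply: nonincreasing_cvg_mu.
- by apply: le_lt_trans (ltry 1); apply: probability_le1; exact: measurable_big.
- by move=> k; exact: measurable_big.
- by apply: bigcapT_measurable => k; exact: measurable_big.
- move=> i j ij; apply/subsetPset => w /=; apply: le_lt_trans.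
  by rewrite ler_nat.
Qed.

(** With high probability two stationary points lie in a fixed bounded
    interval, which the flow squeezes to one point after a long time. *)
Lemma crude_stationary_unique eta eta' :
  crude_stationary eta -> crude_stationary eta' -> {ae Pr, forall w, eta' w = eta w}.
Proof.
move=> [m1 s1] [m2 s2].
pose E := [set w | eta' w != eta w].
have mE : measurable E by exact: measurable_neq.
exists E; split => //; last by move=> w /= /eqP.
apply/eqP; rewrite eq_le measure_ge0 andbT.
apply/lee_addgt0Pr => e e0; rewrite add0e.
have e30 : 0 < e / 3 by rewrite divr_gt0.
have [K [K1 K2]] : exists K : nat, (Pr [set w | (K%:R < `|eta w|)%R] < (e / 3)%:E)%E /\
    (Pr [set w | (K%:R < `|eta' w|)%R] < (e / 3)%:E)%E.
  have [N1 _ h1] := cvg0_lt (tail_cvg m1) e30.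
  have [N2 _ h2] := cvg0_lt (tail_cvg m2) e30.
  by exists (maxn N1 N2); split; [apply: h1|apply: h2]; rewrite /= ?leq_maxl ?leq_maxr.
have Kge0 : 0 <= K%:R :> R by [].
have KK : - K%:R <= K%:R :> R by lra.
have [n Hn] : exists n, r ^+ n * (1 + c * (K%:R - - K%:R)) < e / 3.
  have /cvgrPdist_lt/(_ _ e30)[n _ h] := coalescence_cvg (K%:R - - K%:R).
  exists n; have := h n (leqnn n); rewrite /= sub0r normrN.
  by apply: le_lt_trans; exact: ler_norm.
have n0 : 0 <= n%:R :> R by [].
have mn := @mtheta n%:R.
rewrite -(Pr_theta n%:R mE).
have [N1 [mN1 N10 sub1]] := s1 n; have [N2 [mN2 N20 sub2]] := s2 n.
set B1 := [set w | (K%:R < `|eta w|)%R] in K1.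
set B2 := [set w | (K%:R < `|eta' w|)%R] in K2.
pose S := [set w | phi n%:R w (- K%:R) != phi n%:R w K%:R].
have mB1 : measurable B1 by exact: measurable_big.
have mB2 : measurable B2 by exact: measurable_big.
have mS : measurable S by apply: measurable_neq; exact: (measurable_rds_fixed H).
have PS : (Pr S <= (e / 3)%:E)%E.
  by apply: le_trans (coalescence n KK) _; rewrite lee_fin ltW.
have mU1 := measurableU _ _ mN1 mN2; have mU2 := measurableU _ _ mB1 mB2.
have mU3 := measurableU _ _ mU2 mS; have mU4 := measurableU _ _ mU1 mU3.
apply: (@le_trans _ _ (Pr ((N1 `|` N2) `|` ((B1 `|` B2) `|` S)))).
  apply: le_measure; rewrite ?inE//.
    by rewrite -[X in measurable X]setTI; exact: mn.
  move=> w /= Ew.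
  have [|nN1] := pselect (N1 w); first by left; left.
  have [|nN2] := pselect (N2 w); first by left; right.
  have e1 : eta (theta n%:R w) = phi n%:R w (eta w).
    by apply: contrapT => /sub1.
  have e2 : eta' (theta n%:R w) = phi n%:R w (eta' w).
    by apply: contrapT => /sub2.
  right; have [|nB1] := pselect (B1 w); first by left; left.
  have [|nB2] := pselect (B2 w); first by left; right.
  right; rewrite /S/=; apply: contra_neq Ew => eqS.
  rewrite e1 e2.
  move: nB1 nB2 => /= /negP; rewrite -leNgt ler_norml => /andP[l1 u1].
  move=> /negP; rewrite -leNgt ler_norml => /andP[l2 u2].
  have const z : - K%:R <= z -> z <= K%:R -> phi n%:R w z = phi n%:R w K%:R.
    move=> lz uz; apply/eqP; rewrite eq_le (rds_mono H)//=.
    by rewrite -eqS (rds_mono H).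
  by rewrite !const.
apply: le_trans (measureU2 _ mU1 mU3) _.
rewrite [X in (X + _)%E](_ : _ = 0%E) ?add0e; last exact: null_set_setU.
apply: le_trans (measureU2 _ mU2 mS) _.
have -> : e = e / 3 + e / 3 + e / 3 by field.
rewrite !EFinD; apply: leeD => //.
apply: le_trans (measureU2 _ mB1 mB2) _.
by apply: leeD; exact: ltW.
Qed.

Section existence.
Variable m : R.
Hypotheses (m0 : 0 <= m) (moment : (\int[Pr]_w `|phi 1 w 0|%R%:E <= m%:E)%E).

Definition pullback (n : nat) (w : T) : R := phi n%:R (theta (- n%:R) w) 0.

Lemma measurable_pullback n : measurable_fun setT (pullback n).
Proof.
exact: (measurable_rds_comp H (f := fun=> n%:R) (g := theta (- n%:R)) (h := fun=> 0)).
Qed.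

Let pullbackS n w : pullback n.+1 w =
  phi n%:R (theta (- n%:R) w) (phi 1 (theta (- n.+1%:R) w) 0).
Proof.
rewrite /pullback -{1}natr1 (rdsD H)//; congr (phi _ _ _).
by rewrite -thetaD -natr1 opprD addrCA addrN addr0.
Qed.

Let tail_prob K : 0 < K -> (Pr [set w | (K < `|phi 1 w 0|)%R] <= (m / K)%:E)%E.
Proof.
move=> K0.
have mf : measurable_fun setT (fun w => phi 1 w 0) by exact: (measurable_rds_fixed H).
have mEf : measurable_fun setT (fun w => (phi 1 w 0)%:E) by exact/measurable_EFinP.
have := le_integral_abse Pr measurableT mEf K0.
rewrite setTI => HM.
have mB : measurable [set w | (K%:E <= `|(phi 1 w 0)%:E|)%E].
  rewrite -[X in measurable X]setTI.
  by apply: emeasurable_fun_c_infty => //; exact: measurableT_comp.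
have : (K%:E * Pr [set w | (K < `|phi 1 w 0|)%R] <= m%:E)%E.
  apply: le_trans moment; apply: le_trans HM.
  apply: lee_wpmul2l; first by rewrite lee_fin ltW.
  apply: le_measure; rewrite ?inE//; first exact: measurable_big.
  by move=> w /= /ltW; rewrite lee_fin.
have fP : Pr [set w | (K < `|phi 1 w 0|)%R] \is a fin_num.
  by rewrite fin_num_measure//; exact: measurable_big.
by rewrite -(fineK fP) -EFinM !lee_fin ler_pdivlMr// mulrC.
Qed.

Let changed n := [set w | pullback n.+1 w != pullback n w].

Let m_changed n : measurable (changed n).
Proof. by apply: measurable_neq; exact: measurable_pullback. Qed.

Let q := Num.sqrt r.

Let q01 : 0 < q < 1.
Proof.
have /andP[r0 r1] := r01.
by rewrite /q sqrtr_gt0 r0 -[ltRHS]sqrtr1 ltr_sqrt.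
Qed.

(** The maps [pullback n] and [pullback n.+1] apply the same flow map over
    [-n, 0] to 0 and to the position at time -n of the trajectory started one
    unit earlier. The latter lies within K = q^-n up to probability m q^n, and
    [-K, K] fails to be squeezed with probability of order r^n K = q^n, which
    explains the choice q^2 = r. *)
Let changed_prob n : (Pr (changed n) <= ((m + 1 + 2 * c) * q ^+ n)%:E)%E.
Proof.
have /andP[q0 q1] := q01; have /andP[r0 r1] := r01.
pose K := (q ^+ n)^-1.
have K0 : 0 < K by rewrite invr_gt0 exprn_gt0.
have KK : - K <= K by lra.
have n0 : 0 <= n%:R :> R by [].
pose A := theta (- n.+1%:R) @^-1` [set w | K < `|phi 1 w 0|].
pose B := theta (- n%:R) @^-1` [set w | phi n%:R w (- K) != phi n%:R w K].
have mA' : measurable [set w | K < `|phi 1 w 0|].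
  by apply: measurable_big; exact: (measurable_rds_fixed H).
have mB' : measurable [set w | phi n%:R w (- K) != phi n%:R w K].
  by apply: measurable_neq; exact: (measurable_rds_fixed H).
have mA : measurable A by rewrite -[X in measurable X]setTI; exact: mtheta.
have mB : measurable B by rewrite -[X in measurable X]setTI; exact: mtheta.
apply: (@le_trans _ _ (Pr (A `|` B))).
  apply: le_measure; rewrite ?inE//; first exact: measurableU.
  move=> w /= cw; have [|nA] := pselect (A w); [by left|right].
  rewrite /B/=; apply: contra_neq cw => eqB.
  rewrite pullbackS /pullback.
  move: nA; rewrite /A/= => /negP; rewrite -leNgt ler_norml => /andP[l u].
  have const z : - K <= z -> z <= K -> phi n%:R (theta (- n%:R) w) z = phi n%:R (theta (-
    n%:R) w) K.
    move=> lz uz; apply/eqP; rewrite eq_le (rds_mono H)//=.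
    by rewrite -eqB (rds_mono H).
  by rewrite !const// ltW// oppr_lt0.
apply: le_trans (measureU2 _ mA mB) _.
rewrite [X in (X + _)%E](Pr_theta _ mA') [X in (_ + X)%E](Pr_theta _ mB').
apply: le_trans (leeD (tail_prob K0) (coalescence n KK)) _.
rewrite -EFinD lee_fin.
have rE : r ^+ n = q ^+ n * q ^+ n.
  by rewrite -exprMn -expr2 /q sqr_sqrtr// ltW.
have qn0 : 0 < q ^+ n by rewrite exprn_gt0.
have qn1 : q ^+ n <= 1 by rewrite exprn_ile1// ltW.
have -> : m / K = m * q ^+ n by rewrite /K invrK.
have -> : r ^+ n * (1 + c * (K - - K)) = q ^+ n * q ^+ n + 2 * c * q ^+ n.
  rewrite rE /K; field; by rewrite gt_eqF.
have : q ^+ n * q ^+ n <= q ^+ n by rewrite ler_piMr// ltW.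
lra.
Qed.

(** By the Borel-Cantelli lemma the pullback from the past is eventually
    constant, not merely convergent; this is what lets the discontinuous flow
    maps be applied to its limit. *)
Lemma pullback_stabilizes : {ae Pr, forall w,
  exists N, forall n, (N <= n)%N -> pullback n w = pullback N w}.
Proof.
have /andP[q0 q1] := q01.
have sum_fin : (\sum_(n <oo) Pr (changed n) < +oo)%E.
  pose C := m + 1 + 2 * c.
  have C0 : 0 <= C by rewrite !addr_ge0// mulr_ge0// ltW.
  apply: (@le_lt_trans _ _ (\sum_(n <oo) (geometric C q n)%:E)%E).
    by apply: lee_nneseries => n _ //; exact: changed_prob.
  have cv : (series (geometric C q) n @[n --> \oo] --> C / (1 - q)).
    by apply: cvg_geometric_series; rewrite ger0_norm// ltW.
  have : ((\sum_(0 <= k < n) (geometric C q k)%:E)%E @[n --> \oo] --> (C / (1 - q))%:E).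
    under eq_fun do rewrite sumEFin.
    by apply: cvg_EFin => //; exact: nearW.
  by move=> /cvg_lim -> //; rewrite ltry.
have := lim_sup_set_cvg0 m_changed sum_fin.
move=> null; exists (lim_sup_set changed); split => //.
  apply: bigcapT_measurable => n; apply: bigcup_measurable => k _; exact: m_changed.
move=> w /= H1 N _ /=; apply: contrapT => H2; apply: H1.
exists N => n; elim: n => [|n IH]; first by rewrite leqn0 => /eqP ->.
rewrite leq_eqVlt => /predU1P[<-//|]; rewrite ltnS => Nn.
rewrite -(IH Nn); apply/eqP/negPn/negP => Hn; apply: H2.
by exists n.
Qed.

Definition pullback_limit (w : T) : R := fine (limn_esup (fun n => (pullback n w)%:E)).

Let pullback_limitE w v N : (forall n, (N <= n)%N -> pullback n w = v) ->
  pullback_limit w = v.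
Proof. by move=> Hw; rewrite /pullback_limit (limn_esup_eventually Hw). Qed.

(** Shifting by an integer time n applies the flow map over [0, n] to a pullback
    from the past; as the pullbacks are eventually equal to their limit, the
    flow map can be applied to the limit itself. *)
Lemma pullback_limit_crude : crude_stationary pullback_limit.
Proof.
split.
  apply/measurable_EFinP/measurable_EFinP.
  apply: (measurableT_comp (f := fine)) => //.
  apply: measurable_fun_limn_esup => n; apply/measurable_EFinP.
  exact: measurable_pullback.
move=> n; apply: filterS pullback_stabilizes => w [N HN].
rewrite (pullback_limitE HN); apply: (pullback_limitE (N := (N + n)%N)) => k Nk.
have nk : (n <= k)%N by exact: leq_trans (leq_addl _ _) Nk.
have -> : k = (n + (k - n))%N by rewrite subnKC.
rewrite -(HN (k - n)%N) ?leq_subRL//; last by rewrite addnC.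
rewrite /pullback natrD (rdsD H)//; set v := (k - n)%:R.
have e1 : theta v (theta (- (n%:R + v)) (theta n%:R w)) = w.
  by rewrite -!thetaD (_ : v + - (n%:R + v) + n%:R = 0) ?theta0//; ring.
have e2 : theta (- (n%:R + v)) (theta n%:R w) = theta (- v) w.
  by rewrite -thetaD; congr (theta _ w); ring.
by rewrite e1 e2.
Qed.

End existence.

(** * From crude to perfect stationarity *)
Section perfection.
Variable eta0 : T -> R.
Hypothesis crude0 : crude_stationary eta0.

Let meta0 : measurable_fun setT eta0. Proof. by case: crude0. Qed.

(** The image at time s of a crude stationary point is again crude stationary,
    so that uniqueness upgrades integer times to real times. *)
Lemma crude_stationary_real s : 0 <= s ->
  {ae Pr, forall w, phi s (theta (- s) w) (eta0 (theta (- s) w)) = eta0 w}.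
Proof.
move=> s0.
apply: (@crude_stationary_unique eta0 (fun w => phi s (theta (- s) w) (eta0 (theta (- s) w))))
  => //.
have me : measurable_fun setT (fun w => eta0 (theta (- s) w)).
  by apply: measurableT_comp => //; exact: mtheta.
split.
  exact: (measurable_rds_comp H (f := fun=> s) (g := theta (- s)) (h := fun w => eta0 (theta
    (- s) w))).
move=> n; apply: filterS (ae_theta (- s) (crude0.2 n)) => w Hw.
have n0 : 0 <= n%:R :> R by [].
rewrite (thetaC (- s) n%:R w) Hw -(rdsD H)// addrC (rdsD H)//.
by rewrite thetaNK.
Qed.

Let M := measurableTypeR R.
Let leb : {sigma_finite_measure set M -> \bar R} := @lebesgue_measure R.

(** The state at time 0 of the trajectory started at time -s from the crude
    stationary point at that time. *)
Definition pushed (s : R) (w : T) : R :=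
  phi (Num.max 0 s) (theta (- Num.max 0 s) w) (eta0 (theta (- Num.max 0 s) w)).

Let mpushed : measurable_fun setT (fun p : M * T => pushed p.1 p.2).
Proof.
have mm : measurable_fun setT (fun p : M * T => Num.max 0 p.1 : R).
  by apply: measurable_maxr => //; exact: measurable_fst.
have mth : measurable_fun setT (fun p : M * T => theta (- Num.max 0 p.1) p.2).
  apply: (measurableT_comp (f := fun q : R * T => theta q.1 q.2) (group_measurable (rds_group
    H))
    (g := fun p : M * T => (- Num.max 0 p.1, p.2))).
  apply: measurable_fun_pair; last exact: measurable_snd.
  by apply: measurableT_comp.
apply: (measurable_rds_comp H (f := fun p : M * T => Num.max 0 p.1)
  (g := fun p : M * T => theta (- Num.max 0 p.1) p.2)
  (h := fun p : M * T => eta0 (theta (- Num.max 0 p.1) p.2))) => //.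
  by move=> p; rewrite le_max lexx.
by apply: measurableT_comp.
Qed.

(** By the cocycle property, for every w and not merely almost surely: both sides
    start from the crude stationary point at the same shift of w. *)
Lemma pushed_shift s t w : 0 <= s -> 0 <= t ->
  pushed (s + t) (theta t w) = phi t w (pushed s w).
Proof.
move=> s0 t0; rewrite /pushed !(max_idPr _) ?addr_ge0//.
have -> : theta (- (s + t)) (theta t w) = theta (- s) w.
  by rewrite -thetaD; congr (theta _ w); ring.
by rewrite addrC (rdsD H)// thetaNK.
Qed.

Let mpushed1 w : measurable_fun setT (fun s : M => pushed s w).
Proof. exact: (measurableT_comp mpushed (measurable_pair2 w)). Qed.

Definition off_value (N : R) (w : T) (v : R) : set M := [set s : M | N <= s /\ pushed s w != v].

Let m_off N w v : measurable (off_value N w v).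
Proof.
rewrite (_ : off_value N w v = `[N, +oo[ `&` (fun s : M => pushed s w) @^-1` (~` [set v])).
  apply: measurableI => //; rewrite -[X in measurable X]setTI.
  by apply: mpushed1 => //; exact: measurableC.
by apply/seteqP; split => s /=; rewrite in_itv/= andbT => -[? /eqP ?].
Qed.

(** Unlike an almost sure identity at each time, this property of w is stable
    under the shifts; see [eventual_value_shift]. *)
Definition eventual_value (w : T) (v : R) := exists N : nat, leb (off_value N%:R w v) = 0%E.

Definition pushed_average (n : nat) (w : T) : \bar R :=
  (\int[leb]_s ((expR (pushed s w) * \1_(`[n%:R, n.+1%:R]%classic : set M) s)%:E))%E.

Let mexp n : measurable_fun setT (fun p : M * T =>
  (expR (pushed p.1 p.2) * \1_(`[n%:R, n.+1%:R]%classic : set M) p.1)%:E).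
Proof.
apply/measurable_EFinP; apply: measurable_funM.
  by apply: measurableT_comp => //; exact: measurable_expR.
have mI : measurable_fun setT (\1_(`[n%:R, n.+1%:R]%classic : set M) : M -> R) by exact:
  measurable_indic.
exact: (measurableT_comp mI measurable_fst).
Qed.

Let mexp0 n (p : M * T) :
  (0 <= (expR (pushed p.1 p.2) * \1_(`[n%:R, n.+1%:R]%classic : set M) p.1)%:E)%E.
Proof. by rewrite lee_fin mulr_ge0// ?expR_ge0// indicE. Qed.

(** A measurable formula for the eventual value: averages over [n, n.+1] ignore
    null sets of times. The exponential makes the integrand nonnegative, so that
    the averages are defined and measurable in w by the Tonelli theorem. *)
Definition perfect (w : T) : R := ln (fine (limn_esup (pushed_average ^~ w))).

Lemma measurable_perfect : measurable_fun setT perfect.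
Proof.
apply: (measurableT_comp (f := @ln R)) => //; apply: (measurableT_comp (f := fine)) => //.
apply: measurable_fun_limn_esup => n.
exact: (@measurable_fun_fubini_tonelli_G _ _ M T R leb _ (mexp n) (mexp0 n)).
Qed.

Lemma perfectE w v : eventual_value w v -> perfect w = v.
Proof.
move=> [N HN]; rewrite /perfect.
suff Hn n : (N <= n)%N -> pushed_average n w = (expR v)%:E.
  have -> : limn_esup (pushed_average ^~ w) = (expR v)%:E.
    rewrite is_cvg_limn_esupE.
      by apply/cvg_lim => //; apply: cvg_near_cst; exists N.
    by apply/cvg_ex; exists (expR v)%:E; apply: cvg_near_cst; exists N.
  by rewrite /= expRK.
move=> Nn; rewrite /pushed_average.
have mI : measurable (`[n%:R, n.+1%:R]%classic : set M) by exact: measurable_itv.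
rewrite (_ : (expR v)%:E = \int[leb]_s ((expR v)%:E * (\1_(`[n%:R, n.+1%:R]%classic : set M)
  s)%:E))%E; last first.
  rewrite ge0_integralZl//.
  - rewrite integral_indic// setIT [X in (_ * X)%E](@lebesgue_measure_itv R `[n%:R, n.+1%:R])/=.
    by rewrite lte_fin ltr_nat ltnSn -EFinB -natr1 addrAC subrr add0r mule1.
  - by apply/measurable_EFinP; exact: measurable_indic.
apply: ge0_ae_eq_integral => //.
- exact: (measurableT_comp (mexp n) (measurable_pair2 w)).
- by apply: measurable_funeM; apply/measurable_EFinP; exact: measurable_indic.
exists (off_value N%:R w v); split => // s /= Hs.
apply: contrapT => off; apply: Hs => _; rewrite -EFinM; congr (_%:E).
rewrite indicE; case: (boolP (s \in _)) => [sI|_]; last by rewrite !mulr0.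
rewrite inE/= in_itv/= in sI; have /andP[ns _] := sI.
congr (expR _ * _); apply: contrapT => /eqP sv; apply: off; split => //.
by apply: le_trans ns; rewrite ler_nat.
Qed.

Definition perfect_set : set T := [set w | eventual_value w (perfect w)].

Let m_off_perfect (N : nat) (f : T -> R) : measurable_fun setT f ->
  measurable [set p : M * T | N%:R <= p.1 /\ pushed p.1 p.2 != f p.2].
Proof.
move=> mf.
have mB : measurable_fun setT (fun p : M * T => pushed p.1 p.2 - f p.2).
  by apply: measurable_funB => //; exact: (measurableT_comp mf measurable_snd).
rewrite (_ : [set p | _] = ((fst : M * T -> M) @^-1` `[N%:R, +oo[) `&`
    ((fun p : M * T => pushed p.1 p.2 - f p.2) @^-1` (~` [set 0]))).
  apply: measurableI; rewrite -[X in measurable X]setTI.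
    by apply: measurable_fst.
  by apply: mB => //; exact: measurableC.
apply/seteqP; split => p /=; rewrite in_itv/= andbT => -[? H0]; split => //.
  by apply/eqP; rewrite subr_eq0.
by rewrite -subr_eq0; apply/eqP.
Qed.

Let section_off (N : nat) (f : T -> R) w :
  ysection [set p : M * T | N%:R <= p.1 /\ pushed p.1 p.2 != f p.2] w = off_value N%:R w (f w).
Proof. by apply/seteqP; split => s; rewrite /ysection/= inE. Qed.

Lemma measurable_perfect_set : measurable perfect_set.
Proof.
rewrite (_ : perfect_set = \bigcup_N
    (fun w => leb (off_value N%:R w (perfect w))) @^-1` [set 0%E]); last first.
  by apply/seteqP; split => w /=; [move=> [N HN]; exists N|move=> [N _ HN]; exists N].
apply: bigcupT_measurable => N; rewrite -[X in measurable X]setTI.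
have mS := measurable_fun_ysection leb (m_off_perfect N measurable_perfect).
have {}mS : measurable_fun setT (fun w => leb (off_value N%:R w (perfect w))).
  by apply: eq_measurable_fun mS => w _ /=; rewrite section_off.
exact: mS.
Qed.

(** By the Tonelli theorem and [crude_stationary_real], for almost every w the
    pushed value at time s is eta0 w for almost every s. *)
Lemma perfect_set_conull : Pr perfect_set = 1%E.
Proof.
pose E := [set p : M * T | 0%:R <= p.1 /\ pushed p.1 p.2 != eta0 p.2].
have mE : measurable E by exact: m_off_perfect.
have := @indic_fubini_tonelli _ _ M T R leb Pr E mE.
rewrite indic_fubini_tonelli_FE// indic_fubini_tonelli_GE//.
rewrite (_ : (\int[leb]_x (Pr \o xsection E) x = 0)%E); last first.
  apply: integral0_eq => s _ /=.
  have [s0|s0] := leP 0 s; last first.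
    rewrite (_ : xsection E s = set0) ?measure0//.
    apply/seteqP; split => // w; rewrite /xsection/= inE => -[/=].
    by rewrite leNgt s0.
  have [N [mN N0 sub]] := crude_stationary_real s0.
  apply/eqP; rewrite eq_le measure_ge0 andbT -N0.
  apply: le_measure; rewrite ?inE//; first exact: measurable_xsection.
  move=> w; rewrite /xsection/= inE => -[/= _ sw]; apply: sub => /= e.
  by move: sw; rewrite /pushed (max_idPr s0) e eqxx.
move=> /esym int0.
have mS : measurable_fun setT (fun w => leb (ysection E w)) := measurable_fun_ysection leb mE.
have ae0 : {ae Pr, forall w, leb (ysection E w) = 0%E}.
  have := (ae_eq_integral_abs Pr measurableT mS).1.
  move=> Habs; have : ae_eq Pr setT (fun w => leb (ysection E w)) (cst 0%E).
    by apply: Habs; rewrite -[RHS]int0; apply: eq_integral => w _; rewrite gee0_abs.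
  by apply: filterS => w /(_ I).
have aeP : {ae Pr, forall w, perfect_set w}.
  apply: filterS ae0 => w; rewrite section_off => null.
  have ev : eventual_value w (eta0 w) by exists 0%N.
  by rewrite /perfect_set/= (perfectE ev).
have [N [mN N0 sub]] := aeP.
have null : Pr (~` perfect_set) = 0%E.
  apply/eqP; rewrite eq_le measure_ge0 andbT -N0.
  by apply: le_measure; rewrite ?inE//; exact/measurableC/measurable_perfect_set.
have := @measure_setI_conull _ _ _ Pr setT _ measurableT measurable_perfect_set null.
by rewrite setTI => ->; exact: probability_setT.
Qed.

(** By [pushed_shift], the times at which the value at theta_t w is off are the
    translates by t of those for w. *)
Lemma eventual_value_shift w v t : 0 <= t -> eventual_value w v ->
  eventual_value (theta t w) (phi t w v).
Proof.
move=> t0 [N HN]; pose K := (N + (Num.trunc t).+1)%N; exists K.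
have NtK : N%:R + t <= K%:R by rewrite /K natrD lerD2l ltW// truncnS_gt.
apply/eqP; rewrite eq_le measure_ge0 andbT -HN.
have tr : leb ((fun s : M => s - t) @^-1` off_value N%:R w v) = leb (off_value N%:R w v).
  exact: lebesgue_measure_translate.
rewrite -tr.
apply: le_measure; rewrite ?inE//.
  rewrite -[X in measurable X]setTI.
  have mf : measurable_fun setT (fun s : M => (s - t : M)) by exact: measurable_funB.
  exact: mf.
move=> s [/= Ks off]; have Nst : N%:R <= s - t by lra.
split => //; apply: contra_neq off => e.
have st0 : 0 <= s - t by apply: le_trans Nst.
by rewrite -[s](subrK t) pushed_shift// e.
Qed.

End perfection.

Lemma stationary_crude (eta : {RV Pr >-> R}) :
  stationary_point theta phi eta -> crude_stationary eta.
Proof.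
move=> [T0 [mT0 T01 _ st]]; split => // n.
exists (~` T0); split; first exact: measurableC.
  by rewrite probability_setC// T01 subee.
by move=> w /= Hw T0w; apply: Hw; rewrite st.
Qed.

End stationary.

Theorem theorem2p1 (R : realType) (a : R -> R) (lambda : R)
  (a_lipschitz : exists k : R, k.-lipschitz a)
  (lambda_gt0 : 0 < lambda)
  (a_dissipative : forall x y : R,
     (a x - a y) * (x - y) <= - lambda * (x - y) ^+ 2)
  (d : measure_display) (T : measurableType d) (Pr : probability T R)
  (theta : R -> T -> T) (phi : R -> T -> R -> R)
  (phi_rds : arratia_rds Pr a theta phi) :
  exists eta : {RV Pr >-> R},
    stationary_point theta phi eta /\
    forall eta' : {RV Pr >-> R}, stationary_point theta phi eta' ->
      {ae Pr, forall w, eta' w = eta w}.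
Proof.
have [L L0 aL] := lipschitz_bound a_lipschitz.
have [_ [Pc [coal fellerPc]]] := rds_arratia phi_rds.
have [c [r [c0 r01 coalescence]]] :=
  rds_coalescence phi_rds coal fellerPc L0 aL lambda_gt0 a_dissipative.
have [m m0 moment] := rds_moment phi_rds coal fellerPc L0 aL lambda_gt0 a_dissipative.
have crude := pullback_limit_crude phi_rds c0 r01 coalescence m0 moment.
set eta0 := pullback_limit theta phi in crude.
pose etaB := isMeasurableFun.Build _ _ _ _ (perfect theta phi eta0)
  (measurable_perfect phi_rds crude).
pose eta : {RV Pr >-> R} := HB.pack (perfect theta phi eta0) etaB.
have eta_stationary : stationary_point theta phi eta.
  exists (perfect_set theta phi eta0); split.
  - exact: (measurable_perfect_set phi_rds crude).
  - exact: (perfect_set_conull phi_rds r01 coalescence crude).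
  - move=> t t0 _ [w Pw <-].
    have ev := eventual_value_shift phi_rds crude t0 Pw.
    by rewrite /perfect_set/= (perfectE phi_rds crude ev).
  - move=> w t Pw t0.
    have ev := eventual_value_shift phi_rds crude t0 Pw.
    by rewrite /= (perfectE phi_rds crude ev).
exists eta; split => // eta' st'.
apply: (crude_stationary_unique phi_rds r01 coalescence).
  exact: stationary_crude.
exact: stationary_crude.
Qed.
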